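(* Let $\{S_n\}$ be a random walk on $\mathbb{Z}^d$ and $\{\xi(z):z\in\mathbb{Z}^d\}$ a scenery satisfying the standing assumptions in the context, and let $X_n=\sum_{1\le k\le n}\xi(S_k)$. If $d\ge3$ and $(b_n)$ is a sequence with $n^{1/2}\ll b_n\ll n^{2/3}$, then, as $n\uparrow\infty$, $$\log\mathbb{P}\{X_n\ge b_n\}\sim-\frac{b_n^2}{n}\,\frac{1}{2\sigma^2\,(2G(0)-1)}.$$
   Context: Standing assumptions. $\{S_n:n\ge 0\}$ is a random walk on $\mathbb{Z}^d$ with $S_0=0$ and i.i.d. increments, which is symmetric ($S_1$ and $-S_1$ have the same law) and aperiodic in the sense of Spitzer (the additive group generated by $\{x:\mathbb{P}\{S_1=x\}>0\}$ is $\mathbb{Z}^d$), and the covariance matrix $\Gamma$ of $S_1$ is finite and nondegenerate. $\{\xi(z):z\in\mathbb{Z}^d\}$ are i.i.d. real random variables, independent of the walk, with $\mathbb{E}\xi(0)=0$, variance $\sigma^2=\mathbb{E}\xi(0)^2>0$, $\mathbb{E}|\xi(0)|^3<\infty$, and satisfying Cramér's condition: $\mathbb{E}e^{\theta\xi(0)}<\infty$ for some $\theta>0$. $\mathbb{P}$ is the joint (annealed) law of walk and scenery. For $d\ge3$, $G(x)=\sum_{k=0}^\infty\mathbb{P}\{S_k=x\}$ is the Green's function. For positive sequences, $u_n\ll v_n$ means $u_n/v_n\to0$; $u_n\sim v_n$ means $u_n/v_n\to1$. *)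

(* Defs.v *)
From HB Require Import structures.
From mathcomp Require Import all_boot all_order all_algebra finmap.
From mathcomp Require Import all_classical all_reals all_analysis.
Set Implicit Arguments.
Unset Strict Implicit.
Unset Printing Implicit Defensive.
Import Order.TTheory GRing.Theory Num.Theory.
Import numFieldNormedType.Exports.

Local Open Scope classical_set_scope.
Local Open Scope ring_scope.

(* Z^d, as an alias of 'rV[int]_d that can carry the discrete sigma-algebra. *)
Definition lattice (d : nat) : Type := 'rV[int]_d.

HB.instance Definition _ (d : nat) := GRing.Zmodule.on (lattice d).
HB.instance Definition _ (d : nat) := isPointed.Build (lattice d) 0.
HB.instance Definition _ (d : nat) :=
  @isMeasurable.Build default_measure_display (lattice d) discrete_measurable
    discrete_measurable0 discrete_measurableC discrete_measurableU.

Section law_and_independence.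
Context {dO : measure_display} {Omega : measurableType dO} {R : realType}.
Variable P : probability Omega R.

Definition same_law {dU} {U : measurableType dU} (X Y : Omega -> U) : Prop :=
  forall B : set U, measurable B -> P (X @^-1` B) = P (Y @^-1` B).

Definition mutually_independent {I : choiceType} {dU} {U : measurableType dU}
    (X : I -> Omega -> U) : Prop :=
  forall (J : {fset I}) (B : I -> set U),
    (forall i, i \in J -> measurable (B i)) ->
    P (\bigcap_(i in [set` J]) (X i @^-1` B i)) =
    (\prod_(i <- J) P (X i @^-1` B i))%E.

Definition iid {I : choiceType} {dU} {U : measurableType dU}
    (X : I -> Omega -> U) : Prop :=
  mutually_independent X /\ forall i j, same_law (X i) (X j).

Definition generated_events {I : Type} {dU} {U : measurableType dU}
    (X : I -> Omega -> U) : set (set Omega) :=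
  <<s \bigcup_i preimage_set_system setT (X i) measurable >>.

Definition independent_families {I J : Type} {dU} {U : measurableType dU}
    {dV} {V : measurableType dV}
    (X : I -> Omega -> U) (Y : J -> Omega -> V) : Prop :=
  forall A B, generated_events X A -> generated_events Y B ->
    P (A `&` B) = (P A * P B)%E.

End law_and_independence.

Section walk.
Context {dO : measure_display} {Omega : measurableType dO} {R : realType}.
Variables (P : probability Omega R) (d : nat).

Definition random_walk (S : nat -> {RV P >-> lattice d}) : Prop :=
  (forall w, S 0%N w = 0) /\ iid P (fun k w => S k.+1 w - S k w).

Definition symmetric_law (X : Omega -> lattice d) : Prop :=
  same_law P X (fun w => - X w).

(* The smallest subgroup of Z^d containing the atoms of X is Z^d itself. *)
Definition spitzer_aperiodic (X : Omega -> lattice d) : Prop :=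
  forall H : {pred lattice d}, zmod_closed H ->
    (forall x, (0 < P (X @^-1` [set x]))%E -> x \in H) ->
    forall x, x \in H.

Definition lattice_coord (X : Omega -> lattice d) (i : 'I_d) (w : Omega) : R :=
  ((X w : 'rV[int]_d) 0 i)%:~R.

(* The library's covariance is extended-real valued; for the diagonal entries
   finiteness amounts to square integrability of the coordinates. *)
Definition finite_covariance (X : Omega -> lattice d) : Prop :=
  forall i j : 'I_d,
    covariance P (lattice_coord X i) (lattice_coord X j) \is a fin_num.

Definition covariance_mx (X : Omega -> lattice d) : 'M[R]_d :=
  \matrix_(i, j) fine (covariance P (lattice_coord X i) (lattice_coord X j)).

(* Possibly +oo in general, but finite under the walk assumptions when d >= 3
   (transience), so that fine loses nothing there. *)
Definition green (S : nat -> Omega -> lattice d) (x : lattice d) : \bar R :=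
  (\sum_(0 <= k <oo) P (S k @^-1` [set x]))%E.

Record walk_assumptions (S : nat -> {RV P >-> lattice d}) : Prop := {
  walk_random_walk : random_walk S;
  walk_symmetric : symmetric_law (S 1%N);
  walk_aperiodic : spitzer_aperiodic (S 1%N);
  walk_finite_covariance : finite_covariance (S 1%N);
  walk_nondegenerate : covariance_mx (S 1%N) \in unitmx }.

(* The third moment makes the expectation and the variance genuine finite
   integrals. The Cramer condition is one-sided. *)
Record scenery_assumptions (xi : lattice d -> {RV P >-> R}) (sigma : R)
    : Prop := {
  scenery_iid : iid P xi;
  scenery_mean : ('E_P[xi 0%R] = 0)%E;
  scenery_variance : ('V_P[xi 0%R] = (sigma ^+ 2)%R%:E)%E;
  scenery_variance_gt0 : 0 < sigma ^+ 2;
  scenery_third_moment : ('E_P[(fun w => `|xi 0 w| ^+ 3)%R] < +oo)%E;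
  scenery_cramer : exists2 theta : R, 0 < theta &
    ('E_P[(fun w => expR (theta * xi 0 w))%R] < +oo)%E }.

Definition rwrs (S : nat -> Omega -> lattice d) (xi : lattice d -> Omega -> R)
    (n : nat) (w : Omega) : R :=
  \sum_(1 <= k < n.+1) xi (S k w) w.

End walk.

Definition negligible_to {R : realType} (u v : nat -> R) : Prop :=
  (fun n => u n / v n) @ \oo --> (0 : R).

(* When u n = ln (fine p), the convention ln 0 = 0 is harmless: a null
   probability gives the ratio 0, so a limit 1 forces p > 0 eventually. *)
Definition asymp_equiv {R : realType} (u v : nat -> R) : Prop :=
  (fun n => u n / v n) @ \oo --> (1 : R).

(* Main.v *)
(* Given the walk, X_n is the sum of l(z) xi(z) over the sites z, where l is the local time, so
   for small h * max l its conditional transform at h is exp(h^2 sigma^2 V_n / 2), up to a factor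
   1 + o(1) in the exponent, with V_n the sum of the l(z)^2. Put v = 2 G(0) - 1, the limit of
   E V_n / n, and c = n^(1/3). The event max l > c has probability at most exp(- c0 c), which is
   negligible because b_n^2 / n << c. Off that event and for small h c, the annealed transform at h
   is exp(h^2 sigma^2 n v / 2), again up to 1 + o(1) in the exponent. Chernoff's bound at
   h = b_n / (n v sigma^2), where h c -> 0, gives the upper estimate; the lower one compares the
   transforms at three tilts near h.

   The lower bound on E exp(lam V_n) is Jensen's inequality. For the upper bound the trajectory is
   cut into blocks of length about c^2 / eps. The self-intersections inside the blocks are
   independent and are expanded to second order. The intersections of a block with its past are
   handled by Khas'minskii's lemma on the event that the Green potential of the past is small, the
   complement of which has again probability at most exp(- c0 c). Of the walk this uses only its
   symmetry and P(S_n = x) <= C n^(-3/2), which is proved by dominating the law of a step by a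
   multiple of simple random walk steps along three independent directions. *)
Require Import Defs.
From HB Require Import structures.
From mathcomp Require Import all_boot all_order all_algebra finmap.
From mathcomp Require Import all_classical all_reals all_analysis.
From mathcomp Require Import measurable_realfun.
From mathcomp Require Import ring lra zify.
Import Order.TTheory GRing.Theory Num.Theory.
Import numFieldNormedType.Exports.

Set Implicit Arguments.
Unset Strict Implicit.
Unset Printing Implicit Defensive.

Local Open Scope classical_set_scope.
Local Open Scope ring_scope.

(** * Bounded functions and means *)

(** The length tau of the blocks is forced from two sides. There are about n / tau of them, and the
    Green's function truncated at time tau, composed with itself, is of order tau^(1/2).
    Khas'minskii's lemma over stretches of length tau then shows that the potential of the
    trajectory exceeds a suitable w of order n tau^(-1/2) with probability at most exp(- n / tau),
    up to a power of n. For this to be at most exp(- c0 c), tau may not exceed the order of c^2. On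
    the other hand the crossings of the blocks with their past cost about lam w n / tau, that is lam
    n^2 tau^(-3/2), in the exponent, with lam = h^2 sigma^2 / 2. This is small against lam n only if
    tau is large compared with n^(2/3). With c = n^(1/3), only tau of order c^2 is left, with a
    large factor 1 / eps, and the number of blocks is of order eps c. The bound on h c is chosen
    after eps, so that lam tau is small too, as the expansion inside a block requires. The walk
    enters through finite trajectories only, hence the positive linear functional on functions of
    one step, which is identified later with the law of the increments. *)

Section bounded_functions.
Context {R : realType} {T : Type}.
Implicit Types (D : set T) (f g : T -> R).

Definition bnd D f := exists M, forall x, D x -> `|f x| <= M.

Lemma bnd_cst D (c : R) : bnd D (fun=> c).
Proof. by exists `|c|. Qed.

Lemma bndD D f g : bnd D f -> bnd D g -> bnd D (fun x => f x + g x).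
Proof.
move=> [M hM] [N hN]; exists (M + N) => x Dx.
by rewrite (le_trans (ler_normD _ _))// lerD ?hM ?hN.
Qed.

Lemma bndM D f g : bnd D f -> bnd D g -> bnd D (fun x => f x * g x).
Proof.
move=> [M hM] [N hN]; exists (M * N) => x Dx.
by rewrite normrM ler_pM ?hM ?hN.
Qed.

Lemma bndZ D (a : R) f : bnd D f -> bnd D (fun x => a * f x).
Proof. by move=> hf; apply: bndM => //; exact: bnd_cst. Qed.

Lemma bndN D f : bnd D f -> bnd D (fun x => - f x).
Proof. by move=> [M hM]; exists M => x Dx; rewrite normrN hM. Qed.

Lemma bndB D f g : bnd D f -> bnd D g -> bnd D (fun x => f x - g x).
Proof. by move=> hf hg; apply: bndD => //; exact: bndN. Qed.

Lemma bnd_sum D (I : Type) (s : seq I) (F : I -> T -> R) :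
  (forall i, bnd D (F i)) -> bnd D (fun x => \sum_(i <- s) F i x).
Proof.
move=> hF; elim: s => [|i s IH].
  by exists 0 => x _; rewrite big_nil normr0.
have [M hM] := bndD (hF i) IH; exists M => x Dx.
by rewrite big_cons hM.
Qed.

Lemma bnd_sq D f : bnd D f -> bnd D (fun x => f x ^+ 2).
Proof. by move=> h; apply: bndM. Qed.

Lemma bnd_bool D (b : T -> bool) : bnd D (fun x => (b x)%:R).
Proof. by exists 1 => x _; case: (b x); rewrite ?normr1 ?normr0. Qed.

Lemma bnd_expR D f : bnd D f -> bnd D (fun x => expR (f x)).
Proof.
move=> [M hM]; exists (expR M) => x Dx.
by rewrite ger0_norm ?expR_ge0// ler_expR (le_trans (ler_norm _))// hM.
Qed.

Lemma bnd_ge0_le D f g : (forall x, D x -> 0 <= f x <= g x) -> bnd D g -> bnd D f.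
Proof.
move=> fg [M hM]; exists M => x Dx; have /andP[f0 fg'] := fg x Dx.
by rewrite ger0_norm// (le_trans fg')// (le_trans (ler_norm _))// hM.
Qed.

End bounded_functions.

Lemma bnd_comp (R : realType) (D D' : Type) (A : set D) (B : set D') (g : D -> D') (h : D' -> R) :
  (forall x, A x -> B (g x)) -> bnd B h -> bnd A (fun x => h (g x)).
Proof. by move=> AB [M hM]; exists M => x Ax; apply/hM/AB. Qed.

(* Finitely additive means: only positivity and linearity are used, on functions bounded on the domain. *)
Record mean {R : realType} {T : Type} (D : set T) := Mean {
  ev :> (T -> R) -> R;
  ev_linear : forall a f g, bnd D f -> bnd D g ->
    ev (fun x => a * f x + g x) = a * ev f + ev g;
  ev_ge0 : forall f, bnd D f -> (forall x, D x -> 0 <= f x) -> 0 <= ev f;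
  ev_1 : ev (fun=> 1) = 1 }.

Section mean_theory.
Context {R : realType} {T : Type} {D : set T} (E : @mean R T D).
Implicit Types (f g : T -> R).

Lemma evD f g : bnd D f -> bnd D g -> E (fun x => f x + g x) = E f + E g.
Proof.
move=> hf hg; rewrite -[E f]mul1r -ev_linear//.
by congr (ev E _); apply: funext => x; rewrite mul1r.
Qed.

Lemma evZ a f : bnd D f -> E (fun x => a * f x) = a * E f.
Proof.
move=> hf.
have e0 : E (fun=> 0) = 0.
  have := ev_linear E 1 (bnd_cst D (0:R)) (bnd_cst D (0:R)).
  have -> : (fun=> 1 * 0 + 0) = (fun=> 0) :> (T -> R).
    by apply: funext => x; rewrite mul1r addr0.
  by rewrite mul1r => /eqP; rewrite -subr_eq0 opprD addrA subrr sub0r oppr_eq0 => /eqP.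
have := ev_linear E a hf (bnd_cst D (0:R)); rewrite e0 addr0 => <-.
by congr (ev E _); apply: funext => x; rewrite addr0.
Qed.

Lemma ev_cst c : E (fun=> c) = c.
Proof.
rewrite -[RHS]mulr1 -(ev_1 E) -evZ; last exact: bnd_cst.
by congr (ev E _); apply: funext => x; rewrite mulr1.
Qed.

Lemma evN f : bnd D f -> E (fun x => - f x) = - E f.
Proof.
move=> hf; rewrite -mulN1r -evZ//.
by congr (ev E _); apply: funext => x; rewrite mulN1r.
Qed.

Lemma evB f g : bnd D f -> bnd D g -> E (fun x => f x - g x) = E f - E g.
Proof. by move=> hf hg; rewrite evD ?evN//; exact: bndN. Qed.

Lemma ev_le f g : bnd D f -> bnd D g -> (forall x, D x -> f x <= g x) -> E f <= E g.
Proof.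
move=> hf hg fg; rewrite -subr_ge0 -evB//.
apply: ev_ge0; first exact: bndB.
by move=> x Dx; rewrite subr_ge0 fg.
Qed.

Lemma ev_le_cst f c : bnd D f -> (forall x, D x -> f x <= c) -> E f <= c.
Proof. by move=> hf fc; rewrite -[leRHS]ev_cst; apply: ev_le => //; exact: bnd_cst. Qed.

Lemma ev_norm_le f M : (forall x, D x -> `|f x| <= M) -> `|E f| <= M.
Proof.
move=> hM; have hf : bnd D f by exists M.
rewrite ler_norml; apply/andP; split.
  rewrite -[leLHS]ev_cst; apply: ev_le => //; first exact: bnd_cst.
  by move=> x /hM; rewrite ler_norml => /andP[].
by apply: ev_le_cst => // x /hM; rewrite ler_norml => /andP[].
Qed.

Lemma ev_sum (I : Type) (s : seq I) (F : I -> T -> R) :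
  (forall i, bnd D (F i)) ->
  E (fun x => \sum_(i <- s) F i x) = \sum_(i <- s) E (F i).
Proof.
move=> hF; elim: s => [|i s IH].
  by rewrite big_nil -[RHS](ev_cst 0); congr (ev E _); apply: funext => x; rewrite big_nil.
rewrite big_cons -IH -evD//; last exact: bnd_sum.
by congr (ev E _); apply: funext => x; rewrite big_cons.
Qed.

Lemma ev_cauchy_schwarz f g : bnd D f -> bnd D g ->
  E (fun x => f x * g x) <= Num.sqrt (E (fun x => f x ^+ 2) * E (fun x => g x ^+ 2)).
Proof.
move=> hf hg.
have hf2 := bnd_sq hf; have hg2 := bnd_sq hg; have hfg := bndM hf hg.
set A := E (fun x => f x ^+ 2); set B := E (fun x => g x ^+ 2).
set C := E (fun x => f x * g x).
have A0 : 0 <= A by apply: ev_ge0 => // x _; exact: sqr_ge0.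
have B0 : 0 <= B by apply: ev_ge0 => // x _; exact: sqr_ge0.
have key a b : 2 * a * b * C <= a ^+ 2 * A + b ^+ 2 * B.
  rewrite /A /B /C -!evZ// -evD; [|exact: bndM (bnd_cst _ _) _..].
  apply: ev_le => [||x _].
  - exact: bndM (bnd_cst _ _) _.
  - by apply: bndD; exact: bndM (bnd_cst _ _) _.
  - have := sqr_ge0 (a * f x - b * g x); nra.
have [C0|C0] := leP C 0; first by rewrite (le_trans C0)// sqrtr_ge0.
rewrite -(@ler_pXn2r _ 2)// ?nnegrE ?sqrtr_ge0 ?(ltW C0)//.
rewrite sqr_sqrtr ?mulr_ge0//.
(* The case [A = 0] needs its own weights: a = B + 1 and b = C give 2 (B + 1) C^2 <= B C^2, which
   contradicts C > 0. Otherwise a = C and b = A give C^2 <= A B. *)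
have [Az|An] := eqVneq A 0.
  rewrite Az mul0r; have := key (B + 1) C; rewrite Az.
  have := C0; have := B0; nra.
have A1 : 0 < A by rewrite lt0r An.
have := key C A; have := C0; nra.
Qed.

End mean_theory.

(** * Expectations over finite trajectories *)

Section trajectories.
Context {R : realType} {T : zmodType} (E1 : @mean R T setT).
Implicit Types (x : T) (F : seq T -> R).

Definition sized n : set (seq T) := [set t | size t = n].

(** Expectation over n steps from x. The starting point is not recorded, so that the local times of
    the list count the times 1, ..., n, as the sum defining X_n does. *)
Fixpoint W n x F : R :=
  if n is n'.+1 then E1 (fun y => W n' (x + y) (fun t => F ((x + y) :: t)))
  else F [::].

Lemma W_norm_le n x F M : (forall t, size t = n -> `|F t| <= M) -> `|W n x F| <= M.
Proof.
elim: n x F => [|n IH] x F hM /=; first exact: hM.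
by apply: ev_norm_le => y _; apply: IH => t st; apply: hM; rewrite /= st.
Qed.

Lemma bnd_sized_cons n z F : bnd (sized n.+1) F -> bnd (sized n) (fun t => F (z :: t)).
Proof. by move=> [M hM]; exists M => t st; apply: hM; rewrite /sized/= st. Qed.

Lemma bnd_W n (I : Type) (D : set I) (x : I -> T) (F : I -> seq T -> R) M :
  (forall i t, D i -> size t = n -> `|F i t| <= M) -> bnd D (fun i => W n (x i) (F i)).
Proof. by move=> hM; exists M => i Di; apply: W_norm_le => t st; exact: hM. Qed.

Lemma bnd_W_cons n x F : bnd (sized n.+1) F ->
  bnd setT (fun y => W n (x + y) (fun t => F ((x + y) :: t))).
Proof.
by move=> [M hM]; apply: (@bnd_W _ _ _ _ _ M) => y t _ st; apply: hM; rewrite /sized/= st.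
Qed.

Lemma W_linear n x a F G : bnd (sized n) F -> bnd (sized n) G ->
  W n x (fun t => a * F t + G t) = a * W n x F + W n x G.
Proof.
elim: n x F G => [|n IH] x F G hF hG //=.
rewrite -ev_linear; [|exact: bnd_W_cons..].
by congr (ev E1 _); apply: funext => y; apply: IH; exact: bnd_sized_cons.
Qed.

Lemma W_ge0 n x F : bnd (sized n) F -> (forall t, size t = n -> 0 <= F t) -> 0 <= W n x F.
Proof.
elim: n x F => [|n IH] x F hF F0 /=; first exact: F0.
apply: ev_ge0 => [|y _]; first exact: bnd_W_cons.
by apply: IH => [|t st]; [exact: bnd_sized_cons|apply: F0; rewrite /= st].
Qed.

Lemma W_1 n x : W n x (fun=> 1) = 1.
Proof.
elim: n x => //= n IH x; rewrite -[RHS](ev_1 E1).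
by congr (ev E1 _); apply: funext => y; exact: IH.
Qed.

Definition Wm n x : mean (sized n) := Mean (W_linear x) (W_ge0 x) (W_1 n x).

Lemma W_eq n x F G : (forall t, size t = n -> F t = G t) -> W n x F = W n x G.
Proof.
elim: n x F G => [|n IH] x F G FG /=; first exact: FG.
by congr (ev E1 _); apply: funext => y; apply: IH => t st; apply: FG; rewrite /= st.
Qed.

Lemma W_le n x F G : bnd (sized n) F -> bnd (sized n) G ->
  (forall t, size t = n -> F t <= G t) -> W n x F <= W n x G.
Proof. by move=> hF hG FG; exact: (ev_le (Wm n x)). Qed.

Lemma W_cst n x c : W n x (fun=> c) = c. Proof. exact: (ev_cst (Wm n x)). Qed.

Lemma WD n x F G : bnd (sized n) F -> bnd (sized n) G ->
  W n x (fun t => F t + G t) = W n x F + W n x G.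
Proof. by move=> hF hG; exact: (evD (Wm n x)). Qed.

Lemma WZ n x a F : bnd (sized n) F -> W n x (fun t => a * F t) = a * W n x F.
Proof. by move=> hF; exact: (evZ (Wm n x)). Qed.

Lemma W_sum n x (I : Type) (s : seq I) (F : I -> seq T -> R) :
  (forall i, bnd (sized n) (F i)) ->
  W n x (fun t => \sum_(i <- s) F i t) = \sum_(i <- s) W n x (F i).
Proof. by move=> hF; exact: (ev_sum (Wm n x)). Qed.

(** The Markov property at time m: the second stretch restarts from the endpoint of the first. *)
Lemma W_cat m n x F :
  W (m + n) x F = W m x (fun A => W n (last x A) (fun B => F (A ++ B))).
Proof.
elim: m x F => [|m IH] x F //=.
by congr (ev E1 _); apply: funext => y; rewrite IH.
Qed.

Lemma W_shift n x y F : W n (x + y) F = W n y (fun t => F (map (+%R x) t)).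
Proof.
elim: n x y F => [|n IH] x y F //=.
congr (ev E1 _); apply: funext => z.
by rewrite -addrA (IH x).
Qed.

Lemma W_shift0 n x F : W n x F = W n 0 (fun t => F (map (+%R x) t)).
Proof. by rewrite -W_shift addr0. Qed.

Lemma bnd_cat m n F A : bnd (sized (m + n)) F -> size A = m ->
  bnd (sized n) (fun B => F (A ++ B)).
Proof.
by move=> [M hM] sA; exists M => B sB; apply: hM; rewrite /sized/= size_cat sA sB.
Qed.

Lemma bnd_W_cat m n (x : seq T -> T) F : bnd (sized (m + n)) F ->
  bnd (sized m) (fun A => W n (x A) (fun B => F (A ++ B))).
Proof.
move=> [M hM]; apply: (@bnd_W _ _ _ _ _ M) => A B sA sB.
by apply: hM; rewrite /sized/= size_cat sA sB.
Qed.

(* Fubini for two steps propagates to a step and a trajectory. *)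
Definition commuting := forall F : T -> T -> R,
  (exists M, forall x y, `|F x y| <= M) ->
  E1 (fun x => E1 (fun y => F x y)) = E1 (fun y => E1 (fun x => F x y)).

Lemma W_commute n x (F : T -> seq T -> R) : commuting ->
  (exists M, forall y t, size t = n -> `|F y t| <= M) ->
  E1 (fun y => W n x (F y)) = W n x (fun t => E1 (fun y => F y t)).
Proof.
move=> com; elim: n x F => [|n IH] x F [M hM] //=.
rewrite (com (fun y z => W n (x + z) (fun t => F y ((x + z) :: t)))).
  congr (ev E1 _); apply: funext => z; rewrite IH//.
  by exists M => y t st; apply: hM; rewrite /= st.
by exists M => y z; apply: W_norm_le => t st; apply: hM; rewrite /= st.
Qed.

(* The walk seen from its endpoint: the positions S_n - S_(n-1), ..., S_n - S_0. *)
Definition reverse_traj (t : seq T) : seq T :=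
  [seq last 0 t - z | z <- rev (belast 0 t)].

Lemma size_reverse_traj t : size (reverse_traj t) = size t.
Proof. by rewrite size_map size_rev size_belast. Qed.

Lemma last_map_add x (y : T) t : last (x + y) (map (+%R x) t) = x + last y t.
Proof. by elim: t y => //= z t IH y; rewrite IH. Qed.

Lemma belast_map_add x (y : T) t : belast (x + y) (map (+%R x) t) = map (+%R x) (belast y t).
Proof. by elim: t y => //= z t IH y; rewrite IH. Qed.

Lemma last_reverse_traj t : last 0 (reverse_traj t) = last 0 t.
Proof.
rewrite /reverse_traj; case: t => //= y t.
by rewrite rev_cons map_rcons last_rcons subr0.
Qed.

Lemma reverse_traj_cons y t : reverse_traj (y :: map (+%R y) t) =
  rcons (reverse_traj t) (last 0 (reverse_traj t) + y).
Proof.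
have := last_map_add y 0 t; have := belast_map_add y 0 t; rewrite addr0 => eb el.
rewrite last_reverse_traj /reverse_traj/= rev_cons map_rcons el subr0 eb -map_rev -map_comp.
by rewrite [last 0 t + y]addrC; congr rcons; apply: eq_map => z /=; rewrite opprD addrACA subrr add0r.
Qed.

(** Reversal exchanges the order of the increments. In the recursion the first step y becomes the
    last increment of the reversed trajectory, and [commuting] allows it to be integrated last. *)
Lemma W_reverse n F : commuting -> bnd (sized n) F ->
  W n 0 (fun t => F (reverse_traj t)) = W n 0 F.
Proof.
move=> com; elim: n F => [|n IH] F [M hM] //=.
transitivity (E1 (fun y => W n 0 (fun t => F (rcons t (last 0 t + y))))).
  congr (ev E1 _); apply: funext => y.
  rewrite add0r W_shift0.
  rewrite -(IH (fun t => F (rcons t (last 0 t + y)))); last first.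
    by exists M => t st; apply: hM; rewrite /sized/= size_rcons st.
  by apply: W_eq => t st; rewrite reverse_traj_cons.
rewrite W_commute//; last by exists M => y t st; apply: hM; rewrite /sized/= size_rcons st.
have -> : E1 (fun y => W n (0 + y) (fun t => F ((0 + y) :: t))) = W (1 + n) 0 F by [].
rewrite addnC W_cat; apply: W_eq => t st /=.
by congr (ev E1 _); apply: funext => y; rewrite cats1.
Qed.

End trajectories.

(** * Return probabilities *)

Lemma leq_bin_succ n j : (j.*2 < n)%N -> ('C(n, j) <= 'C(n, j.+1))%N.
Proof.
move=> h; have := mul_bin_left n j.
rewrite -(leq_pmul2l (ltn0Sn j)) => ->.
by rewrite leq_mul2r; apply/orP; right; lia.
Qed.

Lemma bin_le_half n j : ('C(n, j) <= 'C(n, n./2))%N.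
Proof.
have low : forall i, (i <= n./2)%N -> ('C(n, n./2 - i) <= 'C(n, n./2))%N.
  elim=> [|i IH] hi; first by rewrite subn0.
  apply: leq_trans (IH (ltnW hi)).
  have -> : (n./2 - i = (n./2 - i.+1).+1)%N by lia.
  by apply: leq_bin_succ; lia.
have [nj|jn] := ltnP n j; first by rewrite bin_small.
have [hj|hj] := leqP j n./2.
  by rewrite -(subKn hj); apply: low; lia.
rewrite -bin_sub//.
have h2 : (n - j <= n./2)%N by lia.
by rewrite -(subKn h2); apply: low; lia.
Qed.

Lemma central_bin_step m : (m.+1 * 'C(m.+1.*2, m.+1) = (m.*2.+1).*2 * 'C(m.*2, m))%N.
Proof.
have e1 := mul_bin_diag m.+1.*2 m.
rewrite doubleS /= in e1.
have e2 := mul_bin_left m.*2.+1 m.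
have e3 := mul_bin_down m.*2.+1 m.
rewrite /= in e3.
have h3 : (m.*2.+1 - m = m.+1)%N by lia.
rewrite h3 in e2 e3.
rewrite doubleS.
nia.
Qed.

(** The ratio of consecutive central coefficients is 2 (2 m + 1) / (m + 1), which reduces the
    induction to (2 m + 1) (2 m + 3) <= 4 (m + 1)^2. This takes the place of Stirling's formula. *)
Lemma central_bin_bound m : ('C(m.*2, m) ^ 2 * m.*2.+1 <= 16 ^ m)%N.
Proof.
elim: m => [|m IH]; first by [].
have e := central_bin_step m.
rewrite -(@leq_pmul2l (m.+1 ^ 2)%N)//.
rewrite mulnA -expnMn e expnMn.
apply: (@leq_trans (4 * (m.*2.+1 * m.+1.*2.+1) * 16 ^ m)%N).
  have -> : ((m.*2.+1).*2 ^ 2 * 'C(m.*2, m) ^ 2 * m.+1.*2.+1 =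
    4 * (m.*2.+1 * m.+1.*2.+1) * ('C(m.*2, m) ^ 2 * m.*2.+1))%N by lia.
  by rewrite leq_mul2l IH orbT.
rewrite (expnS 16) (mulnA (m.+1 ^ 2)%N) leq_mul2r; apply/orP; right; nia.
Qed.

Lemma bin_sq_bound k j : ('C(k, j) ^ 2 * k.+1 <= 4 ^ k)%N.
Proof.
apply: (@leq_trans ('C(k, k./2) ^ 2 * k.+1)); first by rewrite leq_mul2r leq_exp2r// bin_le_half orbT.
rewrite -{1 3 4}(odd_double_half k); set m := k./2; case: (odd k) => /=; last first.
  by rewrite add0n (_ : 4 ^ m.*2 = 16 ^ m)%N ?central_bin_bound// -muln2 mulnC expnM.
rewrite add1n (_ : 4 ^ m.*2.+1 = 4 * 16 ^ m)%N; last by rewrite expnS -muln2 (mulnC m) expnM.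
have cb := central_bin_bound m.+1.
have e : ('C(m.+1.*2, m.+1) = 2 * 'C(m.*2.+1, m))%N.
  have h3 : (m.*2.+1 - m = m.+1)%N by lia.
  have := @bin_sub m.*2.+1 m; rewrite h3 => h4.
  by rewrite doubleS binS h4; lia.
rewrite e expnMn (expnS 16) in cb.
move: cb; set X := ('C(_, m) ^ 2)%N; set Y := (16 ^ m)%N => cb.
have c4 : (2 ^ 2 = 4)%N by [].
rewrite c4 in cb; clearbody X Y; nia.
Qed.

(** * Heat kernel bound by comparison with simple random walks on three lines *)

Section heat_kernel.
Context {R : realType} {T : zmodType} (E1 : @mean R T setT).
Implicit Types (f : T -> R) (v x : T).

Definition avg v f x := (f (x + v) + f (x - v)) / 2.

Lemma sum_binS k (G : nat -> R) : \sum_(j < k.+2) 'C(k.+1, j)%:R * G j =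
  \sum_(j < k.+1) 'C(k, j)%:R * (G j.+1 + G j).
Proof.
rewrite big_ord_recl /= bin0 mul1r.
under eq_bigr do rewrite /bump /= add1n binS natrD mulrDl.
rewrite big_split /= big_ord_recr /= bin_small// mul0r addr0.
under [RHS]eq_bigr do rewrite mulrDr.
rewrite big_split /= addrA [RHS]addrC; congr (_ + _).
by rewrite [RHS]big_ord_recl bin0 mul1r.
Qed.

Lemma iter_avg v f k x : iter k (avg v) f x =
  \sum_(j < k.+1) 'C(k, j)%:R * (f (x - v *+ k + v *+ j.*2) / 2 ^+ k).
Proof.
elim: k x => [|k IH] x.
  by rewrite big_ord1 bin0 expr0 divr1 mul1r !mulr0n subr0 addr0.
rewrite iterS /avg !IH (sum_binS k (fun j => f (x - v *+ k.+1 + v *+ j.*2) / 2 ^+ k.+1)).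
rewrite -big_split mulr_suml; apply: eq_bigr => j _ /=.
have -> : x + v - v *+ k + v *+ j.*2 = x - v *+ k.+1 + v *+ j.+1.*2.
  rewrite doubleS (mulrS v k) (mulrS v j.*2.+1) (mulrS v j.*2) opprD -!addrA; congr (x + _).
  by rewrite [LHS]addrCA [RHS]addrCA addKr.
have -> : x - v - v *+ k + v *+ j.*2 = x - v *+ k.+1 + v *+ j.*2.
  by rewrite (mulrS v k) opprD !addrA.
by rewrite exprSr invfM; ring.
Qed.

Lemma avg_ge0 v f k x : (forall y, 0 <= f y) -> 0 <= iter k (avg v) f x.
Proof.
by move=> f0; rewrite iter_avg; apply: sumr_ge0 => j _; rewrite mulr_ge0// divr_ge0// exprn_ge0.
Qed.

Lemma bin_ratio_le k j : 'C(k, j)%:R / 2 ^+ k <= (Num.sqrt k.+1%:R)^-1 :> R.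
Proof.
have s0 : 0 < Num.sqrt (k.+1%:R) :> R by rewrite sqrtr_gt0.
rewrite -[leRHS]div1r ler_pdivrMr ?exprn_gt0// mulrAC ler_pdivlMr// mul1r.
rewrite -(@ler_pXn2r _ 2)// ?nnegrE ?mulr_ge0 ?sqrtr_ge0 ?exprn_ge0//.
rewrite exprMn sqr_sqrtr ?ler0n// -!natrX -natrM ler_nat.
by rewrite -expnM (mulnC k) expnM; exact: bin_sq_bound.
Qed.

(** Binomial weights are at most (k + 1)^(-1/2), so averaging k times along v gains this factor over
    the sum of f along a line. The shifts [w] carry the lines of the directions not yet treated,
    which lets the bound be used for three directions in turn. *)
Lemma iter_avg_line_bound (I : finType) (w : I -> T) v f M k x :
  (forall y, 0 <= f y) ->
  (forall J y, \sum_(i : I) \sum_(j < J) f (y + w i + v *+ j.*2) <= M) ->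
  \sum_(i : I) iter k (avg v) f (x + w i) <= M / Num.sqrt k.+1%:R.
Proof.
move=> f0 hM; under eq_bigr do rewrite iter_avg.
have := hM k.+1 (x - v *+ k).
move/(ler_wpM2r _) => /(_ (Num.sqrt k.+1%:R)^-1); rewrite invr_ge0 sqrtr_ge0 => /(_ isT).
apply: le_trans; rewrite mulr_suml; apply: ler_sum => i _.
rewrite mulr_suml; apply: ler_sum => j _.
rewrite mulrCA (addrAC x); apply: ler_wpM2l => //; exact: bin_ratio_le.
Qed.

Definition origin : T -> R := fun x => (x == 0)%:R.

(* Nearest-neighbour steps along v1, v2, v3, averaged k1, k2, k3 times: when the law of a
   step dominates a multiple of them, the law of S_n is compared with a mixture of these. *)
Definition smooth v1 v2 v3 k1 k2 k3 : T -> R :=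
  iter k1 (avg v1) (iter k2 (avg v2) (iter k3 (avg v3) origin)).

Definition independent3 v1 v2 v3 := forall a b c : int,
  v1 *~ a + v2 *~ b + v3 *~ c = 0 -> [/\ a = 0, b = 0 & c = 0].

Lemma smooth_le v1 v2 v3 k1 k2 k3 x : independent3 v1 v2 v3 ->
  smooth v1 v2 v3 k1 k2 k3 x <=
  (Num.sqrt k1.+1%:R)^-1 * (Num.sqrt k2.+1%:R)^-1 * (Num.sqrt k3.+1%:R)^-1.
Proof.
move=> ind.
have o0 : forall y, 0 <= origin y by move=> y; exact: ler0n.
(* By independence the points reached along the three lines are all distinct, so at most one of them
   is the origin and the triple sum is at most 1. *)
have b3 J1 J2 y : \sum_(p : 'I_J1 * 'I_J2)
    iter k3 (avg v3) origin (y + (v1 *+ p.1.*2 + v2 *+ p.2.*2)) <= 1 / Num.sqrt k3.+1%:R.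
  apply: iter_avg_line_bound => // J z.
  rewrite pair_big /=.
  have [[[[a b] c] /= h]|none] := pselect (exists p : 'I_J1 * 'I_J2 * 'I_J,
      z + (v1 *+ p.1.1.*2 + v2 *+ p.1.2.*2) + v3 *+ p.2.*2 == 0).
    rewrite (bigD1 ((a, b), c))//= big1 ?addr0; first by rewrite /origin h.
    move=> [[a' b'] c'] /= ne; rewrite /origin; case: eqP => // h'; case/negP: ne.
    have := ind (a.*2%:Z - a'.*2%:Z) (b.*2%:Z - b'.*2%:Z) (c.*2%:Z - c'.*2%:Z).
    case.
      rewrite !mulrzBr -!pmulrn.
      have sub2 (p q r s : T) : (p - r) + (q - s) = (p + q) - (r + s) by rewrite opprD addrACA.
      rewrite !sub2; apply/eqP; rewrite subr_eq0; apply/eqP/(addrI z).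
      by rewrite !addrA in h h' *; rewrite h' (eqP h).
    move=> e1 e2 e3; apply/eqP; congr ((_, _), _); apply/val_inj => /=; lia.
  by rewrite big1// => p _; rewrite /origin; case: eqP => // h; case: none; exists p; apply/eqP.
have b2 J1 y : \sum_(i < J1)
    iter k2 (avg v2) (iter k3 (avg v3) origin) (y + v1 *+ i.*2) <=
    (1 / Num.sqrt k3.+1%:R) / Num.sqrt k2.+1%:R.
  apply: iter_avg_line_bound => [z|J z]; first exact: avg_ge0.
  by rewrite pair_big /=; under eq_bigr do rewrite -addrA; exact: b3.
have := @iter_avg_line_bound unit (fun=> 0) v1 (iter k2 (avg v2) (iter k3 (avg v3) origin))
  ((1 / Num.sqrt k3.+1%:R) / Num.sqrt k2.+1%:R) k1 x.
rewrite !big_const card_unit /= !addr0 => h.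
apply: le_trans (h _ _) _.
- by move=> y; apply: avg_ge0 => z; exact: avg_ge0.
- by move=> J y; rewrite big_const card_unit /= !addr0; exact: b2.
- by rewrite le_eqVlt; apply/orP; left; apply/eqP; rewrite div1r; ring.
Qed.

Lemma avgC v w f : avg v (avg w f) = avg w (avg v f).
Proof.
apply: funext => x; rewrite /avg.
by rewrite (addrAC x w v) (addrAC x w (- v)) (addrAC x (- w) v) (addrAC x (- w) (- v)); ring.
Qed.

Lemma iter_avgC v w f k : avg v (iter k (avg w) f) = iter k (avg w) (avg v f).
Proof. by elim: k => //= k <-; rewrite avgC. Qed.

Lemma smoothS1 v1 v2 v3 k1 k2 k3 :
  avg v1 (smooth v1 v2 v3 k1 k2 k3) = smooth v1 v2 v3 k1.+1 k2 k3.
Proof. by []. Qed.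

Lemma smoothS2 v1 v2 v3 k1 k2 k3 :
  avg v2 (smooth v1 v2 v3 k1 k2 k3) = smooth v1 v2 v3 k1 k2.+1 k3.
Proof. exact: iter_avgC. Qed.

Lemma smoothS3 v1 v2 v3 k1 k2 k3 :
  avg v3 (smooth v1 v2 v3 k1 k2 k3) = smooth v1 v2 v3 k1 k2 k3.+1.
Proof.
rewrite /smooth iter_avgC; congr (iter _ _ _); exact: iter_avgC.
Qed.

Lemma bnd_avg v f : bnd setT f -> bnd setT (avg v f).
Proof.
move=> [M hM]; exists ((M + M) / 2) => x _; rewrite normrM (@ger0_norm _ 2^-1)//.
by rewrite ler_wpM2r// (le_trans (ler_normD _ _))// lerD// hM.
Qed.

Lemma bnd_smooth v1 v2 v3 k1 k2 k3 : bnd setT (smooth v1 v2 v3 k1 k2 k3).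
Proof.
have hit : forall v f k, bnd setT f -> bnd setT (iter k (avg v) f).
  by move=> v f k hf; elim: k => //= k; exact: bnd_avg.
by do 3!apply: (hit); exact: bnd_bool.
Qed.

Lemma W_avg n v f x : bnd setT f ->
  W E1 n x (fun t => avg v f (last x t)) = avg v (fun y => W E1 n y (fun t => f (last y t))) x.
Proof.
move=> hf; rewrite /avg.
have e y : W E1 n (x + y) (fun t => f (last (x + y) t)) = W E1 n x (fun t => f (last x t + y)).
  by rewrite (addrC x) W_shift; apply: W_eq => t _; rewrite last_map_add addrC.
rewrite !e -WD; last 2 first.
- exact: bnd_comp hf.
- exact: bnd_comp hf.
rewrite mulrC -WZ; last by apply: bndD; apply: bnd_comp hf.
by apply: W_eq => t _; rewrite mulrC.
Qed.

(* A supersolution of the binomial recursion, dominating (k+1)^(-3/2) by the arithmetic-geometric mean inequality. *)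
Definition decay (q c : R) (n k : nat) : R :=
  q / (k.+1%:R + c * n%:R) ^+ 2 + q^-1 / (k.+1%:R + c * n%:R).

(** With y = k + 1 + c n and c = beta / 4 the inequality holds for y^(-1) and y^(-2) separately: k
    moves by one with weight beta, so y drifts at speed beta, four times the speed c at which the
    right-hand side ages, and this margin absorbs the convexity of the inverse powers on y >= 1. *)
Lemma decay_step (q beta : R) n k : 0 < q -> 0 < beta <= 1 ->
  beta * decay q (beta / 4) n k.+1 + (1 - beta) * decay q (beta / 4) n k <=
  decay q (beta / 4) n.+1 k.
Proof.
move=> q0 /andP[b0 b1]; rewrite /decay.
set c := beta / 4; set y := k.+1%:R + c * n%:R.
have c0 : 0 < c by rewrite divr_gt0.
have y1 : 1 <= y by rewrite /y -[leLHS]addr0 lerD ?ler1n// mulr_ge0// ltW.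
have -> : k.+2%:R + c * n%:R = y + 1 by rewrite /y -(natr1 k.+1); ring.
have -> : k.+1%:R + c * n.+1%:R = y + c by rewrite /y -(natr1 n); ring.
have bE : beta = 4 * c by rewrite /c; field.
have y0 : 0 < y by lra.
have e1 : beta / (y + 1) + (1 - beta) / y <= (y + c)^-1.
  rewrite -subr_ge0.
  have -> : (y + c)^-1 - (beta / (y + 1) + (1 - beta) / y) =
      (3 * y - 1 + 4 * c) * c / ((y + c) * ((y + 1) * y)).
    rewrite bE; field; rewrite !gt_eqF//; lra.
  by rewrite divr_ge0// ?mulr_ge0//; lra.
have e2 : beta / (y + 1) ^+ 2 + (1 - beta) / y ^+ 2 <= ((y + c) ^+ 2)^-1.
  rewrite -subr_ge0.
  have -> : ((y + c) ^+ 2)^-1 - (beta / (y + 1) ^+ 2 + (1 - beta) / y ^+ 2) =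
      (4 * (2 * y + 1) * (y + c) ^+ 2 - (2 * y + c) * (y + 1) ^+ 2) * c /
      ((y + c) ^+ 2 * ((y + 1) ^+ 2 * y ^+ 2)).
    rewrite bE; field; rewrite !gt_eqF//; lra.
  apply: divr_ge0; last by rewrite !mulr_ge0// ?exprn_ge0//; lra.
  apply: mulr_ge0; last exact: ltW.
  have h1 : (2 * y + c) * (y + 1) ^+ 2 <= (2 * y + 1) * (2 * y) ^+ 2.
    apply: ler_pM; rewrite ?sqr_ge0//; [lra|lra|].
    by apply: lerXn2r; rewrite ?nnegrE; lra.
  have h2 : y ^+ 2 <= (y + c) ^+ 2 by apply: lerXn2r; rewrite ?nnegrE; lra.
  have : (2 * y + 1) * y ^+ 2 <= (2 * y + 1) * (y + c) ^+ 2 by apply: ler_wpM2l => //; lra.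
  by rewrite subr_ge0; move: h1; rewrite exprMn; nra.
rewrite (mulrDr beta) (mulrDr (1 - beta)) addrACA.
have -> : beta * (q / (y + 1) ^+ 2) + (1 - beta) * (q / y ^+ 2) =
  q * (beta / (y + 1) ^+ 2 + (1 - beta) / y ^+ 2) by ring.
have -> : beta * (q^-1 / (y + 1)) + (1 - beta) * (q^-1 / y) =
  q^-1 * (beta / (y + 1) + (1 - beta) / y) by ring.
by apply: lerD; apply: ler_wpM2l => //; rewrite ?invr_ge0; exact: ltW.
Qed.

(** A minorisation of the law of a step: it dominates beta times the sum of the three laws of a fair
    step between v and - v. *)
Definition symmetric_atoms (beta : R) v1 v2 v3 := forall f,
  bnd setT f -> (forall x, 0 <= f x) ->
  beta * (avg v1 f 0 + avg v2 f 0 + avg v3 f 0) <= E1 f.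

(** A step along one of the directions raises the corresponding k by one, and the rest of the law of
    the step is bounded by the supremum; this produces the recursion solved by [decay]. In the
    constant, 1/3 comes from the arithmetic-geometric mean over the three directions and 1/2 from
    the one inside [decay]. *)
Lemma W_smooth_le v1 v2 v3 beta q n k1 k2 k3 x :
  independent3 v1 v2 v3 -> 0 < beta <= 1 -> symmetric_atoms beta v1 v2 v3 -> 0 < q ->
  W E1 n x (fun t => smooth v1 v2 v3 k1 k2 k3 (last x t)) <=
  (decay q (beta / 4) n k1 + decay q (beta / 4) n k2 + decay q (beta / 4) n k3) / 6.
Proof.
move=> ind b01 atoms q0; have [b0 b1] := andP b01.
elim: n k1 k2 k3 x => [|n IH] k1 k2 k3 x.
  rewrite /=; apply: le_trans (smooth_le _ _ _ _ ind) _.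
  have amgm k : (Num.sqrt k.+1%:R)^-1 ^+ 3 <= decay q (beta / 4) 0 k / 2.
    rewrite /decay mulr0 addr0; set s := (Num.sqrt _)^-1.
    have <- : s ^+ 2 = k.+1%:R^-1 by rewrite exprVn sqr_sqrtr ?ler0n.
    rewrite -exprVn; set r := k.+1%:R^-1.
    have -> : r = s ^+ 2 by rewrite exprVn sqr_sqrtr ?ler0n.
    have s0 : 0 < s by rewrite invr_gt0 sqrtr_gt0.
    rewrite -subr_ge0.
    have -> : (q * (s ^+ 2) ^+ 2 + q^-1 * s ^+ 2) / 2 - s ^+ 3 = s ^+ 2 * (q * s - 1) ^+ 2 / q / 2.
      by field; rewrite gt_eqF.
    apply: divr_ge0 => //; apply: divr_ge0; last exact: ltW.
    by apply: mulr_ge0; exact: sqr_ge0.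
  have := amgm k1; have := amgm k2; have := amgm k3.
  have i0 k : 0 <= (Num.sqrt (k.+1%:R : R))^-1 by rewrite invr_ge0 sqrtr_ge0.
  move: (i0 k1) (i0 k2) (i0 k3); set a := _^-1; set b := _^-1; set c := _^-1 => a0 b0' c0.
  have : a * b * c <= (a ^+ 3 + b ^+ 3 + c ^+ 3) / 3.
    rewrite -subr_ge0 (_ : _ - _ = (a + b + c) * ((a - b) ^+ 2 + (b - c) ^+ 2 + (c - a) ^+ 2) / 6); last by field.
    by rewrite divr_ge0// mulr_ge0 ?addr_ge0 ?sqr_ge0.
  by move=> *; lra.
set u := fun z => W E1 n z (fun t => smooth v1 v2 v3 k1 k2 k3 (last z t)).
have [B hB] := bnd_smooth v1 v2 v3 k1 k2 k3.
have bu : bnd setT (fun y => u (x + y)) by apply: (@bnd_W _ _ _ _ _ _ _ _ B) => y t _ _; exact: hB.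
change (E1 (fun y => u (x + y)) <= (decay q (beta / 4) n.+1 k1 + decay q (beta / 4) n.+1 k2 + decay q (beta / 4) n.+1 k3) / 6).
set M := (decay q (beta / 4) n k1 + decay q (beta / 4) n k2 + decay q (beta / 4) n k3) / 6.
(* The minorisation applies to nonnegative functions only, hence to the distance from [u] to its
   bound [M] given by the induction hypothesis. *)
have := atoms (fun y => M - u (x + y)) (bndB (bnd_cst _ _) bu).
have uM y : u y <= M by exact: IH.
move/(_ (fun y => etrans (subr_ge0 _ _) (uM _))).
rewrite evB//; last exact: bnd_cst.
rewrite ev_cst.
have avgu v : avg v (fun y => M - u (x + y)) 0 = M - avg v u x.
  by rewrite /avg !add0r; field.
rewrite !avgu.
have au v : avg v u x = W E1 n x (fun t => avg v (smooth v1 v2 v3 k1 k2 k3) (last x t)).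
  by rewrite W_avg//; exact: bnd_smooth.
rewrite !au smoothS1 smoothS2 smoothS3.
move: (IH k1.+1 k2 k3 x) (IH k1 k2.+1 k3 x) (IH k1 k2 k3.+1 x).
move: (decay_step n k1 q0 b01) (decay_step n k2 q0 b01) (decay_step n k3 q0 b01).
rewrite /M.
set A1 := W _ _ _ _; set A2 := W _ _ _ _; set A3 := W _ _ _ _ => d1 d2 d3 h1 h2 h3 h.
have := ler_wpM2l (ltW b0) h1; have := ler_wpM2l (ltW b0) h2; have := ler_wpM2l (ltW b0) h3.
by move: d1 d2 d3 h; clear; lra.
Qed.

Definition heat (C : R) (n : nat) : R := C / (n.+1%:R * Num.sqrt n.+1%:R).

Lemma W_return_le v1 v2 v3 beta : independent3 v1 v2 v3 -> 0 < beta <= 1 ->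
  symmetric_atoms beta v1 v2 v3 ->
  exists2 C, 0 < C & forall n x, W E1 n x (fun t => (last x t == 0)%:R) <= heat C n.
Proof.
move=> ind b01 atoms; have [b0 b1] := andP b01.
set c := beta / 4.
have c0 : 0 < c by rewrite divr_gt0.
have c1 : c <= 1 by rewrite /c; lra.
exists ((c ^- 2 + c^-1) / 2) => [|n x].
  by rewrite divr_gt0// addr_gt0// invr_gt0// exprn_gt0.
(* This choice makes both terms of [decay] at k = 0 of order (n + 1)^(-3/2). *)
set q : R := Num.sqrt n.+1%:R.
have q0 : 0 < q by rewrite sqrtr_gt0.
have q2 : n.+1%:R = q ^+ 2 by rewrite sqr_sqrtr ?ler0n.
apply: le_trans (W_smooth_le n 0 0 0 x ind b01 atoms q0) _.
suff h : decay q c n 0 <= (c ^- 2 + c^-1) / (n.+1%:R * q).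
  have -> : (decay q (beta / 4) n 0 + decay q (beta / 4) n 0 + decay q (beta / 4) n 0) / 6 = decay q c n 0 / 2.
    by rewrite /c; field.
  by rewrite /heat -/q mulrAC ler_pM2r ?invr_gt0.
rewrite /decay.
have yl : c * n.+1%:R <= 1 + c * n%:R by rewrite -(natr1 n); lra.
rewrite q2 in yl *.
have cq0 : 0 < c * q ^+ 2 by rewrite mulr_gt0// exprn_gt0.
have y0 : 0 < 1 + c * n%:R by apply: lt_le_trans yl.
have e1 : (1 + c * n%:R)^-1 <= (c * q ^+ 2)^-1 by rewrite lef_pV2 ?posrE.
have e2 : ((1 + c * n%:R) ^+ 2)^-1 <= ((c * q ^+ 2) ^+ 2)^-1.
  by rewrite lef_pV2 ?posrE ?exprn_gt0//; apply: lerXn2r => //; rewrite nnegrE ltW.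
apply: (@le_trans _ _ (q / (c * q ^+ 2) ^+ 2 + q^-1 / (c * q ^+ 2))).
  by apply: lerD; apply: ler_wpM2l => //; rewrite ?invr_ge0; exact: ltW.
rewrite le_eqVlt; apply/orP; left; apply/eqP; field.
by rewrite !gt_eqF.
Qed.

End heat_kernel.

(** * Self-intersections of the walk *)

Section sums_of_heat.
Context {R : realType}.

Lemma invsqrt_step (j : nat) : (j.+1%:R * Num.sqrt j.+1%:R)^-1 <=
  4 * ((Num.sqrt j.+1%:R)^-1 - (Num.sqrt j.+2%:R)^-1) :> R.
Proof.
set s := Num.sqrt j.+1%:R; set r := Num.sqrt j.+2%:R.
have s0 : 0 < s by rewrite sqrtr_gt0.
have r0 : 0 < r by rewrite sqrtr_gt0.
have s2 : j.+1%:R = s ^+ 2 by rewrite sqr_sqrtr ?ler0n.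
have r2 : r ^+ 2 = s ^+ 2 + 1 by rewrite -s2 sqr_sqrtr ?ler0n// natr1.
have s1 : 1 <= s by rewrite -[leLHS]sqrtr1 ler_wsqrtr// ler1n.
rewrite s2 -subr_ge0.
have e : r - s = (r + s)^-1.
  by apply: (mulIf (x := r + s)); rewrite ?mulVf ?gt_eqF// ?addr_gt0// -subr_sqr r2 addrC addKr.
have -> : 4 * (s^-1 - r^-1) - (s ^+ 2 * s)^-1 = (4 * (r - s) * s ^+ 2 - r) / (s ^+ 3 * r).
  by field; rewrite !gt_eqF.
rewrite divr_ge0 ?mulr_ge0 ?exprn_ge0 ?(ltW s0) ?(ltW r0)// e.
have rs : r <= 3 / 2 * s.
  by rewrite -(@ler_pXn2r _ 2) ?nnegrE ?mulr_ge0 ?(ltW r0) ?(ltW s0)// r2 exprMn; nra.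
rewrite subr_ge0 mulrAC ler_pdivlMr ?addr_gt0//; nra.
Qed.

Lemma sum_heat_le (C : R) i n : 0 <= C ->
  \sum_(j < n) heat C (i + j) <= 4 * C / Num.sqrt i.+1%:R.
Proof.
move=> C0.
suff : \sum_(j < n) heat C (i + j) <= 4 * C * ((Num.sqrt i.+1%:R)^-1 - (Num.sqrt (i + n).+1%:R)^-1).
  move/le_trans; apply; rewrite ler_wpM2l ?mulr_ge0// lerBlDr lerDl invr_ge0 sqrtr_ge0//.
elim: n => [|n IH]; first by rewrite big_ord0 addn0 subrr mulr0.
rewrite big_ord_recr /=.
apply: le_trans (lerD IH (ler_wpM2l C0 (invsqrt_step (i + n)))) _.
by rewrite addnS le_eqVlt; apply/orP; left; apply/eqP; ring.
Qed.

Lemma sum_invsqrt_le n : \sum_(i < n) (Num.sqrt i.+1%:R)^-1 <= 2 * Num.sqrt n%:R :> R.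
Proof.
elim: n => [|n IH]; first by rewrite big_ord0 mulr_ge0// sqrtr_ge0.
rewrite big_ord_recr /=; apply: le_trans (lerD IH (lexx _)) _.
set s := Num.sqrt n%:R; set r := Num.sqrt n.+1%:R.
have s0 : 0 <= s by rewrite sqrtr_ge0.
have r0 : 0 < r by rewrite sqrtr_gt0.
have r2 : r ^+ 2 = s ^+ 2 + 1 by rewrite !sqr_sqrtr ?ler0n// natr1.
rewrite -(ler_pM2r r0) mulrDl mulVf ?gt_eqF//.
have := sqr_ge0 (r - s); nra.
Qed.

End sums_of_heat.

(** * Intersection counts *)

Section intersections.
Context {T : eqType}.
Implicit Types (A B : seq T) (y : T).

(** Pairs of times at which A and B sit at the same site, that is, the sum over the sites of the
    product of the two local times. *)
Definition cross A B : nat := (\sum_(y <- A) count_mem y B)%N.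

(** The quantity V_n: ordered pairs of times, with the diagonal included, hence the sum of the
    squared local times and the doubling in the formulas for concatenation. *)
Definition selfint A : nat := cross A A.

Lemma cross_catl A A' B : cross (A ++ A') B = (cross A B + cross A' B)%N.
Proof. by rewrite /cross big_cat. Qed.

Lemma cross_nil B : cross [::] B = 0%N. Proof. by rewrite /cross big_nil. Qed.

Lemma cross_cons y A B : cross (y :: A) B = (count_mem y B + cross A B)%N.
Proof. by rewrite /cross big_cons. Qed.

Lemma crossC A B : cross A B = cross B A.
Proof.
rewrite /cross; elim: A B => [|y A IH] B.
  by rewrite big_nil big1.
rewrite big_cons IH big_split /=; congr (_ + _)%N.
elim: B => [|z B IHB]; rewrite ?big_nil ?big_cons //= IHB; congr (_ + _)%N.
by rewrite eq_sym.
Qed.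

Lemma cross_catr A B B' : cross A (B ++ B') = (cross A B + cross A B')%N.
Proof. by rewrite crossC cross_catl !(crossC A). Qed.

Lemma selfint_cat A B : selfint (A ++ B) = (selfint A + selfint B + (cross A B).*2)%N.
Proof. by rewrite /selfint cross_catl !cross_catr (crossC B A); lia. Qed.

Lemma selfint_cons y A : selfint (y :: A) = ((count_mem y A).*2.+1 + selfint A)%N.
Proof.
by rewrite -cat1s selfint_cat /selfint /cross !big_cons !big_nil /= eqxx; lia.
Qed.

Lemma cross_le A B : (cross A B <= size A * size B)%N.
Proof.
elim: A => [|y A IH]; first by rewrite cross_nil.
by rewrite cross_cons mulSn leq_add// count_size.
Qed.

End intersections.

Lemma cross_map (T U : eqType) (f : T -> U) (A B : seq T) : injective f ->
  cross (map f A) (map f B) = cross A B.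
Proof.
move=> fI; rewrite /cross big_map; apply: eq_bigr => y _.
by rewrite count_map; apply: eq_count => z /=; rewrite (inj_eq fI).
Qed.

(** * Return probabilities and occupation sums *)

Section potential.
Context {R : realType} {T : zmodType} (E1 : @mean R T setT).
Implicit Types (x y z : T) (A B t : seq T) (V : T -> R).
Local Notation W := (W E1).

Definition ret n x : R := W n x (fun t => (last x t == 0)%:R).

Lemma ret0 x : ret 0 x = (x == 0)%:R. Proof. by []. Qed.

Lemma ret_ge0 n x : 0 <= ret n x.
Proof. by apply: W_ge0 => [|t _]; [exact: bnd_bool|exact: ler0n]. Qed.

Lemma ret_le1 n x : ret n x <= 1.
Proof.
rewrite -[leRHS](W_cst E1 n x); apply: W_le => [||t _]; [exact: bnd_bool|exact: bnd_cst|].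
by case: (_ == _).
Qed.

Lemma bnd_ret n (I : Type) (D : set I) (f : I -> T) : bnd D (fun i => ret n (f i)).
Proof. by exists 1 => i _; rewrite ger0_norm ?ret_ge0 ?ret_le1. Qed.

Lemma retS n x : ret n.+1 x = E1 (fun y => ret n (x + y)).
Proof. by []. Qed.

Lemma W_ret m n x z : W m x (fun t => ret n (last x t - z)) = ret (m + n) (x - z).
Proof.
elim: m x => //= m IH x; rewrite retS; congr (ev E1 _); apply: funext => y.
by rewrite (IH (x + y)) (addrAC x).
Qed.

Definition occ V n x : R := W n x (fun t => \sum_(z <- t) V z).

Lemma bnd_sum_sized V n : bnd setT V -> bnd (sized n) (fun t => \sum_(z <- t) V z).
Proof.
move=> [M hM]; exists (M *+ n) => t <-; elim: t => [|z t IH].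
  by rewrite big_nil normr0 mulr0n.
by rewrite big_cons mulrS (le_trans (ler_normD _ _))// lerD// hM.
Qed.

End potential.

(** * Khas'minskii's lemma and Green potentials *)

Section khasminskii.
Context {R : realType} {T : zmodType} (E1 : @mean R T setT).
Implicit Types (x y z : T) (A B t : seq T) (V : T -> R).
Local Notation W := (W E1).
Local Notation ret := (ret E1).
Local Notation occ := (occ E1).

Lemma bnd_occ V n (I : Type) (D : set I) (f : I -> T) : bnd setT V ->
  bnd D (fun i => occ V n (f i)).
Proof.
move=> /(bnd_sum_sized n)[M hM].
by apply: (@bnd_W _ _ _ _ _ _ _ _ M) => i t _ st; exact: hM.
Qed.

Lemma occ0 V x : occ V 0 x = 0. Proof. by rewrite /occ /= big_nil. Qed.

Lemma occS V n x : bnd setT V ->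
  occ V n.+1 x = E1 (fun y => V (x + y) + occ V n (x + y)).
Proof.
move=> hV; rewrite /occ /=; congr (ev E1 _); apply: funext => y.
rewrite -[V _ in RHS](W_cst E1 n (x + y)) -WD; last 2 first.
- exact: bnd_cst.
- exact: bnd_sum_sized.
by apply: W_eq => t _; rewrite big_cons.
Qed.

Lemma occ_ge0 V n x : bnd setT V -> (forall y, 0 <= V y) -> 0 <= occ V n x.
Proof.
move=> hV V0; apply: W_ge0 => [|t _]; first exact: bnd_sum_sized.
by rewrite sumr_ge0.
Qed.

Lemma bnd_step V x : bnd setT V -> bnd setT (fun y => V (x + y)).
Proof. exact: bnd_comp. Qed.

Lemma occ_leS V n x : bnd setT V -> (forall y, 0 <= V y) -> occ V n x <= occ V n.+1 x.
Proof.
move=> hV V0; elim: n x => [|n IH] x; first by rewrite occ0 occ_ge0.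
rewrite occS// [leRHS]occS//; apply: ev_le => [||y _].
- by apply: bndD; [exact: bnd_step|exact: bnd_occ].
- by apply: bndD; [exact: bnd_step|exact: bnd_occ].
- by rewrite lerD2l.
Qed.

Lemma occ_le V k m x : bnd setT V -> (forall y, 0 <= V y) -> (k <= m)%N ->
  occ V k x <= occ V m x.
Proof.
move=> hV V0 /subnK <-; elim: (m - k)%N => // n IH.
by rewrite addSn (le_trans IH)// occ_leS.
Qed.

Lemma expR_le1M (r : R) : expR r <= 1 + r * expR r.
Proof.
have := expR_ge1Dx (- r); rewrite expRN => h.
have e0 := expR_gt0 r.
have := ler_wpM2r (ltW e0) h; rewrite mulVf ?gt_eqF// mulrDl mul1r; lra.
Qed.

(** Induction on the first step in place of the power series. A point with V = 0 contributes no
    factor, so the potential has to be bounded only where V is positive, with the visit at time 0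
    counted. *)
Lemma khasminskii V (a kap : R) m : bnd setT V -> (forall y, 0 <= V y) ->
  0 <= a -> a * kap < 1 ->
  (forall y, 0 < V y -> V y + occ V m y <= kap) ->
  forall k x, (k <= m)%N ->
  W k x (fun t => expR (a * \sum_(z <- t) V z)) <= 1 + a / (1 - a * kap) * occ V k x.
Proof.
move=> hV V0 a0 ak hk; set K := (1 - a * kap)^-1.
have K0 : 0 < K by rewrite invr_gt0; lra.
have KE : K = 1 + a * kap * K by rewrite /K; field; lra.
elim=> [|k IH] x km.
  by rewrite /= big_nil mulr0 expR0 occ0 mulr0 addr0.
set u := fun y => W k y (fun t => expR (a * \sum_(z <- t) V z)).
have bu (c : T -> T) : bnd setT (fun y => u (c y)).
  have [M hM] := bnd_sum_sized k hV.
  apply: (@bnd_W _ _ _ _ _ _ _ _ (expR (a * M))) => y t _ st.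
  rewrite ger0_norm ?expR_ge0// ler_expR ler_wpM2l// (le_trans (ler_norm _))//.
  exact: hM.
have -> : W k.+1 x (fun t => expR (a * \sum_(z <- t) V z)) =
    E1 (fun y => expR (a * V (x + y)) * u (x + y)).
  congr (ev E1 _); apply: funext => y; rewrite /u -WZ; last first.
    apply: bnd_expR; apply: bndZ; exact: bnd_sum_sized.
  by apply: W_eq => t _; rewrite big_cons mulrDr expRD.
have key y : expR (a * V y) * u y <= 1 + a * K * (V y + occ V k y).
  have uy : u y <= 1 + a * K * occ V k y by apply: IH; exact: ltnW.
  have [Vy|Vy] := eqVneq (V y) 0.
    by rewrite Vy mulr0 expR0 mul1r add0r.
  have Vp : 0 < V y by rewrite lt0r Vy V0.
  have hky : V y + occ V k y <= kap.
    by apply: le_trans (hk _ Vp); rewrite lerD2l; apply: occ_le => //; exact: ltnW.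
  have u0 : 0 <= u y.
    apply: W_ge0 => [|t _]; last exact: expR_ge0.
    apply: bnd_expR; apply: bndZ; exact: bnd_sum_sized.
  set v := expR (a * V y) * u y.
  (* From exp(r) <= 1 + r exp(r) comes an inequality with [v] on both sides. It can be solved
     because a V <= a kap < 1; then K = 1 + a kap K turns the bound on [u y] into [v <= K], which is
     put back on the right. *)
  have e1 : v <= u y + a * V y * v.
    by have := ler_wpM2r u0 (expR_le1M (a * V y)); rewrite /v; lra.
  have oV := occ_ge0 k y hV V0.
  have aV : a * V y <= a * kap by apply: ler_wpM2l => //; lra.
  have aK : a * K * (V y + occ V k y) <= a * K * kap.
    by apply: ler_wpM2l => //; rewrite mulr_ge0// ltW.
  have vle : v * (1 - a * V y) <= K * (1 - a * V y).
    lra.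
  have vK : v <= K by move: vle; rewrite ler_pM2r//; lra.
  have : a * V y * v <= a * V y * K by apply: ler_wpM2l => //; rewrite mulr_ge0.
  lra.
rewrite occS// -evZ; last by apply: bndD; [exact: bnd_step|exact: bnd_occ].
rewrite -[X in X + _](ev_cst E1) -evD; last 2 first.
- exact: bnd_cst.
- by apply: bndM; [exact: bnd_cst|apply: bndD; [exact: bnd_step|exact: bnd_occ]].
apply: ev_le => [||y _]; last exact: key.
- apply: bndM => //; apply: bnd_expR; apply: bndZ; exact: bnd_step.
- apply: bndD; first exact: bnd_cst.
  by apply: bndM; [exact: bnd_cst|apply: bndD; [exact: bnd_step|exact: bnd_occ]].
Qed.

(** Green's functions truncated at time n, without and with the visit at time 0, and the potential
    at y of the points of A. *)
Definition gsum n x : R := \sum_(j < n) ret j.+1 x.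
Definition gfull n x : R := \sum_(j < n.+1) ret j x.
Definition pot n A y : R := \sum_(z <- A) gfull n (y - z).

Lemma gfullE n x : gfull n x = (x == 0)%:R + gsum n x.
Proof. by rewrite /gfull big_ord_recl ret0. Qed.

Lemma gsum_ge0 n x : 0 <= gsum n x.
Proof. by rewrite sumr_ge0// => j _; exact: ret_ge0. Qed.

Lemma gfull_ge0 n x : 0 <= gfull n x.
Proof. by rewrite sumr_ge0// => j _; exact: ret_ge0. Qed.

Lemma bnd_gfull n (I : Type) (D : set I) (f : I -> T) : bnd D (fun i => gfull n (f i)).
Proof. by apply: bnd_sum => j; exact: bnd_ret. Qed.

Lemma occ_pred1 z n x : occ (fun y => (y == z)%:R) n x = gsum n (x - z).
Proof.
elim: n x => [|n IH] x; first by rewrite occ0 /gsum big_ord0.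
rewrite occS; last exact: bnd_bool.
rewrite /gsum big_ord_recl retS; under eq_bigr do rewrite retS.
rewrite -ev_sum; last by move=> j; exact: bnd_ret.
rewrite -evD; last 2 first.
- exact: bnd_ret.
- by apply: bnd_sum => j; exact: bnd_ret.
by congr (ev E1 _); apply: funext => y; rewrite IH /gsum ret0 (addrAC x (- z)) subr_eq0.
Qed.

Lemma natr_count y A : (count_mem y A)%:R = \sum_(z <- A) (y == z)%:R :> R.
Proof.
elim: A => [|z A IH]; first by rewrite big_nil.
by rewrite big_cons -IH /= natrD eq_sym.
Qed.

Lemma occ_sum (I : Type) (s : seq I) (V : I -> T -> R) n x : (forall i, bnd setT (V i)) ->
  occ (fun y => \sum_(i <- s) V i y) n x = \sum_(i <- s) occ (V i) n x.
Proof.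
move=> hV; rewrite /occ -W_sum; last by move=> i; exact: bnd_sum_sized.
by apply: W_eq => t _; rewrite exchange_big.
Qed.

Lemma occ_count A n x : occ (fun y => (count_mem y A)%:R) n x = \sum_(z <- A) gsum n (x - z).
Proof.
have -> : (fun y => (count_mem y A)%:R) = (fun y => \sum_(z <- A) (y == z)%:R) :> (T -> R).
  by apply: funext => y; rewrite natr_count.
by rewrite occ_sum; [apply: eq_bigr => z _; rewrite occ_pred1|move=> z; exact: bnd_bool].
Qed.

Lemma potE n A y : (count_mem y A)%:R + \sum_(z <- A) gsum n (y - z) = pot n A y.
Proof.
by rewrite natr_count -big_split; apply: eq_bigr => z _ /=; rewrite gfullE subr_eq0.
Qed.

Lemma natr_cross A B : (cross A B)%:R = \sum_(z <- B) (count_mem z A)%:R :> R.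
Proof. by rewrite crossC /cross natr_sum. Qed.

Lemma bnd_count A : bnd setT (fun y => (count_mem y A)%:R : R).
Proof. by exists (size A)%:R => y _; rewrite ger0_norm// ler_nat count_size. Qed.

(** Here V is the local time of A, which lives on A: only the potential of A at its own points
    matters. *)
Lemma khasminskii_cross A (a kap : R) m x : 0 <= a -> a * kap < 1 ->
  (forall y, y \in A -> pot m A y <= kap) ->
  W m x (fun B => expR (a * (cross A B)%:R)) <=
  1 + a / (1 - a * kap) * \sum_(z <- A) gsum m (x - z).
Proof.
move=> a0 ak hA.
rewrite -occ_count.
under W_eq do rewrite natr_cross.
apply: (khasminskii (m := m)) => // [|y]; first exact: bnd_count.
rewrite ltr0n -has_count => /hasP[z zA /= /eqP zy].
by rewrite occ_count potE; apply: hA; rewrite -zy.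
Qed.

End khasminskii.

(** * Exponential moments of self-intersections at dyadic scales *)

Section self_intersections.
Context {R : realType} {T : zmodType} (E1 : @mean R T setT).
Implicit Types (x y z : T) (A B t : seq T).
Local Notation W := (W E1).
Local Notation ret := (ret E1).
Local Notation gsum := (gsum E1).
Local Notation gfull := (gfull E1).
Local Notation pot := (pot E1).

Lemma bnd_cross n (f g : seq T -> seq T) :
  (forall t, size (f t) <= size t)%N -> (forall t, size (g t) <= size t)%N ->
  bnd (sized n) (fun t => (cross (f t) (g t))%:R : R).
Proof.
move=> hf hg; exists (n * n)%:R => t <-; rewrite ger0_norm// ler_nat.
by rewrite (leq_trans (cross_le _ _))// leq_mul.
Qed.

Lemma bnd_selfint n (f : seq T -> seq T) : (forall t, size (f t) <= size t)%N ->
  bnd (sized n) (fun t => (selfint (f t))%:R : R).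
Proof. by move=> hf; exact: bnd_cross. Qed.

Definition Phi n (lam : R) : R := W n 0 (fun t => expR (lam * (selfint t)%:R)).

Lemma W_selfint n x (f : nat -> R) : W n x (fun t => f (selfint t)) = W n 0 (fun t => f (selfint t)).
Proof.
rewrite W_shift0; apply: W_eq => t _; congr f.
by rewrite /selfint cross_map//; exact: addrI.
Qed.

Lemma bnd_exp_selfint n (lam : R) (f : seq T -> seq T) : (forall t, size (f t) <= size t)%N ->
  bnd (sized n) (fun t => expR (lam * (selfint (f t))%:R)).
Proof. by move=> hf; apply: bnd_expR; apply: bndZ; exact: bnd_selfint. Qed.

Lemma size_take_le n t : (size (take n t) <= size t)%N.
Proof. by rewrite size_take_min geq_minr. Qed.

Lemma size_drop_le n t : (size (drop n t) <= size t)%N.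
Proof. by rewrite size_drop leq_subr. Qed.

Lemma Phi_ge0 n lam : 0 <= Phi n lam.
Proof. by apply: W_ge0 => [|t _]; [exact: bnd_exp_selfint|exact: expR_ge0]. Qed.

Lemma W_prod_selfint m n (lam mu : R) :
  W (m + n) 0 (fun t => expR (lam * (selfint (take m t))%:R) * expR (mu * (selfint (drop m t))%:R)) =
  Phi m lam * Phi n mu.
Proof.
rewrite W_cat mulrC -WZ; last exact: bnd_exp_selfint.
apply: W_eq => A sA; rewrite mulrC.
rewrite /Phi -(W_selfint n (last 0 A) (fun k => expR (mu * k%:R))) -WZ; last exact: bnd_exp_selfint.
by apply: W_eq => B _; rewrite take_size_cat// drop_size_cat.
Qed.

Variable C : R.
Hypothesis C0 : 0 < C.
Hypothesis retC : forall n x, ret n x <= heat C n.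

Lemma gfull_le n x : gfull n x <= 4 * C.
Proof.
apply: (@le_trans _ _ (\sum_(j < n.+1) heat C (0 + j))); first by apply: ler_sum => j _; exact: retC.
by apply: le_trans (sum_heat_le 0 n.+1 (ltW C0)) _; rewrite sqrtr1 divr1.
Qed.

Lemma gsum_le_gfull n x : gsum n x <= gfull n x.
Proof. by rewrite gfullE lerDr. Qed.

Lemma bnd_gsum n (I : Type) (D : set I) (f : I -> T) : bnd D (fun i => gsum n (f i)).
Proof. by apply: bnd_sum => j; exact: bnd_ret. Qed.

Lemma W_gsum m n x z : W m x (fun t => gsum n (last x t - z)) <= 4 * C / Num.sqrt m.+1%:R.
Proof.
rewrite /gsum W_sum; last by move=> j; exact: bnd_ret.
under eq_bigr do rewrite W_ret.
apply: (@le_trans _ _ (\sum_(j < n) heat C (m.+1 + j))).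
  by apply: ler_sum => j _; rewrite addSnnS; exact: retC.
apply: le_trans (sum_heat_le m.+1 n (ltW C0)) _.
rewrite ler_wpM2l ?mulr_ge0 ?(ltW C0)// lef_pV2 ?posrE ?sqrtr_gt0//.
by rewrite ler_wsqrtr// ler_nat.
Qed.

Lemma bnd_sum_gsum m n (y : seq T -> T) :
  bnd (sized m) (fun A => \sum_(z <- A) gsum n (y A - z)).
Proof.
exists ((4 * C) *+ m) => A <-; move: (y A) => w; elim: A => [|z t IH].
  by rewrite big_nil normr0 mulr0n.
rewrite big_cons mulrS (le_trans (ler_normD _ _))// lerD//.
by rewrite ger0_norm ?gsum_ge0// (le_trans (gsum_le_gfull _ _))// gfull_le.
Qed.

(** A point visited i steps before the end of the stretch is expected to be revisited later a number
    of times of order (i + 1)^(-1/2). Two consecutive stretches of length m thus cross about m^(1/2)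
    times in the mean, much less than m. *)
Lemma W_cross_le m n x :
  W m x (fun A => \sum_(z <- A) gsum n (last x A - z)) <= 8 * C * Num.sqrt m%:R.
Proof.
apply: (@le_trans _ _ (4 * C * \sum_(i < m) (Num.sqrt i.+1%:R)^-1)); last first.
  have := ler_wpM2l (_ : 0 <= 4 * C) (sum_invsqrt_le m).
  by rewrite mulrA => h; apply: le_trans (h _) _; [rewrite mulr_ge0// ltW|lra].
elim: m x => [|m IH] x; first by rewrite big_ord0 mulr0 /= big_nil.
rewrite big_ord_recr mulrDr /=; apply: ev_le_cst => [|y _].
  have [M hM] := bnd_sum_gsum m.+1 n (last x).
  by apply: (@bnd_W _ _ _ _ _ _ _ _ M) => y t _ st; apply: hM; rewrite /sized/= st.
under W_eq do rewrite big_cons.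
rewrite WD; [|exact: bnd_gsum|exact: bnd_sum_gsum].
by rewrite addrC lerD// W_gsum.
Qed.

Lemma pot_le n A y : pot n A y <= (size A)%:R * (4 * C).
Proof.
elim: A => [|z A IH]; first by rewrite /pot big_nil mul0r.
by rewrite /pot big_cons /= -natr1 mulrDl mul1r addrC lerD// gfull_le.
Qed.

(** Cauchy-Schwarz separates the two independent halves, taken at 2 lam, from their crossings, taken
    at 4 lam. The product of length and parameter is preserved. The crossings are treated by
    Khas'minskii's lemma with the crude bound 4 C m for the potential; the condition on lam makes
    its product with 4 lam at most 1/2. *)
Lemma Phi_double m (lam : R) : 0 <= lam -> 32 * C * m%:R * lam <= 1 ->
  Phi (m + m) lam <= Phi m (2 * lam) * expR (32 * C * lam * Num.sqrt m%:R).
Proof.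
move=> l0 lm.
pose f t := expR (lam * (selfint (take m t))%:R) * expR (lam * (selfint (drop m t))%:R).
pose g t := expR (2 * lam * (cross (take m t) (drop m t))%:R).
have bf : bnd (sized (m + m)) f.
  by apply: bndM; apply: bnd_exp_selfint => t; [exact: size_take_le|exact: size_drop_le].
have bc n (c : R) : bnd (sized n) (fun t => expR (c * (cross (take m t) (drop m t))%:R)).
  apply: bnd_expR; apply: bndM; first exact: bnd_cst.
  by apply: bnd_cross => t; [exact: size_take_le|exact: size_drop_le].
have -> : Phi (m + m) lam = W (m + m) 0 (fun t => f t * g t).
  apply: W_eq => t st; rewrite /f /g -!expRD; congr expR.
  by rewrite -{1}(cat_take_drop m t) selfint_cat -muln2 !natrD natrM; ring.
apply: le_trans (ev_cauchy_schwarz (Wm E1 (m + m) 0) bf (bc _ _)) _ => /=.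
have -> : W (m + m) 0 (fun t => f t ^+ 2) = Phi m (2 * lam) ^+ 2.
  rewrite expr2 -W_prod_selfint; apply: W_eq => t _.
  by rewrite /f exprMn -!expRM_natl !mulrA.
have -> : W (m + m) 0 (fun t => g t ^+ 2) =
    W m 0 (fun A => W m (last 0 A) (fun B => expR (4 * lam * (cross A B)%:R))).
  rewrite W_cat; apply: W_eq => A sA; apply: W_eq => B _.
  by rewrite /g -expRM_natl take_size_cat// drop_size_cat//; congr expR; ring.
rewrite sqrtrM ?sqr_ge0// sqrtr_sqr ger0_norm ?Phi_ge0// ler_wpM2l ?Phi_ge0//.
have m0 : 0 <= m%:R :> R by exact: ler0n.
set K := 64 * C * lam * Num.sqrt m%:R.
suff h : W m 0 (fun A => W m (last 0 A) (fun B => expR (4 * lam * (cross A B)%:R))) <= 1 + K.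
  have h2 : 1 + K <= expR (32 * C * lam * Num.sqrt m%:R) ^+ 2.
    rewrite -expRM_natl (_ : _ * _ = K) ?expR_ge1Dx// /K; ring.
  by rewrite -[leRHS]ger0_norm ?expR_ge0// -sqrtr_sqr ler_wsqrtr// (le_trans h).
have ak : 4 * lam * (m%:R * (4 * C)) <= 1 / 2 by lra.
apply: (@le_trans _ _ (W m 0 (fun A => 1 + 8 * lam * \sum_(z <- A) gsum m (last 0 A - z)))).
  apply: W_le => [| |A sA].
  - apply: (@bnd_W _ _ _ _ _ _ _ _ (expR (4 * lam * (m * m)%:R))) => A B sA sB.
    rewrite ger0_norm ?expR_ge0// ler_expR ler_wpM2l ?mulr_ge0// ler_nat.
    by rewrite (leq_trans (cross_le _ _))// sA sB.
  - by apply: bndD; [exact: bnd_cst|apply: bndZ; exact: bnd_sum_gsum].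
  apply: le_trans (@khasminskii_cross _ _ E1 A (4 * lam) (m%:R * (4 * C)) m (last 0 A) _ _ _) _.
  - by rewrite mulr_ge0.
  - by lra.
  - by move=> y _; rewrite -sA; exact: pot_le.
  rewrite lerD2l ler_wpM2r//; first by rewrite sumr_ge0// => z _; exact: gsum_ge0.
  by rewrite ler_pdivrMr; [nra|lra].
rewrite WD; [|exact: bnd_cst|by apply: bndZ; exact: bnd_sum_gsum].
rewrite W_cst WZ ?lerD2l; last exact: bnd_sum_gsum.
have l8 : 0 <= 8 * lam by rewrite mulr_ge0.
by apply: le_trans (ler_wpM2l l8 (W_cross_le m m 0)) _; rewrite /K; lra.
Qed.

(* Doubling loses a factor exp(2^(-k/2)) at scale 2^k, which is summable. *)
Lemma Phi_dyadic_le k (a : R) : 0 <= a -> 16 * C * a <= 1 ->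
  Phi (2 ^ k) (a / (2 ^ k)%:R) <= expR (a + 4).
Proof.
move=> a0 Ca.
(* At scale 2^k the loss in the exponent is at most r^k. Since r <= 3/4, this is at most 4 (r^k -
   r^(k+1)), and the losses add up to less than 4. *)
pose r : R := Num.sqrt 2^-1.
have r0 : 0 <= r by exact: sqrtr_ge0.
have r2 : r ^+ 2 = 2^-1 by rewrite sqr_sqrtr.
have r34 : r <= 3 / 4 by nra.
suff h : Phi (2 ^ k) (a / (2 ^ k)%:R) <= expR (a + 4 * (1 - r ^+ k)).
  apply: le_trans h _; rewrite ler_expR lerD2l.
  have := exprn_ge0 k r0; lra.
elim: k => [|k IH].
  rewrite expn0 divr1 expr0 subrr mulr0 addr0 /Phi -(W_cst E1 1 0 (expR a)).
  apply: W_le => [||t st]; [exact: bnd_exp_selfint|exact: bnd_cst|].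
  rewrite ler_expR ler_piMr// lern1.
  by rewrite (leq_trans (cross_le _ _))// st.
have p0 : 0 < (2 ^ k)%:R :> R by rewrite ltr0n expn_gt0.
have e2 : (2 ^ k.+1)%:R = 2 * (2 ^ k)%:R :> R by rewrite expnS natrM.
have := @Phi_double (2 ^ k) (a / (2 ^ k.+1)%:R).
rewrite addnn -mul2n -expnS; move=> h; apply: le_trans (h _ _) _.
- by rewrite divr_ge0.
- by rewrite e2 (_ : _ * _ = 16 * C * a)//; field; rewrite gt_eqF.
have -> : 2 * (a / (2 ^ k.+1)%:R) = a / (2 ^ k)%:R by rewrite e2; field; rewrite gt_eqF.
apply: le_trans (ler_wpM2r (expR_ge0 _) IH) _.
rewrite -expRD ler_expR -addrA lerD2l exprSr.
have sr : Num.sqrt (2 ^ k)%:R * r ^+ k = 1.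
  apply/eqP; rewrite -sqrp_eq1 ?mulr_ge0 ?sqrtr_ge0 ?exprn_ge0//.
  by rewrite exprMn sqr_sqrtr ?ler0n// exprAC r2 exprVn natrX mulfV// expf_neq0.
have s0 : 0 < Num.sqrt (2 ^ k)%:R :> R by rewrite sqrtr_gt0.
have s2 : Num.sqrt (2 ^ k)%:R ^+ 2 = (2 ^ k)%:R :> R by rewrite sqr_sqrtr ?ler0n.
have rk : r ^+ k = (Num.sqrt (2 ^ k)%:R)^-1 by apply: (mulfI (lt0r_neq0 s0)); rewrite sr mulfV ?gt_eqF.
have -> : 32 * C * (a / (2 ^ k.+1)%:R) * Num.sqrt (2 ^ k)%:R = 16 * C * a * r ^+ k.
  rewrite rk e2; move: s0 s2; set s := Num.sqrt _ => s0 <-.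
  by field; rewrite gt_eqF.
have rk0 := exprn_ge0 k r0.
have : 16 * C * a * r ^+ k <= r ^+ k by rewrite ler_piMl.
nra.
Qed.

End self_intersections.

(** * Cutting the trajectory into blocks *)

Section blocks.
Context {R : realType} {T : zmodType} (E1 : @mean R T setT).
Implicit Types (x y z : T) (A B t : seq T).
Local Notation W := (W E1).
Local Notation ret := (ret E1).
Local Notation occ := (occ E1).
Local Notation gsum := (gsum E1).
Local Notation pot := (pot E1).
Local Notation Phi := (Phi E1).

Lemma occ_ret k y n x : occ (fun z => ret k (z - y)) n x = \sum_(j < n) ret (j.+1 + k) (x - y).
Proof.
elim: n x => [|n IH] x; first by rewrite occ0 big_ord0.
rewrite occS; last exact: bnd_ret.
rewrite big_ord_recl; under eq_bigr do rewrite addSn retS.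
rewrite addSn retS -ev_sum; last by move=> j; exact: bnd_ret.
rewrite -evD; last 2 first.
- exact: bnd_ret.
- by apply: bnd_sum => j; exact: bnd_ret.
by congr (ev E1 _); apply: funext => z; rewrite IH add0n (addrAC x (- y)).
Qed.

(** A time followed by k further steps contributes itself and twice its later returns. This is the
    origin of the limit of E V_n / n. *)
Lemma W_mean_selfint n x : W n x (fun t => (selfint t)%:R) = \sum_(k < n) (1 + 2 * gsum k 0).
Proof.
elim: n x => [|n IH] x; first by rewrite big_ord0 /= /selfint cross_nil.
rewrite big_ord_recr /= -[RHS](ev_cst E1); congr (ev E1 _); apply: funext => y.
under W_eq do rewrite selfint_cons natrD.
rewrite WD; last 2 first.
- exists (n.*2.+1)%:R => t <-; rewrite ger0_norm// ler_nat ltnS leq_double; exact: count_size.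
- exact: bnd_selfint.
rewrite IH addrC; congr (_ + _).
under W_eq do rewrite -addn1 natrD -muln2 natrM mulrC addrC natr_count.
rewrite WD; last 2 first.
- exact: bnd_cst.
- apply: bndM; first exact: bnd_cst.
  exists n%:R => t <-; rewrite -natr_count ger0_norm// ler_nat; exact: count_size.
rewrite W_cst WZ; last first.
  exists n%:R => t <-; rewrite -natr_count ger0_norm// ler_nat; exact: count_size.
congr (_ + _ * _).
rewrite -(subrr (x + y)) -occ_pred1 /occ; apply: W_eq => t _.
by apply: eq_bigr => z _; rewrite eq_sym.
Qed.

(* Khas'minskii's condition for the crossings of the past t with the next tau steps. *)
Definition good tau (w : R) t : bool := all (fun y => pot tau t y <= w) (0 :: t).

Lemma pot_cat n A B y : pot n (A ++ B) y = pot n A y + pot n B y.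
Proof. by rewrite /pot big_cat. Qed.

Lemma pot_ge0 n A y : 0 <= pot n A y.
Proof. by rewrite sumr_ge0// => z _; exact: gfull_ge0. Qed.

(** Potentials only grow as the trajectory is extended, so a single event for the whole trajectory
    controls the past at the start of every block. *)
Lemma good_catl tau w A B : good tau w (A ++ B) -> good tau w A.
Proof.
move=> /allP h; apply/allP => y yA; apply: (@le_trans _ _ (pot tau (A ++ B) y)).
  by rewrite pot_cat lerDl pot_ge0.
by apply: h; move: yA; rewrite !inE mem_cat => /orP[->//|->]; rewrite orbT.
Qed.

Section blocks_of_length.
Variables (r tau : nat).

(* A trajectory of length r + N * tau is cut into a block of length r followed by
   N blocks of length tau; [off] counts each pair of intersecting blocks once. *)
Fixpoint diag N t : nat := if N is N'.+1 then
  (diag N' (take (r + N' * tau) t) + selfint (drop (r + N' * tau) t))%N else selfint t.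

Fixpoint off N t : nat := if N is N'.+1 then
  (off N' (take (r + N' * tau) t) + cross (take (r + N' * tau) t) (drop (r + N' * tau) t))%N
  else 0%N.

Lemma selfint_diag_off N t : selfint t = (diag N t + (off N t).*2)%N.
Proof.
elim: N t => [|N IH] t /=; first by rewrite addn0.
by rewrite -{1}(cat_take_drop (r + N * tau) t) selfint_cat (IH (take _ _)); lia.
Qed.

Lemma W_exp_diag N (lam : R) :
  W (r + N * tau) 0 (fun t => expR (lam * (diag N t)%:R)) = Phi r lam * Phi tau lam ^+ N.
Proof.
elim: N => [|N IH]; first by rewrite mul0n addn0 mulr1.
rewrite mulSnr addnA W_cat exprSr mulrA -IH.
rewrite mulrC -WZ; last first.
  apply: bnd_expR; apply: bndM; first exact: bnd_cst.
  exists ((r + N * tau) * (r + N * tau))%:R => t <-.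
  rewrite ger0_norm// ler_nat (leq_trans _ (cross_le t t))//.
  by rewrite -/(selfint t) (selfint_diag_off N) leq_addr.
apply: W_eq => A sA; rewrite mulrC.
rewrite /Phi -(W_selfint E1 tau (last 0 A) (fun k => expR (lam * k%:R))) -WZ; last exact: bnd_exp_selfint.
by apply: W_eq => B _ /=; rewrite take_size_cat// drop_size_cat// natrD mulrDr expRD.
Qed.

Lemma bnd_exp_off N (lam : R) n : bnd (sized n) (fun t => expR (lam * (off N t)%:R)).
Proof.
apply: bnd_expR; apply: bndM; first exact: bnd_cst.
exists (n * n)%:R => t <-.
rewrite ger0_norm// ler_nat (leq_trans _ (cross_le t t))//.
by rewrite -/(selfint t) (selfint_diag_off N); lia.
Qed.

(** The last block is integrated first. On a good past, Khas'minskii's lemma bounds the factor due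
    to its crossings by 1 + a w / (1 - a w) = 1 / (1 - a w), because the block starts from
    [last 0 A], one of the points where the potential is at most w. *)
Lemma W_exp_off N (a w : R) : 0 <= a -> a * w < 1 ->
  W (r + N * tau) 0 (fun t => expR (a * (off N t)%:R) * (good tau w t)%:R) <= (1 - a * w)^-1 ^+ N.
Proof.
move=> a0 aw; elim: N => [|N IH].
  apply: (ev_le_cst (Wm E1 _ 0)) => [|t _].
    by apply: bndM; [exact: bnd_exp_off|exact: bnd_bool].
  by rewrite /= mulr0 expR0 mul1r expr0; case: (good _ _ _).
have K0 : 0 < (1 - a * w)^-1 by rewrite invr_gt0; lra.
rewrite mulSnr addnA W_cat exprS.
apply: le_trans _ (ler_wpM2l (ltW K0) IH); rewrite -WZ; last first.
  by apply: bndM; [exact: bnd_exp_off|exact: bnd_bool].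
have bX M : bnd (sized (r + N * tau + M)) (fun t => expR (a * (off N.+1 t)%:R) * (good tau w t)%:R).
  by apply: bndM; [exact: bnd_exp_off|exact: bnd_bool].
apply: W_le => [||A sA].
- exact: (bnd_W_cat _ _ (bX tau)).
- by apply: bndM; [exact: bnd_cst|apply: bndM; [exact: bnd_exp_off|exact: bnd_bool]].
set e := expR (a * (off N A)%:R).
have bc : bnd (sized tau) (fun B => expR (a * (cross A B)%:R)).
  apply: bnd_expR; apply: bndM; first exact: bnd_cst.
  exists (size A * tau)%:R => B <-; rewrite ger0_norm// ler_nat; exact: cross_le.
(* Goodness of the whole trajectory is weakened to that of the past A, which no longer depends on
   the block B. *)
apply: (@le_trans _ _ (W tau (last 0 A) (fun B => (e * (good tau w A)%:R) * expR (a * (cross A B)%:R)))).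
  apply: W_le => [||B sB].
  - exact: bnd_cat (bX tau) sA.
  - by exact: bndZ.
  rewrite /= take_size_cat// drop_size_cat// natrD mulrDr expRD -/e.
  case gAB : (good tau w (A ++ B)); first by rewrite (good_catl gAB) !mulr1.
  by rewrite mulr0 !mulr_ge0 ?expR_ge0.
rewrite WZ// [leRHS]mulrC; case gA : (good tau w A); last by rewrite !mulr0 !mul0r.
rewrite mulr1 ler_wpM2l ?expR_ge0//.
have hA y : y \in 0 :: A -> pot tau A y <= w by move/allP: gA => /(_ y).
apply: le_trans (@khasminskii_cross _ _ E1 A a w tau (last 0 A) a0 aw _) _.
  by move=> y yA; apply: hA; rewrite inE yA orbT.
have hl : \sum_(z <- A) gsum tau (last 0 A - z) <= w.
  apply: le_trans (hA _ (mem_last _ _)).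
  by apply: ler_sum => z _; exact: gsum_le_gfull.
have : a / (1 - a * w) * \sum_(z <- A) gsum tau (last 0 A - z) <= a / (1 - a * w) * w.
  by apply: ler_wpM2l => //; rewrite mulr_ge0// ltW.
have e1 : (1 - a * w)^-1 = 1 + a / (1 - a * w) * w by field; lra.
by rewrite [X in _ -> _ <= X]e1 => h; rewrite lerD2l.
Qed.

End blocks_of_length.

Variables (C v : R).
Hypothesis C0 : 0 < C.
Hypothesis retC : forall n x, ret n x <= heat C n.
Hypothesis vub : forall n, 1 + 2 * gsum n 0 <= v.

Lemma mean_selfint_le n x : W n x (fun t => (selfint t)%:R) <= n%:R * v.
Proof.
rewrite W_mean_selfint; apply: (@le_trans _ _ (\sum_(k < n) v)); first by apply: ler_sum => k _.
by rewrite sumr_const card_ord mulr_natl.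
Qed.

Lemma expR_le_quad (y : R) : 0 <= y -> expR y <= 1 + y + y ^+ 2 * expR y.
Proof.
move=> y0; have h := expR_le1M y; have e := ler_wpM2l y0 h.
lra.
Qed.

Lemma sqr_le_expR (y : R) : 0 <= y -> y ^+ 2 <= 4 * expR y.
Proof.
move=> y0; have h := expR_ge1Dx (y / 2).
have -> : expR y = expR (y / 2) ^+ 2 by rewrite -expRM_natl; congr expR; lra.
nra.
Qed.

Definition quadC : R := 16 * (16 * C) ^+ 2 * expR ((16 * C)^-1 + 4).

(** The number U of self-intersections in tau = 2^k steps has mean at most tau v and a bounded
    exponential moment at scale tau. As lam tau <= a / 2, the latter dominates the remainder (lam
    U)^2 exp(lam U). *)
Lemma Phi_expansion k (lam : R) : 0 <= lam -> 32 * C * (2 ^ k)%:R * lam <= 1 ->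
  Phi (2 ^ k) lam <= expR (lam * (2 ^ k)%:R * v + quadC * (lam * (2 ^ k)%:R) ^+ 2).
Proof.
move=> l0 lk; set tau := (2 ^ k)%N in lk *.
have p0 : 0 < tau%:R :> R by rewrite ltr0n expn_gt0.
pose a : R := (16 * C)^-1.
have C16 : 0 < 16 * C by rewrite mulr_gt0.
have a0 : 0 < a by rewrite invr_gt0.
have aC : 16 * C * a = 1 by rewrite /a mulfV ?gt_eqF.
have la : lam * tau%:R <= a / 2.
  by rewrite -(ler_pM2l C16); lra.
apply: (@le_trans _ _ (1 + (lam * tau%:R * v + quadC * (lam * tau%:R) ^+ 2))); last exact: expR_ge1Dx.
have bs (c : R) n : bnd (sized n) (fun t => c * (selfint t)%:R).
  by apply: bndZ; exact: bnd_selfint.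
apply: (@le_trans _ _ (W tau 0 (fun t => 1 + (lam * (selfint t)%:R +
    16 * (lam * tau%:R / a) ^+ 2 * expR (a / tau%:R * (selfint t)%:R))))).
  apply: W_le => [||t _].
  - exact: bnd_exp_selfint.
  - apply: bndD; [exact: bnd_cst|apply: bndD; first exact: bs].
    by apply: bndZ; exact: bnd_exp_selfint.
  set U : R := (selfint t)%:R; have U0 : 0 <= U by exact: ler0n.
  apply: le_trans (expR_le_quad _) _; first exact: mulr_ge0.
  rewrite -addrA !lerD2l.
  pose y := a / (2 * tau%:R) * U.
  have y0 : 0 <= y by rewrite mulr_ge0// divr_ge0 ?(ltW a0)// mulr_ge0 ?(ltW p0).
  have lU : lam * U <= y.
    by rewrite /y ler_wpM2r// ler_pdivlMr ?mulr_gt0//; lra.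
  have -> : a / tau%:R * U = y + y by rewrite /y; field; rewrite gt_eqF.
  have -> : (lam * U) ^+ 2 = 4 * (lam * tau%:R / a) ^+ 2 * y ^+ 2.
    by rewrite /y; field; rewrite !gt_eqF.
  rewrite expRD.
  have h1 : expR (lam * U) <= expR y by rewrite ler_expR.
  have h2 := sqr_le_expR y0.
  have c0 : 0 <= 4 * (lam * tau%:R / a) ^+ 2 by rewrite mulr_ge0// sqr_ge0.
  have h3 : y ^+ 2 * expR (lam * U) <= (4 * expR y) * expR y.
    by apply: ler_pM => //; rewrite ?sqr_ge0 ?expR_ge0.
  have := ler_wpM2l c0 h3; lra.
rewrite WD; last 2 first.
- exact: bnd_cst.
- apply: bndD; first exact: bs.
  by apply: bndZ; exact: bnd_exp_selfint.
rewrite W_cst lerD2l WD; last 2 first.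
- exact: bs.
- by apply: bndZ; exact: bnd_exp_selfint.
rewrite WZ; last exact: bnd_selfint.
rewrite WZ; last exact: bnd_exp_selfint.
apply: lerD; first by rewrite -mulrA ler_wpM2l// mean_selfint_le.
have h4 := @Phi_dyadic_le _ _ E1 C C0 retC k a (ltW a0) (_ : 16 * C * a <= 1).
rewrite aC lexx in h4; have {}h4 := h4 isT.
have c0 : 0 <= 16 * (lam * tau%:R / a) ^+ 2 by rewrite mulr_ge0// sqr_ge0.
apply: le_trans (ler_wpM2l c0 h4) _.
rewrite /quadC -/a le_eqVlt; apply/orP; left; apply/eqP.
by rewrite expRD /a invrK; ring.
Qed.

Lemma Phi_le m n lam : 0 <= lam -> (m <= n)%N -> Phi m lam <= Phi n lam.
Proof.
move=> l0 mn; rewrite /Phi -(subnKC mn) W_cat.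
have b : bnd (sized (m + (n - m))) (fun t => expR (lam * (selfint t)%:R)) by exact: bnd_exp_selfint.
apply: W_le => [||A sA]; [exact: bnd_exp_selfint|exact: (bnd_W_cat _ _ b)|].
rewrite -[leLHS](W_cst E1 (n - m) (last 0 A)).
apply: W_le => [||B sB]; first exact: bnd_cst.
  exact: bnd_cat b sA.
by rewrite ler_expR ler_wpM2l// ler_nat selfint_cat -addnA leq_addr.
Qed.

(** Cauchy-Schwarz between blocks and crossings costs nothing at first order: the square root undoes
    the doubling of lam in the linear term, and only the quadratic term is doubled. The crossings
    give (1 - 4 lam w)^-1 <= exp(8 lam w) for each block before the root is taken. *)
Lemma W_exp_selfint_good_le r k N (lam w : R) : 0 <= lam -> (r <= 2 ^ k)%N ->
  64 * C * (2 ^ k)%:R * lam <= 1 -> 0 <= w -> 8 * lam * w <= 1 ->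
  W (r + N * 2 ^ k) 0 (fun t => expR (lam * (selfint t)%:R) * (good (2 ^ k) w t)%:R) <=
  expR (N.+1%:R * (lam * (2 ^ k)%:R * v + 2 * quadC * (lam * (2 ^ k)%:R) ^+ 2) + 4 * lam * w * N%:R).
Proof.
move=> l0 rk lk w0 lw; set tau := (2 ^ k)%N in rk lk *.
set n := (r + N * tau)%N.
have bd (c : R) : bnd (sized n) (fun t => expR (c * (diag r tau N t)%:R)).
  apply: bnd_expR; apply: bndM; first exact: bnd_cst.
  exists (n * n)%:R => t <-; rewrite ger0_norm// ler_nat (leq_trans _ (cross_le t t))//.
  by rewrite -/(selfint t) (selfint_diag_off r tau N) leq_addr.
have bo (c : R) : bnd (sized n) (fun t => expR (c * (off r tau N t)%:R) * (good tau w t)%:R).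
  by apply: bndM; [exact: bnd_exp_off|exact: bnd_bool].
have -> : W n 0 (fun t => expR (lam * (selfint t)%:R) * (good tau w t)%:R) =
    W n 0 (fun t => expR (lam * (diag r tau N t)%:R) * (expR (2 * lam * (off r tau N t)%:R) * (good tau w t)%:R)).
  apply: W_eq => t _; rewrite mulrA -expRD (selfint_diag_off r tau N) -muln2 natrD natrM.
  by congr (expR _ * _); ring.
apply: le_trans (ev_cauchy_schwarz (Wm E1 n 0) (bd _) (bo _)) _ => /=.
have -> : W n 0 (fun t => expR (lam * (diag r tau N t)%:R) ^+ 2) = Phi r (2 * lam) * Phi tau (2 * lam) ^+ N.
  by rewrite -W_exp_diag; apply: W_eq => t _; rewrite -expRM_natl mulrA.
have -> : W n 0 (fun t => (expR (2 * lam * (off r tau N t)%:R) * (good tau w t)%:R) ^+ 2) =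
   W n 0 (fun t => expR (4 * lam * (off r tau N t)%:R) * (good tau w t)%:R).
  apply: W_eq => t _; rewrite exprMn -expRM_natl; congr (expR _ * _); first ring.
  by case: (good _ _ _); rewrite ?expr1n ?expr0n.
have aw : 4 * lam * w <= 1 / 2 by lra.
have h1 : W n 0 (fun t => expR (4 * lam * (off r tau N t)%:R) * (good tau w t)%:R) <=
    expR (8 * lam * w * N%:R).
  apply: le_trans (W_exp_off _ _ _ _ _) _; [by rewrite mulr_ge0|lra|].
  rewrite [X in expR X]mulrC expRM_natl; apply: lerXn2r; rewrite ?nnegrE ?expR_ge0 ?invr_ge0//; first lra.
  rewrite -[leLHS]mul1r ler_pdivrMr; last lra.
  have lw0 : 0 <= 4 * lam * w by rewrite !mulr_ge0.
  have := expR_ge1Dx (8 * lam * w); nra.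
have ph : Phi tau (2 * lam) <= expR (2 * (lam * tau%:R * v + 2 * quadC * (lam * tau%:R) ^+ 2)).
  apply: le_trans (Phi_expansion _ _) _; [by rewrite mulr_ge0|rewrite -/tau; lra|].
  rewrite ler_expR le_eqVlt; apply/orP; left; apply/eqP; rewrite -/tau; ring.
set X := lam * tau%:R * v + 2 * quadC * (lam * tau%:R) ^+ 2 in ph *.
have h2 : Phi r (2 * lam) * Phi tau (2 * lam) ^+ N <= expR (2 * (N.+1%:R * X)).
  have -> : 2 * (N.+1%:R * X) = N.+1%:R * (2 * X) by ring.
  rewrite expRM_natl exprS; apply: ler_pM; rewrite ?Phi_ge0 ?exprn_ge0 ?Phi_ge0//.
    by apply: le_trans ph; apply: Phi_le => //; rewrite mulr_ge0.
  by apply: lerXn2r; rewrite ?nnegrE ?Phi_ge0 ?expR_ge0.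
apply: (@le_trans _ _ (Num.sqrt (expR (N.+1%:R * X + 4 * lam * w * N%:R) ^+ 2))).
  rewrite ler_wsqrtr// -expRM_natl mulrDr expRD; apply: ler_pM => //.
  - by rewrite mulr_ge0 ?exprn_ge0 ?Phi_ge0.
  - apply: W_ge0 => [|t _]; last by rewrite mulr_ge0 ?expR_ge0.
    exact: bo.
  - by rewrite (_ : 2 * (4 * lam * w * N%:R) = 8 * lam * w * N%:R)//; ring.
by rewrite sqrtr_sqr ger0_norm ?expR_ge0.
Qed.

End blocks.

(** * Exceptional events: large potentials and large local times *)

Section exceptional_events.
Context {R : realType} {T : zmodType} (E1 : @mean R T setT).
Implicit Types (x y z : T) (A B t : seq T).
Local Notation W := (W E1).
Local Notation ret := (ret E1).
Local Notation occ := (occ E1).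
Local Notation gfull := (gfull E1).
Local Notation pot := (pot E1).
Variable C : R.
Hypothesis C0 : 0 < C.
Hypothesis retC : forall n x, ret n x <= heat C n.
Hypothesis E1_opp : forall f, bnd setT f -> E1 (fun y => f (- y)) = E1 f.
Hypothesis E1_com : commuting E1.

Lemma ret_opp n x : ret n (- x) = ret n x.
Proof.
elim: n x => [|n IH] x; first by rewrite !ret0 oppr_eq0.
rewrite !retS -(E1_opp (f := fun y => ret n (x + y))); last exact: bnd_ret.
by congr (ev E1 _); apply: funext => y; rewrite -[RHS]IH opprB addrC.
Qed.

Lemma gfull_opp n x : gfull n (- x) = gfull n x.
Proof. by apply: eq_bigr => j _; exact: ret_opp. Qed.

Definition kap n : R := 8 * C * Num.sqrt n.+1%:R.

Lemma kap_ge n : 8 * C <= kap n.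
Proof. by rewrite /kap ler_peMr ?mulr_ge0 ?(ltW C0)// -[leLHS]sqrtr1 ler_wsqrtr// ler1n. Qed.

(** Composing the truncated Green's function with itself, the lag k of the second factor contributes
    a sum of return probabilities over times from k on, of order (k + 1)^(-1/2). Summed up to tau
    this is of order tau^(1/2), the size of [kap tau]. *)
Lemma occ_gfull_le tau x y :
  gfull tau (x - y) + occ (fun z => gfull tau (z - y)) tau x <= kap tau.
Proof.
rewrite /kap /gfull occ_sum; last by move=> k; exact: bnd_ret.
rewrite -big_split /=.
apply: (@le_trans _ _ (\sum_(k < tau.+1) 4 * C / Num.sqrt k.+1%:R)).
  apply: ler_sum => k _; rewrite occ_ret.
  apply: le_trans (sum_heat_le k tau.+1 (ltW C0)).
  rewrite big_ord_recl addn0 lerD//.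
  by apply: ler_sum => j _; rewrite lift0 addnC.
have := ler_wpM2l (_ : 0 <= 4 * C) (sum_invsqrt_le tau.+1).
rewrite mulr_sumr => h; apply: le_trans (h _) _; [by rewrite mulr_ge0// ltW|lra].
Qed.

Lemma bnd_exp_pot n (a : R) tau (f : seq T -> seq T) (g : seq T -> T) :
  (forall t, size (f t) <= size t)%N ->
  bnd (sized n) (fun t => expR (a * \sum_(z <- f t) gfull tau (z - g t))).
Proof.
move=> hf; apply: bnd_expR; apply: bndM; first exact: bnd_cst.
exists (n%:R * (4 * C)) => t st; rewrite ger0_norm ?sumr_ge0// => [|z _]; last exact: gfull_ge0.
apply: (@le_trans _ _ ((size (f t))%:R * (4 * C))); last first.
  by rewrite ler_wpM2r ?mulr_ge0 ?(ltW C0)// ler_nat -st.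
elim: (f t) => [|z s IH]; first by rewrite big_nil mul0r.
by rewrite big_cons /= -natr1 mulrDl mul1r addrC lerD// (gfull_le C0).
Qed.

(** As a kap <= 1/2, Khas'minskii's lemma gives a factor 2 for a stretch of at most tau steps,
    whatever its starting point; M stretches give 2^M by the Markov property. *)
Lemma W_exp_gfull_le (a : R) tau M n x y : 0 <= a -> 2 * a * kap tau <= 1 -> (n <= M * tau)%N ->
  W n x (fun t => expR (a * \sum_(z <- t) gfull tau (z - y))) <= 2 ^+ M.
Proof.
move=> a0 ak; have ak' : a * kap tau <= 1 / 2 by lra.
have one k z : (k <= tau)%N -> W k z (fun t => expR (a * \sum_(z <- t) gfull tau (z - y))) <= 2.
  move=> kt; apply: le_trans (khasminskii (kap := kap tau) (m := tau) _ _ a0 _ _ _ kt) _.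
  - exact: bnd_gfull.
  - by move=> u; exact: gfull_ge0.
  - lra.
  - by move=> u _; exact: occ_gfull_le.
  have h : occ (fun z => gfull tau (z - y)) k z <= kap tau.
    apply: le_trans (occ_gfull_le tau z y); rewrite -[leLHS]add0r lerD ?gfull_ge0//.
    apply: occ_le => //; [exact: bnd_gfull|by move=> u; exact: gfull_ge0].
  have -> : 2 = 1 + (1 : R) by lra.
  rewrite lerD2l mulrAC ler_pdivrMr ?mul1r; last lra.
  by have := ler_wpM2l a0 h; lra.
elim: M n x => [|M IH] n x hn.
  by move: hn; rewrite mul0n leqn0 => /eqP ->; rewrite /= big_nil mulr0 expR0 expr0.
have [nt|/ltnW tn] := leqP n tau.
  apply: le_trans (one n x nt) _; rewrite exprS ler_peMr// exprn_ege1// ler1n//.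
rewrite -(subnKC tn) W_cat exprS mulrC.
have b k : bnd (sized k) (fun t => expR (a * \sum_(z <- t) gfull tau (z - y))) by exact: bnd_exp_pot.
apply: le_trans _ (ler_wpM2l _ (one tau x (leqnn _))); last by rewrite exprn_ge0.
rewrite -WZ//; apply: W_le => [||A sA].
- exact: (bnd_W_cat _ _ (b (tau + (n - tau))%N)).
- by exact: bndZ.
under W_eq do rewrite big_cat mulrDr expRD.
rewrite WZ// mulrC ler_wpM2r ?expR_ge0//.
by apply: IH; lia.
Qed.

Lemma sum_reverse_traj (F : T -> R) t :
  \sum_(z <- 0 :: t) F (last 0 t - z) = F 0 + \sum_(z <- reverse_traj t) F z.
Proof.
rewrite lastI -cats1 big_cat big_seq1 subrr addrC; congr (_ + _).
by rewrite /reverse_traj big_map big_rev.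
Qed.

(** The potential that a past exerts at its own endpoint becomes, after time reversal, the potential
    of the origin collected by a walk that leaves it. The reversed trajectory omits the endpoint,
    whose own term exp(a [gfull tau 0]) accounts for the leading factor 2. *)
Lemma W_exp_gfull_rev_le (a : R) tau M n : 0 <= a -> 2 * a * kap tau <= 1 -> (n <= M * tau)%N ->
  W n 0 (fun t => expR (a * \sum_(z <- t) gfull tau (z - last 0 t))) <= 2 * 2 ^+ M.
Proof.
move=> a0 ak hn.
have ->: W n 0 (fun t => expR (a * \sum_(z <- t) gfull tau (z - last 0 t))) =
   W n 0 (fun t => expR (a * \sum_(z <- t) gfull tau (last 0 t - z))).
  by apply: W_eq => t _; congr (expR (_ * _)); apply: eq_bigr => z _; rewrite -gfull_opp opprB.
have b0 : bnd (sized n) (fun t => expR (a * \sum_(z <- t) gfull tau z)).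
  by have := @bnd_exp_pot n a tau id (fun=> 0) (fun=> leqnn _); under eq_fun do under eq_bigr do rewrite subr0.
have b1 : bnd (sized n) (fun t => expR (a * \sum_(z <- reverse_traj t) gfull tau z)).
  have := @bnd_exp_pot n a tau reverse_traj (fun=> 0).
  by under eq_fun do under eq_bigr do rewrite subr0; apply => t; rewrite size_reverse_traj.
apply: (@le_trans _ _ (W n 0 (fun t => 2 * expR (a * \sum_(z <- reverse_traj t) gfull tau z)))).
  apply: W_le => [||t _].
  - have := @bnd_exp_pot n a tau id (last 0) (fun=> leqnn _).
    by under eq_fun do under eq_bigr do rewrite -gfull_opp opprB.
  - by exact: bndZ.
  have c1 : expR (a * gfull tau 0) <= 2.
    have g4 := ler_wpM2l a0 (gfull_le C0 retC tau 0).
    have k8 := ler_wpM2l a0 (kap_ge tau).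
    have e1 := expR_ge1Dx (- (1 / 4 : R)); rewrite expRN in e1.
    apply: (@le_trans _ _ (expR (1 / 4))); first by rewrite ler_expR; lra.
    have u0 := expR_gt0 (1 / 4 : R).
    by move: e1; rewrite -(ler_pM2r u0) mulVf ?gt_eqF//; lra.
  apply: le_trans _ (ler_wpM2r (expR_ge0 _) c1).
  rewrite -expRD ler_expR -mulrDr ler_wpM2l//.
  rewrite -(sum_reverse_traj (gfull tau)) big_cons lerDr.
  exact: gfull_ge0.
rewrite WZ// ler_wpM2l// (W_reverse (F := fun t => expR (a * \sum_(z <- t) gfull tau z)))//.
apply: le_trans (W_exp_gfull_le 0 0 a0 ak hn).
apply: W_le => //; first exact: bnd_exp_pot.
by move=> t _; under [in leRHS]eq_bigr do rewrite subr0.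
Qed.

Lemma mem_traj_take y t : y \in 0 :: t -> exists2 s : 'I_(size t).+1, True & y = last 0 (take s t).
Proof.
rewrite inE => /orP[/eqP ->|yt]; first by exists ord0 => //; rewrite take0.
have it : ((index y t).+1 < (size t).+1)%N by rewrite ltnS index_mem.
exists (Ordinal it) => //=.
by rewrite (take_nth 0) ?index_mem// last_rcons nth_index.
Qed.

Lemma markov_exp (a w s : R) : 0 <= a -> w < s -> 1 <= expR (a * s - a * w).
Proof. by move=> a0 ws; rewrite -[leLHS]expR0 ler_expR -mulrBr mulr_ge0// subr_ge0 ltW. Qed.

(** Union over the n + 1 times s. If the potential at S_s exceeds w, the part due to the past or the
    part due to the future exceeds w / 2. At a = 1 / (2 kap) their exponential moments are at most 2
    * 2^M, by reversal, and 2^M; hence the factor 3 and the exponent a w / 2. *)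
Lemma W_not_good_le tau M n (w : R) : (n <= M * tau)%N ->
  W n 0 (fun t => (~~ good E1 tau w t)%:R) <= n.+1%:R * (3 * 2 ^+ M * expR (- (w / (4 * kap tau)))).
Proof.
move=> hn; have k0 : 0 < kap tau by apply: lt_le_trans (kap_ge tau); rewrite mulr_gt0.
pose a : R := (2 * kap tau)^-1.
have a0 : 0 <= a by rewrite invr_ge0 mulr_ge0// ltW.
have ak : 2 * a * kap tau <= 1 by rewrite /a le_eqVlt; apply/orP; left; apply/eqP; field; rewrite gt_eqF.
pose f (s : nat) t : R := expR (a * \sum_(z <- take s t) gfull tau (z - last 0 (take s t))).
pose g (s : nat) t : R := expR (a * \sum_(z <- drop s t) gfull tau (z - last 0 (take s t))).
pose e := expR (- (w / (4 * kap tau))).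
have eE : e = expR (- (a * (w / 2))) by rewrite /e /a; congr expR; field; rewrite gt_eqF.
have bf s : bnd (sized n) (f s) by apply: bnd_exp_pot => t; exact: size_take_le.
have bg s : bnd (sized n) (g s) by apply: bnd_exp_pot => t; exact: size_drop_le.
have bfg (s : nat) : bnd (sized n) (fun t => e * (f s t + g s t)).
  by apply: bndZ; exact: bndD.
apply: (@le_trans _ _ (W n 0 (fun t => \sum_(s < n.+1) e * (f s t + g s t)))).
  apply: W_le => [||t st]; [exact: bnd_bool|by apply: bnd_sum => s; exact: bfg|].
  have p0 (s : 'I_n.+1) : 0 <= e * (f s t + g s t).
    by rewrite mulr_ge0 ?addr_ge0 ?expR_ge0.
  case gt : (good E1 tau w t); first by rewrite sumr_ge0.
  move/negbT: gt => /allPn[y yt]; rewrite -ltNge => hw.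
  have [s0 _ ys] := mem_traj_take yt; rewrite st in s0 ys.
  rewrite (bigD1 s0)//= -[leLHS]addr0; apply: lerD; last by apply: sumr_ge0 => s _; exact: p0.
  have : w < pot tau (take s0 t) y + pot tau (drop s0 t) y by rewrite -pot_cat cat_take_drop.
  have pE B : pot tau B y = \sum_(z <- B) gfull tau (z - last 0 (take s0 t)).
    by rewrite ys; apply: eq_bigr => z _; rewrite -gfull_opp opprB.
  rewrite !pE => h; rewrite mulrDr eE.
  have pos (r : R) : 0 <= expR (- (a * (w / 2))) * expR r by rewrite mulr_ge0 ?expR_ge0.
  have big r : w / 2 < r -> 1 <= expR (- (a * (w / 2))) * expR (a * r).
    by move=> hr; rewrite -expRD addrC; exact: markov_exp.
  have [h1|h1] := ltP (w / 2) (\sum_(z <- take s0 t) gfull tau (z - last 0 (take s0 t))).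
    by rewrite -[leLHS]addr0 lerD ?pos// big.
  by rewrite -[leLHS]add0r lerD ?pos// big//; lra.
rewrite W_sum//; apply: (@le_trans _ _ (\sum_(s < n.+1) 3 * 2 ^+ M * e)); last first.
  by rewrite sumr_const card_ord -[leLHS]mulr_natl.
apply: ler_sum => -[s hs] _ /=.
rewrite WZ; last exact: bndD.
rewrite mulrC ler_wpM2r ?expR_ge0// WD//.
have sn : (s <= n)%N by rewrite -ltnS.
clear hs.
have -> : 3 * 2 ^+ M = 2 * 2 ^+ M + 2 ^+ M :> R by ring.
rewrite -(subnKC sn) !W_cat; apply: lerD.
  apply: le_trans (@W_exp_gfull_rev_le a tau M s a0 ak (leq_trans sn hn)).
  rewrite le_eqVlt; apply/orP; left; apply/eqP; apply: W_eq => A sA.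
  rewrite -[RHS](W_cst E1 (n - s) (last 0 A)); apply: W_eq => B _.
  by rewrite /f take_size_cat.
have bG : bnd (sized (s + (n - s))) (g s) by apply: bnd_exp_pot => t; exact: size_drop_le.
apply: (ev_le_cst (Wm E1 s 0)) => [|A sA]; first exact: (bnd_W_cat _ _ bG).
have := @W_exp_gfull_le a tau M (n - s) (last 0 A) (last 0 A) a0 ak (leq_trans (leq_subr _ _) hn).
apply: le_trans; rewrite le_eqVlt; apply/orP; left; apply/eqP; apply: W_eq => B _.
by rewrite /g take_size_cat// drop_size_cat.
Qed.

Definition thin (M : nat) t : bool := all (fun y => count_mem y t <= M)%N t.

Lemma W_exp_count_le (a : R) n x y : 0 <= a -> 8 * C * a <= 1 ->
  W n x (fun t => expR (a * (count_mem y t)%:R)) <= 2.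
Proof.
move=> a0 aC.
under W_eq do rewrite natr_count.
have -> : W n x (fun t => expR (a * \sum_(z <- t) (y == z)%:R)) =
   W n x (fun t => expR (a * \sum_(z <- t) (z == y)%:R)).
  by apply: W_eq => t _; congr (expR (_ * _)); apply: eq_bigr => z _; rewrite eq_sym.
apply: le_trans (khasminskii (kap := 4 * C) (m := n) _ _ a0 _ _ _ (leqnn n)) _.
- exact: bnd_bool.
- by move=> z; exact: ler0n.
- lra.
- by move=> z _; rewrite occ_pred1 -subr_eq0 -gfullE (gfull_le C0).
have h : occ (fun z => (z == y)%:R) n x <= 4 * C.
  by rewrite occ_pred1; apply: le_trans (gsum_le_gfull _ _ _) _; rewrite (gfull_le C0).
have -> : 2 = 1 + (1 : R) by lra.
rewrite lerD2l mulrAC ler_pdivrMr ?mul1r; last lra.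
by have := ler_wpM2l a0 h; lra.
Qed.

(** A site with more than M visits has at least M of them after the first, and their number has
    exponential moment at most 2 at a = 1 / (8 C). The union is over the time of the first visit,
    which [index] picks. *)
Lemma W_not_thin_le M n : W n 0 (fun t => (~~ thin M t)%:R) <= n%:R * (2 * expR (- (M%:R / (8 * C)))).
Proof.
pose a : R := (8 * C)^-1.
have a0 : 0 <= a by rewrite invr_ge0 mulr_ge0// ltW.
have aC : 8 * C * a <= 1 by rewrite /a mulfV// gt_eqF// mulr_gt0.
pose f (s : nat) t : R := expR (a * (count_mem (last 0 (take s.+1 t)) (drop s.+1 t))%:R).
pose e := expR (- (M%:R / (8 * C))).
have bf s k : bnd (sized k) (f s).
  apply: bnd_expR; apply: bndM; first exact: bnd_cst.
  exists k%:R => t <-; rewrite ger0_norm// ler_nat.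
  by rewrite (leq_trans (count_size _ _))// size_drop_le.
apply: (@le_trans _ _ (W n 0 (fun t => \sum_(s < n) e * f s t))).
  apply: W_le => [||t st]; first exact: bnd_bool.
    by apply: bnd_sum => s; apply: bndZ; exact: bf.
  have p0 (s : 'I_n) : 0 <= e * f s t by rewrite mulr_ge0 ?expR_ge0.
  case gt : (thin M t); first by rewrite sumr_ge0.
  move/negbT: gt => /allPn[y yt]; rewrite -ltnNge => hw.
  have it : (index y t < n)%N by rewrite -st index_mem.
  rewrite (bigD1 (Ordinal it))//= -[leLHS]addr0; apply: lerD; last by apply: sumr_ge0 => s _; exact: p0.
  have ly : last 0 (take (index y t).+1 t) = y.
    by rewrite (take_nth 0) ?index_mem// last_rcons nth_index.
  have hc : (M <= count_mem y (drop (index y t).+1 t))%N.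
    move: hw; rewrite -{1}(cat_take_drop (index y t).+1 t) count_cat.
    suff -> : count_mem y (take (index y t).+1 t) = 1%N by [].
    rewrite (take_nth 0) ?index_mem// -cats1 count_cat /= nth_index// eqxx addn0.
    have /count_memPn -> // : y \notin take (index y t) t.
    by rewrite in_take_leq ?ltnn// ltnW// index_mem.
  rewrite /f ly /e -expRD -[leLHS]expR0 ler_expR addrC subr_ge0 [leLHS]mulrC.
  by apply: ler_wpM2l => //; rewrite ler_nat.
rewrite W_sum; last by move=> s; apply: bndZ; exact: bf.
apply: (@le_trans _ _ (\sum_(s < n) 2 * e)); last by rewrite sumr_const card_ord -[leLHS]mulr_natl.
apply: ler_sum => -[s hs] _ /=.
rewrite WZ// mulrC ler_wpM2r ?expR_ge0//.
rewrite -(subnKC hs) W_cat.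
apply: (ev_le_cst (Wm E1 s.+1 0)) => [|A sA]; first exact: (bnd_W_cat _ _ (bf _ _)).
have := @W_exp_count_le a (n - s.+1) (last 0 A) (last 0 A) a0 aC.
apply: le_trans; rewrite le_eqVlt; apply/orP; left; apply/eqP; apply: W_eq => B _.
by rewrite /f take_size_cat// drop_size_cat.
Qed.

End exceptional_events.

Section elementary_bounds.
Context {R : realType}.

Lemma dyadic_approx (x : R) : 1 <= x -> exists k, x <= (2 ^ k)%:R <= 2 * x.
Proof.
move=> x1.
have ex : exists k, x <= (2 ^ k)%:R.
  exists (Num.bound x); apply: (@le_trans _ _ (Num.bound x)%:R).
    by apply/ltW; rewrite archi_boundP// (le_trans ler01).
  by rewrite ler_nat ltnW// ltn_expl.
exists (ex_minn ex); case: ex_minnP => k hk hmin; rewrite hk /=.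
case: k hk hmin => [|k] hk hmin; first by rewrite expn0; lra.
rewrite expnS natrM ler_pM2l// leNgt; apply/negP => /ltW h.
by have := hmin _ h; rewrite ltnn.
Qed.

(** From x <= exp(x) at x = c0 c / 4, raised to the fourth power; 256 is 4^4. It serves to absorb
    factors n = c^3 into exp(c0 c). *)
Lemma cube_le_expR (c0 K c : R) : 0 < c0 -> 0 <= K -> 256 * K / c0 ^+ 4 <= c -> K * c ^+ 3 <= expR (c0 * c).
Proof.
move=> c00 K0 hc.
have c4 : 0 < c0 ^+ 4 by rewrite exprn_gt0.
have cc : 0 <= c.
  by apply: le_trans hc; apply: divr_ge0; [apply: mulr_ge0; [exact: ler0n|exact: K0]|exact: ltW].
have -> : expR (c0 * c) = expR (c0 * c / 4) ^+ 4.
  by rewrite -expRM_natl; congr expR; field.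
have h1 : c0 * c / 4 <= expR (c0 * c / 4).
  by apply: le_trans (expR_ge1Dx _); rewrite lerDr.
have y0 : 0 <= c0 * c / 4 by rewrite !mulr_ge0// ltW.
apply: (@le_trans _ _ ((c0 * c / 4) ^+ 4)); last by apply: lerXn2r; rewrite ?nnegrE ?expR_ge0.
have h2 : 256 * K <= c * c0 ^+ 4 by rewrite -ler_pdivrMr.
have -> : (c0 * c / 4) ^+ 4 = c * c0 ^+ 4 / 256 * c ^+ 3 by field.
by rewrite ler_wpM2r ?exprn_ge0//; lra.
Qed.

End elementary_bounds.

(** * Exponential moments of V_n at the scale c = n^(1/3) *)

Section self_intersection_moments.
Context {R : realType} {T : zmodType} (E1 : @mean R T setT).
Implicit Types (x y z : T) (A B t : seq T).
Local Notation W := (W E1).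
Local Notation gsum := (gsum E1).
Local Notation ret := (ret E1).
Local Notation good := (good E1).
Variables (C v : R).
Hypothesis C0 : 0 < C.
Hypothesis retC : forall n x, ret n x <= heat C n.
Hypothesis E1_opp : forall f, bnd setT f -> E1 (fun y => f (- y)) = E1 f.
Hypothesis E1_com : commuting E1.
Hypothesis vub : forall n, 1 + 2 * gsum n 0 <= v.
Hypothesis vlim : forall e, 0 < e -> exists K, forall k, (K <= k)%N -> v - e <= 1 + 2 * gsum k 0.

Lemma v_ge1 : 1 <= v.
Proof. by apply: le_trans (vub 0); rewrite /gsum big_ord0 mulr0 addr0. Qed.

Lemma mean_selfint_ge (e : R) : 0 < e -> exists n0, forall n, (n0 <= n)%N ->
  n%:R * (v - e) <= W n 0 (fun t => (selfint t)%:R).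
Proof.
move=> e0; have e20 : 0 < e / 2 by rewrite divr_gt0.
have [K hK] := vlim e20.
have v1 := v_ge1.
exists (K + Num.bound (2 * K%:R * v / e))%N => n hn.
have Kn : (K <= n)%N by apply: leq_trans hn; rewrite leq_addr.
have nb : 2 * K%:R * v / e <= n%:R.
  apply: (@le_trans _ _ (Num.bound (2 * K%:R * v / e))%:R); last first.
    by rewrite ler_nat (leq_trans _ hn)// leq_addl.
  by apply/ltW; rewrite archi_boundP// !mulr_ge0// ?invr_ge0 ?(ltW e0)//; lra.
rewrite W_mean_selfint -(subnKC Kn) big_split_ord /=.
apply: (@le_trans _ _ (\sum_(i < n - K) (v - e / 2))); last first.
  rewrite -[leLHS]add0r lerD//.
    by rewrite sumr_ge0// => i _; rewrite addr_ge0// mulr_ge0// gsum_ge0.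
  by apply: ler_sum => i _; apply: hK; rewrite leq_addr.
rewrite sumr_const card_ord -[leRHS]mulr_natl subnKC// natrB//.
have nb' : 2 * K%:R * v <= n%:R * e by rewrite -ler_pdivrMr.
have K0 : 0 <= K%:R :> R by exact: ler0n.
by nra.
Qed.

Lemma not_good_or_thin (eps c : R) n : 0 < eps <= 1 -> c ^+ 3 = n%:R -> 1 <= c -> 2 <= eps ^+ 2 * c ->
  exists k N r w, [/\ n = (r + N * 2 ^ k)%N, (r <= 2 ^ k)%N,
    c ^+ 2 / eps <= (2 ^ k)%:R <= 2 * (c ^+ 2 / eps) /\ (2 ^ k)%:R <= eps * n%:R,
    [/\ 0 <= w, w <= 256 * C * c ^+ 2 & w * N%:R <= 256 * C * eps * n%:R] &
    W n 0 (fun t => (~~ (good (2 ^ k) w t && thin (Num.truncn c) t))%:R) <=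
    c ^+ 3 * (6 * expR (- (eps / 2 * c)) + 2 * expR (8 * C)^-1 * expR (- (c / (8 * C))))].
Proof.
move=> /andP[e0 e1] cn c1 ec.
have c0 : 0 < c by lra.
have x1 : 1 <= c ^+ 2 / eps by rewrite ler_pdivlMr// mul1r (le_trans e1)// exprn_ege1.
have [k /andP[k1 k2]] := dyadic_approx x1.
set tau := (2 ^ k)%N in k1 k2 *.
have t0N : (0 < tau)%N by rewrite expn_gt0.
have t0 : 0 < tau%:R :> R by rewrite ltr0n.
(* This is what [2 <= eps ^+ 2 * c] is for: a block is a small part of the trajectory. *)
have ten : tau%:R <= eps * n%:R.
  apply: le_trans k2 _; rewrite -cn mulrA ler_pdivrMr//.
  have : 2 * c ^+ 2 <= (eps ^+ 2 * c) * c ^+ 2 by rewrite ler_wpM2r// exprn_ge0// ltW.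
  by lra.
have n0 : 0 < n%:R :> R by rewrite -cn exprn_gt0.
have tn : tau%:R <= n%:R :> R by apply: le_trans ten _; rewrite ler_piMl// ltW.
pose N := (n %/ tau)%N; pose r := (n %% tau)%N.
have nE : n = (r + N * tau)%N by rewrite addnC -divn_eq.
have rt : (r <= tau)%N by rewrite ltnW// ltn_mod.
have NM : (n <= N.+1 * tau)%N by rewrite mulSn {1}nE leq_add2r.
have Nn : N%:R * tau%:R <= n%:R :> R by rewrite -natrM ler_nat leq_trunc_div.
have nN : n%:R <= N.+1%:R * tau%:R :> R by rewrite -natrM ler_nat.
(* With this w the bound on large potentials contains exp(- 2 (N + 1)), which beats 2^(N + 1), and N
   + 1 >= eps c / 2. *)
pose w := 8 * kap C tau * N.+1%:R.
have kap0 : 0 < kap C tau by rewrite /kap mulr_gt0 ?mulr_gt0 ?sqrtr_gt0.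
pose s : R := Num.sqrt tau%:R.
have s0 : 0 < s by rewrite sqrtr_gt0.
have s2 : tau%:R = s ^+ 2 by rewrite sqr_sqrtr// ltW.
have cs : c <= s.
  rewrite -(@ler_pXn2r _ 2) ?nnegrE ?(ltW c0) ?(ltW s0)// -s2.
  by apply: le_trans k1; rewrite ler_pdivlMr// ler_piMr// exprn_ge0// ltW.
have kaps : kap C tau <= 16 * C * s.
  have : Num.sqrt tau.+1%:R <= 2 * s.
    rewrite -(@ler_pXn2r _ 2) ?nnegrE ?sqrtr_ge0 ?mulr_ge0 ?(ltW s0)//.
    rewrite sqr_sqrtr ?ler0n// exprMn -s2 -natr1.
    have : 1 <= tau%:R :> R by rewrite ler1n.
    by lra.
  have C8 : 0 <= 8 * C by rewrite mulr_ge0// ltW.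
  by move/(ler_wpM2l C8); rewrite /kap; lra.
have N1 : N.+1%:R * s ^+ 2 <= 2 * n%:R by rewrite -s2 -natr1; lra.
have ws : w * s <= 256 * C * n%:R.
  have h : kap C tau * (N.+1%:R * s) <= 16 * C * s * (N.+1%:R * s).
    by rewrite ler_wpM2r// mulr_ge0// ltW.
  have h2 : 128 * C * (N.+1%:R * s ^+ 2) <= 128 * C * (2 * n%:R).
    by apply: ler_wpM2l; [apply: mulr_ge0; [exact: ler0n|exact: ltW]|exact: N1].
  by rewrite /w; lra.
have w0 : 0 <= w by rewrite /w !mulr_ge0// ltW.
exists k, N, r, w; split => //.
- by rewrite k1 k2.
- split => //.
    have : w * c <= w * s by rewrite ler_wpM2l.
    move/le_trans/(_ ws); rewrite -cn => h.
    by rewrite -(ler_pM2r c0); lra.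
  have k1' : c ^+ 2 <= eps * s ^+ 2 by rewrite -s2 mulrC -ler_pdivrMr.
  have h1 : w * s * (N%:R * s ^+ 2) <= 256 * C * n%:R * n%:R.
    by apply: ler_pM; rewrite // -?s2 ?mulr_ge0// ltW.
  have h2 : n%:R <= eps * (s ^+ 2 * s).
    have : c ^+ 2 * c <= eps * s ^+ 2 * s.
      by apply: ler_pM => //; rewrite ?exprn_ge0 ?(ltW c0).
    by rewrite -cn; lra.
  have h3 : 256 * C * n%:R * n%:R <= 256 * C * n%:R * (eps * (s ^+ 2 * s)).
    apply: ler_wpM2l; last exact: h2.
    by apply: mulr_ge0; [apply: mulr_ge0; [exact: ler0n|exact: ltW]|exact: ltW].
  have s3 : 0 < s ^+ 2 * s by rewrite mulr_gt0// exprn_gt0.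
  by rewrite -(ler_pM2r s3); lra.
rewrite -/tau.
have bb (p : pred (seq T)) : bnd (sized n) (fun t => (p t)%:R : R) by exact: bnd_bool.
apply: (@le_trans _ _ (W n 0 (fun t => (~~ good tau w t)%:R + (~~ thin (Num.truncn c) t)%:R))).
  apply: W_le => [||t _]; [exact: bnd_bool|apply: bndD; exact: bnd_bool|].
  by case: (good _ _ _); case: (thin _ _) => //=; rewrite ?addr0 ?add0r// ler_wpDl.
rewrite WD; [|exact: bnd_bool|exact: bnd_bool].
rewrite mulrDr; apply: lerD.
  apply: le_trans (@W_not_good_le _ _ E1 C C0 retC E1_opp E1_com tau N.+1 n w NM) _.
  have -> : w / (4 * kap C tau) = N.+1%:R * 2 by rewrite /w; field; rewrite gt_eqF.
  have e2 : 2 ^+ N.+1 <= expR (N.+1%:R * 1) :> R.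
    rewrite expRM_natl; apply: lerXn2r; rewrite ?nnegrE ?expR_ge0//.
    by have := expR_ge1Dx (1 : R); lra.
  have e3 : 2 ^+ N.+1 * expR (- (N.+1%:R * 2)) <= expR (- N.+1%:R) :> R.
    apply: le_trans (ler_wpM2r (expR_ge0 _) e2) _.
    by rewrite -expRD ler_expR; lra.
  have e4 : expR (- N.+1%:R) <= expR (- (eps / 2 * c)) :> R.
    rewrite ler_expR lerN2.
    have h : eps * c ^+ 3 <= 2 * c ^+ 2 * N.+1%:R.
      rewrite cn; apply: le_trans (ler_wpM2l (ltW e0) nN) _.
      have := ler_wpM2l (ltW e0) k2.
      have -> : eps * (2 * (c ^+ 2 / eps)) = 2 * c ^+ 2 by field; rewrite gt_eqF.
      move=> /(ler_wpM2r (ler0n R N.+1)); lra.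
    have c2 : 0 < c ^+ 2 by rewrite exprn_gt0.
    by rewrite -(ler_pM2l c2); lra.
  have cc1 : 1 <= c ^+ 3 by rewrite exprn_ege1.
  have n1 : n.+1%:R <= 2 * c ^+ 3 by rewrite cn in cc1 *; rewrite -natr1; lra.
  have h := le_trans e3 e4.
  apply: (@le_trans _ _ (2 * c ^+ 3 * (3 * expR (- (eps / 2 * c))))); last lra.
  apply: (ler_pM _ _ n1 _) => //; last by rewrite -mulrA ler_wpM2l.
apply: le_trans (@W_not_thin_le _ _ E1 C C0 retC (Num.truncn c) n) _.
rewrite cn ler_wpM2l// -mulrA ler_wpM2l// -expRD ler_expR.
have C8 : 0 < 8 * C by rewrite mulr_gt0.
have /andP[_ ht] := truncn_itv (ltW c0).
have : c / (8 * C) <= ((Num.truncn c).+1%:R) / (8 * C) by rewrite ler_wpM2r ?invr_ge0 ?(ltW C8)// ltW.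
by rewrite -(natr1 (Num.truncn c)) mulrDl mul1r; lra.
Qed.

(** Jensen's inequality as a tangent line at m, a form that allows the restriction to A: what is
    lost off A is controlled by n^2 times the probability. *)
Lemma W_exp_selfint_ge n (lam m : R) (A : seq T -> bool) : 0 <= lam -> 0 <= m ->
  expR (lam * m) * (1 - W n 0 (fun t => (~~ A t)%:R) +
    lam * (W n 0 (fun t => (selfint t)%:R) - n%:R ^+ 2 * W n 0 (fun t => (~~ A t)%:R) - m)) <=
  W n 0 (fun t => expR (lam * (selfint t)%:R) * (A t)%:R).
Proof.
move=> l0 m0; set p := W n 0 (fun t => (~~ A t)%:R).
set u := W n 0 (fun t => (selfint t)%:R).
have bA : bnd (sized n) (fun t => (~~ A t)%:R : R) by exact: bnd_bool.
have bu : bnd (sized n) (fun t => (selfint t)%:R : R) by exact: bnd_selfint.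
(* The coefficient 1 + lam n^2 makes this minorant nonpositive off A, where V_n may be as large as
   n^2. *)
have bl : bnd (sized n) (fun t => (1 - lam * m) + (- (1 + lam * n%:R ^+ 2) * (~~ A t)%:R + lam * (selfint t)%:R) : R).
  by apply: bndD; [exact: bnd_cst|apply: bndD; exact: bndZ].
have -> : 1 - p + lam * (u - n%:R ^+ 2 * p - m) =
    W n 0 (fun t => (1 - lam * m) + (- (1 + lam * n%:R ^+ 2) * (~~ A t)%:R + lam * (selfint t)%:R)).
  rewrite WD; [|exact: bnd_cst|by apply: bndD; exact: bndZ].
  rewrite W_cst WD; [|by exact: bndZ..].
  by rewrite !WZ// -/p -/u; ring.
rewrite -WZ//; apply: W_le => [||t st].
- by exact: bndZ.
- by apply: bndM; [exact: bnd_exp_selfint|exact: bnd_bool].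
have Ut : (selfint t)%:R <= n%:R ^+ 2 :> R.
  by rewrite -natrX ler_nat (leq_trans (cross_le t t))// st.
have e0 := expR_ge0 (lam * m).
case: (A t) => /=.
  rewrite mulr0 add0r mulr1.
  have -> : lam * (selfint t)%:R = lam * m + lam * ((selfint t)%:R - m) by ring.
  rewrite expRD ler_wpM2l//; have := expR_ge1Dx (lam * ((selfint t)%:R - m)); lra.
rewrite mulr1 mulr0 mulr_ge0_le0//.
have := ler_wpM2l l0 Ut; have := mulr_ge0 l0 m0; lra.
Qed.

(** The error in the upper exponent per unit of eps: v + 2 for the extra block, of length at most
    eps n, and the second-order term, and 1024 C = 4 * 256 C for the crossings. *)
Definition excess : R := v + 2 + 1024 * C.

Lemma excess_ge0 : 0 <= excess.
Proof.
apply: addr_ge0; last by apply: mulr_ge0; [exact: ler0n|exact: ltW].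
by have := v_ge1; lra.
Qed.

Ltac only_goal := clear - E1 C0 retC E1_opp E1_com vub vlim.
Ltac arith := only_goal; lra.
Ltac arith2 := only_goal; nra.

(** The three smallness conditions on lam c^2 are translated by tau <= 2 c^2 / eps and w <= 256 C
    c^2: the first makes 8 lam w <= 1, the second keeps lam tau in the range of the block expansion,
    and the third makes the quadratic term at most eps lam tau. *)
Lemma exp_selfint_le (eps c w : R) k N r n (A : seq T -> bool) :
  0 < eps -> eps <= 1 -> n = (r + N * 2 ^ k)%N -> (r <= 2 ^ k)%N ->
  (2 ^ k)%:R <= 2 * (c ^+ 2 / eps) -> (2 ^ k)%:R <= eps * n%:R ->
  0 <= w -> w <= 256 * C * c ^+ 2 -> w * N%:R <= 256 * C * eps * n%:R ->
  (forall t, A t -> good (2 ^ k) w t) ->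
  forall lam, 0 <= lam -> 2048 * C * (lam * c ^+ 2) <= 1 ->
    128 * C * (lam * c ^+ 2) <= eps -> 4 * quadC C * (lam * c ^+ 2) <= eps ^+ 2 ->
    W n 0 (fun t => expR (lam * (selfint t)%:R) * (A t)%:R) <=
    expR (lam * n%:R * (v + excess * eps)).
Proof.
move=> e0 e1 nE rk k2 ten w0 wc wN Ag lam l0 l1 l2 l3.
have Q0 : 0 <= quadC C.
  by apply: ltW; rewrite /quadC !mulr_gt0 ?expR_gt0// exprn_gt0 ?mulr_gt0.
have t0 : 0 < (2 ^ k)%:R :> R by rewrite ltr0n expn_gt0.
set tau : R := (2 ^ k)%:R in k2 ten t0 *.
have X0 : 0 <= lam * tau by rewrite mulr_ge0// ltW.
have lt : eps * (lam * tau) <= 2 * (lam * c ^+ 2).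
  have := ler_wpM2l (mulr_ge0 l0 (ltW e0)) k2.
  have -> : lam * eps * (2 * (c ^+ 2 / eps)) = 2 * (lam * c ^+ 2) by field; rewrite gt_eqF.
  by arith.
have cond1 : 64 * C * tau * lam <= 1.
  rewrite -(ler_pM2l e0) mulr1.
  have := ler_wpM2l (mulr_ge0 (ler0n R 64) (ltW C0)) lt.
  by move: l2; arith.
have cond2 : 8 * lam * w <= 1 by have := ler_wpM2l l0 wc; move: l1; arith.
have cond3 : 2 * quadC C * (lam * tau) <= eps.
  rewrite -(ler_pM2l e0).
  have := ler_wpM2l (mulr_ge0 (ler0n R 2) Q0) lt.
  by move: l3; arith.
have hb := @W_exp_selfint_good_le _ _ E1 C v C0 retC vub r k N lam w l0 rk cond1 w0 cond2.
rewrite -nE in hb.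
apply: (@le_trans _ _ (W n 0 (fun t => expR (lam * (selfint t)%:R) * (good (2 ^ k) w t)%:R))).
  apply: W_le => [||t _].
  - by apply: bndM; [exact: bnd_exp_selfint|exact: bnd_bool].
  - by apply: bndM; [exact: bnd_exp_selfint|exact: bnd_bool].
  rewrite ler_wpM2l ?expR_ge0// ler_nat.
  by move: (Ag t); case: (A t) => // ->.
apply: le_trans hb _; rewrite ler_expR -/tau.
have v1 := v_ge1.
have NX : N.+1%:R * (lam * tau) <= lam * n%:R * (1 + eps).
  have Nn : N%:R * tau <= n%:R by rewrite /tau -natrM ler_nat nE leq_addl.
  have : N.+1%:R * tau <= n%:R * (1 + eps).
    by rewrite -natr1; move: Nn ten; arith.
  by move=> /(ler_wpM2l l0); arith.
have Y : lam * tau * v + 2 * quadC C * (lam * tau) ^+ 2 <= lam * tau * (v + eps).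
  rewrite mulrDr lerD2l expr2; have := ler_wpM2l X0 cond3; arith.
have ln0 : 0 <= lam * n%:R by rewrite mulr_ge0.
have h1 : N.+1%:R * (lam * tau * v + 2 * quadC C * (lam * tau) ^+ 2) <=
    lam * n%:R * (v + eps * (v + 2)).
  apply: le_trans (ler_wpM2l (ler0n _ _) Y) _.
  have ve : 0 <= v + eps by move: v1 e0; arith.
  have := ler_wpM2r ve NX.
  have : lam * n%:R * ((1 + eps) * (v + eps)) <= lam * n%:R * (v + eps * (v + 2)).
    by rewrite ler_wpM2l//; move: v1 e0 e1; arith2.
  by arith.
have h2 : 4 * lam * w * N%:R <= lam * n%:R * (1024 * C * eps).
  by have := ler_wpM2l l0 wN; arith.
by rewrite /excess; move: h1 h2; arith.
Qed.

(** The tangent is taken at m = n (v - 2 eps). The mean exceeds m by n eps, half of which may be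
    lost off A; the remaining gain lam n eps / 2 >= eps / 2 covers the probability of the complement
    of A. *)
Lemma exp_selfint_ge (eps : R) n (A : seq T -> bool) :
  0 < eps -> eps <= 1 / 2 -> (0 < n)%N ->
  n%:R * (v - eps) <= W n 0 (fun t => (selfint t)%:R) ->
  n%:R * W n 0 (fun t => (~~ A t)%:R) <= eps / 2 ->
  forall lam, 0 <= lam -> 1 <= lam * n%:R ->
    expR (lam * n%:R * (v - 2 * eps)) <=
    W n 0 (fun t => expR (lam * (selfint t)%:R) * (A t)%:R).
Proof.
move=> e0 e12 n0 hm np lam l0 l1; have v1 := v_ge1.
have m0 : 0 <= n%:R * (v - 2 * eps).
  by apply: mulr_ge0; [exact: ler0n|move: v1 e12; arith].
apply: le_trans _ (W_exp_selfint_ge n A l0 m0).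
set p := W n 0 (fun t => (~~ A t)%:R) in np *; set u := W n 0 _ in hm *.
have p0 : 0 <= p by apply: W_ge0 => [|t _]; [exact: bnd_bool|exact: ler0n].
have n1 : 1 <= n%:R :> R by rewrite ler1n.
have ple : p <= eps / 2 by apply: le_trans np; rewrite ler_peMl.
rewrite -[lam * _ * _]mulrA -[leLHS]mulr1 ler_wpM2l ?expR_ge0//.
have h1 : n%:R * (eps / 2) <= u - n%:R ^+ 2 * p - n%:R * (v - 2 * eps).
  by have := ler_wpM2l (ler0n R n) np; move: hm; arith.
have := ler_wpM2l l0 h1.
have := ler_wpM2r (divr_ge0 (ltW e0) (ler0n R 2)) l1.
by move: ple; arith.
Qed.

Lemma exp_selfint_bounds (eps : R) : 0 < eps <= 1 / 2 ->
  exists2 delta, 0 < delta & exists2 c0, 0 < c0 & exists c1, forall n c,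
    c ^+ 3 = n%:R -> c1 <= c -> exists A : seq T -> bool, [/\
      forall t y, A t -> (count_mem y t)%:R <= c,
      W n 0 (fun t => (~~ A t)%:R) <= expR (- (c0 * c)),
      forall lam, 0 <= lam -> lam * c ^+ 2 <= delta ->
        W n 0 (fun t => expR (lam * (selfint t)%:R) * (A t)%:R) <=
        expR (lam * n%:R * (v + excess * eps)) &
      forall lam, 0 <= lam -> 1 <= lam * n%:R ->
        expR (lam * n%:R * (v - 2 * eps)) <=
        W n 0 (fun t => expR (lam * (selfint t)%:R) * (A t)%:R)].
Proof.
move=> /andP[e0 e12]; have e1 : eps <= 1 by move: e12; arith.
have Q0 : 0 < quadC C by rewrite /quadC !mulr_gt0 ?expR_gt0// exprn_gt0 ?mulr_gt0.
have C8 : 0 < 8 * C by rewrite mulr_gt0.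
pose d1 := (2048 * C)^-1; pose d2 := eps / (128 * C); pose d3 := eps ^+ 2 / (4 * quadC C).
have C1 : 0 < 2048 * C by move: C0; arith.
have C2 : 0 < 128 * C by move: C0; arith.
have Q4 : 0 < 4 * quadC C by move: Q0; arith.
have d10 : 0 < d1 by rewrite invr_gt0.
have d20 : 0 < d2 by apply: divr_gt0.
have d30 : 0 < d3 by apply: divr_gt0 => //; exact: exprn_gt0.
exists (Num.min d1 (Num.min d2 d3)); first by rewrite !lt_min d10 d20.
(* Twice c0 is still at most both decay rates; the spare exp(c0 c) absorbs the prefactor K c^3. *)
pose c0 := Num.min (eps / 2) (8 * C)^-1 / 2.
have c00 : 0 < c0 by rewrite divr_gt0// lt_min divr_gt0//= invr_gt0.
have m1 : 2 * c0 <= eps / 2 by rewrite /c0 mulrCA mulfV// mulr1 ge_min lexx.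
have m2 : 2 * c0 <= (8 * C)^-1 by rewrite /c0 mulrCA mulfV// mulr1 ge_min lexx orbT.
exists c0 => //; clearbody c0.
have [n0 hn0] := mean_selfint_ge e0.
pose K : R := 6 + 2 * expR (8 * C)^-1.
have K0 : 0 <= K by rewrite addr_ge0// mulr_ge0// expR_ge0.
have e20 : 0 <= 2 / eps by apply: divr_ge0; [exact: ler0n|exact: ltW].
have c04 : 0 <= c0 ^+ 4 by apply: exprn_ge0; exact: ltW.
(* The thresholds ensure in turn 2 <= eps^2 c, K c^3 <= exp(c0 c) and (2 / eps) n <= exp(c0 c). *)
pose a1 := 2 / eps ^+ 2; pose a2 := 256 * K / c0 ^+ 4; pose a3 := 256 * (2 / eps) / c0 ^+ 4.
have p1 : 0 <= a1 by rewrite divr_ge0// sqr_ge0.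
have p2 : 0 <= a2.
  by apply: divr_ge0; [apply: mulr_ge0; [exact: ler0n|exact: K0]|exact: c04].
have p3 : 0 <= a3.
  by apply: divr_ge0; [apply: mulr_ge0; [exact: ler0n|exact: e20]|exact: c04].
exists (1 + a1 + a2 + a3 + n0%:R) => n c cn cc.
have p4 : 0 <= n0%:R :> R by exact: ler0n.
have c_ge1 : 1 <= c by move: cc p1 p2 p3 p4; arith.
have ca1 : a1 <= c by move: cc p1 p2 p3 p4; arith.
have ca2 : a2 <= c by move: cc p1 p2 p3 p4; arith.
have ca3 : a3 <= c by move: cc p1 p2 p3 p4; arith.
have cn0 : n0%:R <= c by move: cc p1 p2 p3 p4; arith.
have cpos : 0 < c by move: c_ge1; arith.
have hec : 2 <= eps ^+ 2 * c by rewrite mulrC -ler_pdivrMr ?exprn_gt0.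
have [k [N [r [w [nE rk [/andP[k1 k2] ten] [w0 wc wN] hbad]]]]] :=
  not_good_or_thin (introT andP (conj e0 e1)) cn c_ge1 hec.
set A := fun t => good (2 ^ k) w t && thin (Num.truncn c) t.
have c3 : 0 <= c ^+ 3 by rewrite exprn_ge0// ltW.
have hP : W n 0 (fun t => (~~ A t)%:R) <= expR (- (c0 * c)).
  apply: le_trans hbad _.
  have x1 : expR (- (eps / 2 * c)) <= expR (- (2 * c0 * c)).
    by rewrite ler_expR lerN2 ler_wpM2r// ltW.
  have x2 : expR (- (c / (8 * C))) <= expR (- (2 * c0 * c)).
    by rewrite ler_expR lerN2 mulrC ler_wpM2l// ltW.
  apply: (@le_trans _ _ (K * c ^+ 3 * expR (- (2 * c0 * c)))).
    rewrite (mulrC K) -[leRHS]mulrA; apply: ler_wpM2l; first exact: c3.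
    rewrite /K [leRHS]mulrDl; apply: lerD; first by apply: ler_wpM2l; [exact: ler0n|exact: x1].
    by apply: ler_wpM2l; [apply: mulr_ge0; [exact: ler0n|exact: expR_ge0]|exact: x2].
  apply: le_trans (ler_wpM2r (expR_ge0 _) (@cube_le_expR _ c0 K c c00 K0 ca2)) _.
  by rewrite -expRD ler_expR; arith.
exists A; split => //.
- move=> t y /andP[_ /allP h].
  have [yt|/count_memPn ->] := boolP (y \in t); last exact: ltW.
  apply: (@le_trans _ _ (Num.truncn c)%:R); first by rewrite ler_nat; exact: h.
  by have /andP[] := truncn_itv (ltW cpos).
- move=> lam l0; rewrite !le_min => /and3P[l1 l2 l3].
  have h1 : 2048 * C * (lam * c ^+ 2) <= 1.
    by rewrite mulrC -(ler_pdivlMr _ _ C1) mul1r; exact: l1.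
  have h2 : 128 * C * (lam * c ^+ 2) <= eps.
    by rewrite mulrC -(ler_pdivlMr _ _ C2); exact: l2.
  have h3 : 4 * quadC C * (lam * c ^+ 2) <= eps ^+ 2.
    by rewrite mulrC -(ler_pdivlMr _ _ Q4); exact: l3.
  have hA t : A t -> good (2 ^ k) w t by move=> /andP[].
  exact: (exp_selfint_le e0 e1 nE rk k2 ten w0 wc wN hA l0 h1 h2 h3).
- have n1 : (0 < n)%N by rewrite -(ltr0n R) -cn exprn_gt0.
  apply: exp_selfint_ge => //.
    apply: hn0; rewrite -(ler_nat R) -cn; apply: (le_trans cn0).
    by rewrite ler_eXnr.
  apply: le_trans (ler_wpM2l (ler0n _ _) hP) _; rewrite -cn.
  have h := @cube_le_expR _ c0 (2 / eps) c c00 e20 ca3.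
  rewrite expRN ler_pdivrMr ?expR_gt0//.
  have := ler_wpM2l (divr_ge0 (ltW e0) (ler0n R 2)) h.
  have -> : eps / 2 * (2 / eps * c ^+ 3) = c ^+ 3 by field; rewrite gt_eqF.
  by [].
Qed.

End self_intersection_moments.

(** * The walk as a countable family of trajectories *)

Section countable_fibres.
Context {dO : measure_display} {Omega : measurableType dO} {R : realType}.
Variable P : probability Omega R.
Local Open Scope ereal_scope.

(** For a variable with countably many values this is measurability for the discrete sigma-algebra:
    every function of it is then measurable, and expectations are sums over the fibres. *)
Definition fibre_measurable {U : Type} (Z : Omega -> U) :=
  forall u, measurable (Z @^-1` [set u]).

Lemma fibre_measurable_preimage {U : countType} (Z : Omega -> U) (B : set U) :
  fibre_measurable Z -> measurable (Z @^-1` B).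
Proof.
move=> mZ; have -> : Z @^-1` B = \bigcup_u (Z @^-1` [set u] `&` [set _ | B u]).
  by apply/seteqP; split=> w /=; [move=> Bw; exists (Z w)|move=> [u _ [/= -> Bu]]].
apply: countable_bigcupT_measurable; first exact: countableP.
move=> u; have [Bu|nBu] := pselect (B u).
  by rewrite (_ : [set _ | B u] = setT) ?setIT//; apply/seteqP; split.
by rewrite (_ : [set _ | B u] = set0) ?setI0//; apply/seteqP; split.
Qed.

Lemma fibre_measurable_comp {U : countType} {V : Type} (Z : Omega -> U) (g : U -> V) :
  fibre_measurable Z -> fibre_measurable (fun w => g (Z w)).
Proof. by move=> mZ v; exact: (fibre_measurable_preimage (g @^-1` [set v]) mZ). Qed.

Lemma fibre_measurable_pair {U V : countType} (Z : Omega -> U) (Y : Omega -> V) :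
  fibre_measurable Z -> fibre_measurable Y -> fibre_measurable (fun w => (Z w, Y w)).
Proof.
move=> mZ mY [u v].
rewrite (_ : _ @^-1` _ = Z @^-1` [set u] `&` Y @^-1` [set v]); first exact: measurableI.
by apply/seteqP; split=> w /= [-> ->].
Qed.

Lemma fibre_measurable_fun {U : countType} (Z : Omega -> U) (f : U -> \bar R) (D : set Omega) :
  measurable D -> fibre_measurable Z -> measurable_fun D (f \o Z).
Proof.
move=> mD mZ _ B mB; apply: measurableI => //.
exact: (fibre_measurable_preimage (f @^-1` B) mZ).
Qed.

Lemma integral_fibres {U : countType} (Z : Omega -> U) (D : set Omega) (f : Omega -> \bar R) :
  fibre_measurable Z -> measurable D -> measurable_fun D f -> (forall w, D w -> 0 <= f w) ->
  \int[P]_(w in D) f w =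
  \sum_(k <oo) \int[P]_(w in D `&` (fun w => choice.pickle (Z w)) @^-1` [set k]) f w.
Proof.
move=> mZ mD mf f0.
pose F k := D `&` (fun w => choice.pickle (Z w)) @^-1` [set k].
have DF : D = \bigcup_k F k.
  by apply/seteqP; split=> w; [exists (choice.pickle (Z w))|move=> [k _ []]].
rewrite {1}DF ge0_integral_bigcup -?DF//.
  by move=> k; apply: measurableI => //; exact: (fibre_measurable_preimage (choice.pickle @^-1` [set k]) mZ).
by move=> i j _ _ [w [[_ /= <-] [_ /= <-]]].
Qed.

Lemma eq_integral_fibres {U : countType} (Z : Omega -> U) (f g : Omega -> \bar R) :
  fibre_measurable Z -> measurable_fun setT f -> measurable_fun setT g ->
  (forall w, 0 <= f w) -> (forall w, 0 <= g w) ->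
  (forall u, \int[P]_(w in Z @^-1` [set u]) f w = \int[P]_(w in Z @^-1` [set u]) g w) ->
  \int[P]_w f w = \int[P]_w g w.
Proof.
move=> mZ mf mg f0 g0 fg; rewrite !(integral_fibres mZ)//.
apply: eq_eseriesr => k _; rewrite setTI.
have [[u <-]|nu] := pselect (exists u : U, choice.pickle u = k).
  rewrite (_ : _ @^-1` _ = Z @^-1` [set u])//.
  by apply/seteqP; split=> w /=; [move/(pcan_inj choice.pickleK)|move=> ->].
rewrite (_ : _ @^-1` _ = set0) ?integral_set0//.
by apply/seteqP; split=> w //= h; apply: nu; exists (Z w).
Qed.

(** The last hypothesis says that under the weight H on A the variable Y has K times the law of Y'.
    This covers both the Markov property of the walk, where H is 1, and the product formula for the
    scenery. *)
Lemma integral_weighted_fibres {U : countType} (Y Y' : Omega -> U) (A : set Omega)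
    (H : Omega -> R) (h : U -> R) (K : R) :
  fibre_measurable Y -> fibre_measurable Y' -> measurable A -> measurable_fun setT H ->
  (forall w, 0 <= H w)%R -> (forall u, 0 <= h u)%R -> (0 <= K)%R ->
  (forall u, \int[P]_(w in A `&` Y @^-1` [set u]) (H w)%:E = K%:E * P (Y' @^-1` [set u])) ->
  \int[P]_(w in A) (h (Y w) * H w)%:E = K%:E * \int[P]_w (h (Y' w))%:E.
Proof.
move=> mY mY' mA mH H0 h0 K0 ind.
have mh (Z : Omega -> U) : fibre_measurable Z -> measurable_fun setT (h \o Z).
  move=> mZ; apply/measurable_EFinP.
  exact: (@fibre_measurable_fun _ Z (fun u => (h u)%:E) setT measurableT mZ).
have mhH : measurable_fun setT (EFin \o (fun w => h (Y w) * H w)%R).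
  by apply/measurable_EFinP; apply: measurable_funM => //; exact: mh.
rewrite (integral_fibres mY mA); [|exact: measurable_funTS|by move=> w _; rewrite lee_fin mulr_ge0].
rewrite [in RHS](integral_fibres mY' measurableT); last 2 first.
- by apply/measurable_EFinP; exact: mh.
- by move=> w _; rewrite lee_fin.
rewrite -nneseriesZl; last by move=> k _; apply: integral_ge0 => w _; rewrite lee_fin.
apply: eq_eseriesr => k _; rewrite setTI.
have [[u <-]|nu] := pselect (exists u : U, choice.pickle u = k); last first.
  have e (Z : Omega -> U) : (fun w => choice.pickle (Z w)) @^-1` [set k] = set0.
    by apply/seteqP; split=> w //= hw; apply: nu; exists (Z w).
  by rewrite !e setI0 !integral_set0 mule0.
have e (Z : Omega -> U) : (fun w => choice.pickle (Z w)) @^-1` [set choice.pickle u] = Z @^-1` [set u].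
  by apply/seteqP; split=> w /=; [move/(pcan_inj choice.pickleK)|move=> ->].
rewrite !e.
rewrite (eq_integral (fun w => (h u)%:E * (H w)%:E)); last by move=> w; rewrite inE => -[_ /= ->].
rewrite [in RHS](eq_integral (fun=> (h u)%:E)); last by move=> w; rewrite inE => /= ->.
rewrite ge0_integralZl_EFin//; last 3 first.
- exact: measurableI.
- by move=> w _; rewrite lee_fin.
- by apply/measurable_EFinP; exact: measurable_funTS.
by rewrite integral_cst// ind muleCA.
Qed.

Lemma integral_independent_fibres {U : countType} (Y Y' : Omega -> U) (A : set Omega) (h : U -> R) :
  fibre_measurable Y -> fibre_measurable Y' -> measurable A -> (forall u, (0 <= h u)%R) ->
  (forall u, P (A `&` Y @^-1` [set u]) = P A * P (Y' @^-1` [set u])) ->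
  \int[P]_(w in A) (h (Y w))%:E = P A * \int[P]_w (h (Y' w))%:E.
Proof.
move=> mY mY' mA h0 ind; have PA : P A = (fine (P A))%:E by rewrite fineK// fin_num_measure.
rewrite PA -(integral_weighted_fibres (Y := Y) (A := A) (H := fun=> 1%R)) ?fine_ge0//.
  by under [RHS]eq_integral do rewrite mulr1.
by move=> u; rewrite integral_cst ?mul1e -?PA//; [exact: ind|exact: measurableI].
Qed.

Lemma integral_same_fibres {U : countType} (Y Y' : Omega -> U) (h : U -> R) :
  fibre_measurable Y -> fibre_measurable Y' -> (forall u, (0 <= h u)%R) ->
  (forall u, P (Y @^-1` [set u]) = P (Y' @^-1` [set u])) ->
  \int[P]_w (h (Y w))%:E = \int[P]_w (h (Y' w))%:E.
Proof.
move=> mY mY' h0 same; have P1 : P setT = 1 by exact: probability_setT.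
rewrite (integral_independent_fibres mY mY' measurableT h0); first by rewrite P1 mul1e.
by move=> u; rewrite setTI same P1 mul1e.
Qed.

End countable_fibres.

HB.instance Definition _ (d : nat) := Countable.copy (lattice d) 'rV[int]_d.

(** * The law of the walk as an iterated mean *)

Section walk_law.
Context {dO : measure_display} {Omega : measurableType dO} {R : realType}.
Variables (P : probability Omega R) (d : nat) (S : nat -> {RV P >-> lattice d}).
Local Notation T := (lattice d).

Lemma fibre_walk k : fibre_measurable (S k : Omega -> T).
Proof. by move=> x; rewrite -[X in measurable X]setTI; exact: (measurable_funPT (S k)). Qed.

Definition incr k w : T := S k.+1 w - S k w.

Lemma fibre_incr k : fibre_measurable (incr k).
Proof.
exact: (fibre_measurable_comp (fun p : T * T => p.1 - p.2)
  (fibre_measurable_pair (fibre_walk k.+1) (fibre_walk k))).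
Qed.

Fixpoint path n w : seq T := if n is n'.+1 then rcons (path n' w) (S n w) else [::].

Lemma size_path n w : size (path n w) = n.
Proof. by elim: n => //= n IH; rewrite size_rcons IH. Qed.

Lemma fibre_path n : fibre_measurable (path n).
Proof.
elim: n => [|n IH] /=.
  move=> t; case: t => [|y t]; first by rewrite (_ : _ @^-1` _ = setT)//; apply/seteqP.
  by rewrite (_ : _ @^-1` _ = set0)//; apply/seteqP; split.
exact: (fibre_measurable_comp (fun p : seq T * T => rcons p.1 p.2)
  (fibre_measurable_pair IH (fibre_walk n.+1))).
Qed.

Hypothesis RW : random_walk S.

Lemma walk0 w : S 0%N w = 0. Proof. by case: RW. Qed.

Lemma incr0 w : incr 0 w = S 1%N w.
Proof. by rewrite /incr walk0 subr0. Qed.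

Lemma last_path n w : last 0 (path n w) = S n w.
Proof. by case: n => [|n] /=; rewrite ?walk0// last_rcons. Qed.

Lemma pathS n w : path n.+1 w = rcons (path n w) (last 0 (path n w) + incr n w).
Proof. by rewrite /= last_path /incr addrC subrK. Qed.

Definition step (f : T -> R) : R := fine (\int[P]_w (f (S 1%N w))%:E)%E.

Lemma integrable_bnd_fun (Y : Omega -> T) (f : T -> R) : fibre_measurable Y -> bnd setT f ->
  P.-integrable setT (EFin \o (f \o Y)).
Proof.
move=> mY [M hM]; apply: (@le_integrable _ _ _ P _ measurableT _ (EFin \o cst M)).
- exact: (@fibre_measurable_fun _ _ _ _ Y (fun u => (f u)%:E)).
- by move=> w _ /=; rewrite lee_fin (le_trans (hM _ I))// ler_norm.
- exact: finite_measure_integrable_cst.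
Qed.

Lemma step_EFin f : bnd setT f -> (step f)%:E = (\int[P]_w (f (S 1%N w))%:E)%E.
Proof.
move=> hf; rewrite fineK//; apply: integrable_fin_num => //.
exact: (integrable_bnd_fun (fibre_walk 1) hf).
Qed.

Lemma step_linear a f g : bnd setT f -> bnd setT g ->
  step (fun x => a * f x + g x) = a * step f + step g.
Proof.
move=> hf hg.
have hi h : bnd setT h -> P.-integrable setT (EFin \o (h \o S 1%N)).
  exact: (integrable_bnd_fun (fibre_walk 1)).
have := @RintegralD _ _ _ P setT (fun w => a * f (S 1%N w)) (fun w => g (S 1%N w)) measurableT.
rewrite RintegralZl//; last exact: hi.
by apply; [apply: (hi (fun x => a * f x)); exact: bndM (bnd_cst _ _) hf|exact: hi].
Qed.

Lemma step_ge0 f : bnd setT f -> (forall x, setT x -> 0 <= f x) -> 0 <= step f.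
Proof. by move=> _ f0; apply: Rintegral_ge0 => w _; exact: f0. Qed.

Lemma step_1 : step (fun=> 1) = 1.
Proof.
rewrite /step integral_cst// mul1e -[RHS]/(fine (1 : \bar R)); congr fine.
exact: probability_setT.
Qed.

Definition E1 : @mean R T setT := Mean step_linear step_ge0 step_1.

Lemma incr_independent n (B : nat -> set T) :
  P (incr n @^-1` B n `&` \bigcap_(i < n) (incr i @^-1` B i)) =
  (P (incr n @^-1` B n) * P (\bigcap_(i < n) (incr i @^-1` B i)))%E.
Proof.
have [_ [ind _]] := RW.
pose J := [fset i in iota 0 n]%fset.
have JE : [set` J] = `I_n.
  by apply/seteqP; split=> i /=; rewrite in_fset mem_iota add0n.
have nJ : n \notin J by rewrite in_fset mem_iota add0n ltnn.
have e1 := ind J B (fun _ _ => I).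
have e2 := ind (n |` J)%fset B (fun _ _ => I).
rewrite big_fsetU1//= -e1 JE in e2; rewrite -e2; congr (P _).
apply/seteqP; split=> w.
  move=> [hn hJ] i /=; rewrite in_fset1U => /orP[/eqP ->//|iJ].
  by apply: hJ; move: iJ; rewrite in_fset mem_iota add0n.
move=> h; split=> [|i /= hi]; apply: (h) => /=; rewrite in_fset1U ?eqxx//.
by rewrite in_fset mem_iota add0n hi orbT.
Qed.

Lemma nth_size_cons (s : seq T) : nth 0 (0 :: s) (size s) = last 0 s.
Proof. by rewrite -[RHS]/(last 0 (0 :: s)) -nth_last. Qed.

Lemma path_eq n w t : path n w = t -> forall i, (i < n)%N -> incr i w = nth 0 t i - nth 0 (0 :: t) i.
Proof.
elim: n t => [//|n IH] t pt i; rewrite ltnS leq_eqVlt => /orP[/eqP ->|hi].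
  rewrite -pt pathS nth_rcons size_path ltnn eqxx -rcons_cons nth_rcons /= size_path ltnSn.
  by have := nth_size_cons (path n w); rewrite size_path => ->; rewrite addrAC subrr add0r.
rewrite -pt pathS -rcons_cons !nth_rcons /= size_path hi ltnS (ltnW hi).
exact: IH.
Qed.

Lemma incr_eq n w t : size t = n -> (forall i, (i < n)%N -> incr i w = nth 0 t i - nth 0 (0 :: t) i) ->
  path n w = t.
Proof.
elim: n t => [|n IH] t; first by move/size0nil => ->.
case/lastP: t => // t y; rewrite size_rcons => -[st] h.
have pt : path n w = t.
  apply: IH => // i hi.
  by have := h i (ltnW hi); rewrite -rcons_cons !nth_rcons /= st hi ltnS (ltnW hi).
rewrite pathS pt; congr rcons.
rewrite (h n (ltnSn n)) -rcons_cons !nth_rcons /= st ltnn eqxx ltnSn.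
by have := nth_size_cons t; rewrite st => ->; rewrite addrC subrK.
Qed.

Lemma path_fibre n t : size t = n ->
  path n @^-1` [set t] = \bigcap_(i < n) (incr i @^-1` [set nth 0 t i - nth 0 (0 :: t) i]).
Proof.
move=> st; apply/seteqP; split=> w /=; first by move=> h i hi; exact: (path_eq h hi).
by move=> h; apply: incr_eq => // i hi; exact: h.
Qed.

Lemma incr_law n y : P (incr n @^-1` [set y]) = P (S 1%N @^-1` [set y]).
Proof.
have [_ [_ same]] := RW.
rewrite (same n 0%N [set y]) //; congr (P _).
by apply/seteqP; split=> w /=; rewrite -/(incr 0 w) incr0.
Qed.

Lemma path_incr_independent n t y :
  P (path n @^-1` [set t] `&` incr n @^-1` [set y]) =
  (P (path n @^-1` [set t]) * P (S 1%N @^-1` [set y]))%E.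
Proof.
have [st|st] := eqVneq (size t) n; last first.
  have -> : path n @^-1` [set t] = set0.
    by apply/seteqP; split=> w //= h; move: st; rewrite -h size_path eqxx.
  by rewrite set0I measure0 mul0e.
rewrite path_fibre// setIC muleC -(incr_law n).
have := incr_independent n (fun i => if i == n then [set y] else [set nth 0 t i - nth 0 (0 :: t) i]).
rewrite eqxx (_ : \bigcap_(i < n) _ = \bigcap_(i < n) incr i @^-1` [set nth 0 t i - nth 0 (0 :: t) i])//.
by apply: eq_bigcapr => i /= hi; rewrite ltn_eqF.
Qed.

(** The last step is integrated on each fibre of the first n positions, from which its increment is
    independent. Positivity of F lets the integral be split over countably many fibres. *)
Lemma integral_path n (F : seq T -> R) :
  (forall t, 0 <= F t) -> (exists M, forall t, F t <= M) ->
  (\int[P]_w (F (path n w))%:E)%E = (W E1 n 0 F)%:E.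
Proof.
elim: n F => [|n IH] F F0 [M hM].
  by rewrite /= integral_cst// [X in (_ * X)%E]probability_setT mule1.
pose F' t := E1 (fun y => F (rcons t (last 0 t + y))).
have bF t : bnd setT (fun y => F (rcons t (last 0 t + y))).
  by exists M => y _; rewrite ger0_norm.
have F'0 t : 0 <= F' t by apply: ev_ge0.
have -> : W E1 n.+1 0 F = W E1 n 0 F'.
  rewrite -addn1 W_cat; apply: W_eq => t _ /=.
  by congr (ev E1 _); apply: funext => y; rewrite cats1.
rewrite -IH//; last first.
  exists M => t; rewrite -[leRHS](ev_cst E1); apply: ev_le => //; exact: bnd_cst.
apply: (eq_integral_fibres (fibre_path n)).
- exact: (@fibre_measurable_fun _ _ _ _ (path n.+1) (fun t => (F t)%:E) setT measurableT (fibre_path n.+1)).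
- exact: (@fibre_measurable_fun _ _ _ _ (path n) (fun t => (F' t)%:E) setT measurableT (fibre_path n)).
- by move=> w; rewrite lee_fin.
- by move=> w; rewrite lee_fin.
move=> t.
rewrite (eq_integral (fun w => (F (rcons t (last 0 t + incr n w)))%:E)); last first.
  by move=> w; rewrite inE pathS => /= ->.
rewrite [RHS](eq_integral (fun=> (F' t)%:E)); last by move=> w; rewrite inE => /= ->.
rewrite integral_cst; last exact: fibre_path.
rewrite (integral_independent_fibres (h := fun y => F (rcons t (last 0 t + y)))
  (fibre_incr n) (fibre_walk 1) (fibre_path n t) _ (path_incr_independent n t))//.
by rewrite muleC; congr (_ * _)%E; rewrite step_EFin.
Qed.

(** Both iterated means are the expectation of F at two independent increments, the first two of the
    walk. Adding a bound M reduces to the case F >= 0. *)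
Lemma E1_commuting : commuting E1.
Proof.
suff pos F : (forall x y, 0 <= F x y) -> (exists M, forall x y, `|F x y| <= M) ->
    E1 (fun x => E1 (fun y => F x y)) = E1 (fun y => E1 (fun x => F x y)).
  move=> F [M hM].
  have bM (G : T -> T -> R) : (forall x y, `|G x y| <= M) -> forall x, bnd setT (G x).
    by move=> hG x; exists M => y _.
  have bE (G : T -> T -> R) : (forall x y, `|G x y| <= M) -> bnd setT (fun x => E1 (G x)).
    by move=> hG; exists M => x _; apply: ev_norm_le => y _.
  have := pos (fun x y => F x y + M).
  have shift (G : T -> T -> R) : (forall x y, `|G x y| <= M) ->
      E1 (fun x => E1 (fun y => G x y + M)) = E1 (fun x => E1 (G x)) + M.
    move=> hG; rewrite -[X in _ = _ + X](ev_cst E1) -evD; [|exact: bE|exact: bnd_cst].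
    congr (ev E1 _); apply: funext => x.
    by rewrite evD ?ev_cst//; [exact: bM|exact: bnd_cst].
  rewrite shift// (shift (fun y x => F x y))// => h; apply: (addIr M); apply: h.
    by move=> x y; have := hM x y; rewrite ler_norml => /andP[]; rewrite -subr_ge0 opprK.
  exists (M + M) => x y; rewrite (le_trans (ler_normD _ _))// lerD//.
  by rewrite ger0_norm// (le_trans _ (hM x y)).
move=> F0 [M hM].
have bF x : bnd setT (F x) by exists M.
have bF' y : bnd setT (fun x => F x y) by exists M => x _.
have ind x y : P (incr 0 @^-1` [set x] `&` incr 1 @^-1` [set y]) =
    (P (S 1%N @^-1` [set x]) * P (S 1%N @^-1` [set y]))%E.
  have := path_incr_independent 1 [:: x] y.
  have -> : path 1 @^-1` [set [:: x]] = incr 0 @^-1` [set x].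
    by apply/seteqP; split=> w /=; rewrite incr0; [move=> [->]|move=> ->].
  by rewrite incr_law.
have key (G : T -> T -> R) (Y Y' : Omega -> T) : fibre_measurable Y -> fibre_measurable Y' ->
    (forall x, P (Y @^-1` [set x]) = P (S 1%N @^-1` [set x])) ->
    (forall x y, P (Y @^-1` [set x] `&` Y' @^-1` [set y]) =
       (P (S 1%N @^-1` [set x]) * P (S 1%N @^-1` [set y]))%E) ->
    (forall x y, 0 <= G x y) -> (exists M, forall x y, `|G x y| <= M) ->
    (\int[P]_w (G (Y w) (Y' w))%:E)%E = (E1 (fun x => E1 (G x)))%:E.
  move=> mY mY' lY hind G0 [N hN].
  have bE : bnd setT (fun x => E1 (G x)) by exists N => x _; apply: ev_norm_le => y _.
  have E0 x : 0 <= E1 (G x) by apply: ev_ge0 => //; exists N.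
  transitivity (\int[P]_w (E1 (G (Y w)))%:E)%E.
    apply: (eq_integral_fibres mY).
    - exact: (@fibre_measurable_fun _ _ _ _ (fun w => (Y w, Y' w)) (fun p => (G p.1 p.2)%:E) setT measurableT (fibre_measurable_pair mY mY')).
    - exact: (@fibre_measurable_fun _ _ _ _ Y (fun x => (E1 (G x))%:E) setT measurableT mY).
    - by move=> w; rewrite lee_fin.
    - by move=> w; rewrite lee_fin.
    move=> x.
    rewrite (eq_integral (fun w => (G x (Y' w))%:E)); last by move=> w; rewrite inE => /= ->.
    rewrite [RHS](eq_integral (fun=> (E1 (G x))%:E)); last by move=> w; rewrite inE => /= ->.
    rewrite integral_cst//.
    rewrite (integral_independent_fibres (h := G x) mY' (fibre_walk 1) (mY x))//; last first.
      by move=> y; rewrite hind -lY.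
    by rewrite muleC; congr (_ * _)%E; rewrite step_EFin//; exists N.
  rewrite (integral_same_fibres (h := fun x => E1 (G x)) mY (fibre_walk 1))//.
  by rewrite -(step_EFin (f := fun x => E1 (G x))).
apply: EFin_inj.
rewrite -(key F (incr 0) (incr 1))//; [|exact: fibre_incr|exact: fibre_incr|exact: incr_law|by exists M].
rewrite -(key (fun y x => F x y) (incr 1) (incr 0))//; [exact: fibre_incr|exact: fibre_incr|exact: incr_law| |by exists M].
by move=> x y; rewrite setIC ind muleC.
Qed.

End walk_law.

(** * Conditioning on the walk, its atoms and its Green's function *)

Section walk_and_scenery.
Context {dO : measure_display} {Omega : measurableType dO} {R : realType}.
Variables (P : probability Omega R) (d : nat) (S : nat -> {RV P >-> lattice d}).
Local Notation T := (lattice d).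
Hypothesis RW : random_walk S.
Local Notation E1 := (E1 S).

Lemma generated_path n t : generated_events (fun k => S k : Omega -> T) (path S n @^-1` [set t]).
Proof.
set G := \bigcup_i preimage_set_system setT (S i) measurable.
elim: n t => [|n IH] t.
  have [->|nt] := pselect (t = [::]).
    by rewrite (_ : _ @^-1` _ = setT); [exact: (@measurableT _ (g_sigma_algebraType G))|apply/seteqP].
  rewrite (_ : _ @^-1` _ = set0); first exact: (@measurable0 _ (g_sigma_algebraType G)).
  by apply/seteqP; split=> w //= h; apply: nt.
case/lastP: t => [|t x].
  rewrite (_ : _ @^-1` _ = set0); first exact: (@measurable0 _ (g_sigma_algebraType G)).
  by apply/seteqP; split=> w //=; case: (path S n w).
rewrite (_ : _ @^-1` _ = path S n @^-1` [set t] `&` S n.+1 @^-1` [set x]).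
  apply: (@measurableI _ (g_sigma_algebraType G)); first exact: IH.
  apply: sub_gen_smallest; exists n.+1 => //; exists [set x] => //.
  by rewrite setTI.
apply/seteqP; split=> w /=; last by move=> [-> ->].
by move=> /eqP; rewrite eqseq_rcons => /andP[/eqP -> /eqP ->].
Qed.

(** Conditioning on the trajectory: [B t] stands for an event of the scenery, independent of the
    fibres of the path, so that the probability is the mean of the quenched ones. *)
Lemma prob_along_path n (B : seq T -> set Omega) : (forall t, measurable (B t)) ->
  (forall t, P (path S n @^-1` [set t] `&` B t) = (P (path S n @^-1` [set t]) * P (B t))%E) ->
  P [set w | B (path S n w) w] = (W E1 n 0 (fun t => fine (P (B t))))%:E.
Proof.
move=> mB ind; set D := [set w | _].
have mD : measurable D.
  have -> : D = \bigcup_t (path S n @^-1` [set t] `&` B t).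
    by apply/seteqP; split=> w /=; [move=> h; exists (path S n w)|move=> [t _ [/= pt Bt]]; rewrite /D /= pt].
  apply: countable_bigcupT_measurable; first exact: countableP.
  by move=> t; apply: measurableI => //; exact: fibre_path.
rewrite -(integral_path RW) => [|t|]; last 2 first.
- exact: fine_ge0.
- exists 1 => t; rewrite -lee_fin fineK ?fin_num_measure//; exact: probability_le1.
have -> : P D = (\int[P]_w (\1_D w)%:E)%E by rewrite integral_indic// setIT.
apply: (eq_integral_fibres (fibre_path S n)).
- exact/measurable_EFinP/measurable_indic.
- exact: (@fibre_measurable_fun _ _ _ _ (path S n) (fun t => (fine (P (B t)))%:E) setT measurableT (fibre_path S n)).
- by move=> w; rewrite lee_fin.
- by move=> w; rewrite lee_fin fine_ge0.
move=> t; rewrite integral_indic//; last exact: fibre_path.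
rewrite [RHS](eq_integral (fun=> (fine (P (B t)))%:E)); last by move=> w; rewrite inE => /= ->.
rewrite integral_cst; last exact: fibre_path.
rewrite fineK ?fin_num_measure// muleC; have := ind t => /= <-; congr (P _).
apply/seteqP; split=> w /=; last by move=> [pt Bt]; split=> //; rewrite /D /= pt.
by move=> [Dw pt]; split=> //; rewrite -pt; exact: Dw.
Qed.

Lemma prob_event_path n (b : pred (seq T)) :
  P [set w | b (path S n w)] = (W E1 n 0 (fun t => (b t)%:R))%:E.
Proof.
have := @prob_along_path n (fun t => if b t then setT else set0).
have -> : (fun t => fine (P (if b t then setT else set0))) = (fun t => (b t)%:R).
  by apply: funext => t; case: (b t); rewrite ?probability_setT ?measure0.
move=> <-; first by congr (P _); apply/seteqP; split=> w /=; case: (b _).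
- by move=> t; case: (b t).
- move=> t; case: (b t); last by rewrite setI0 measure0 mule0.
  by rewrite setIT [X in (_ * X)%E]probability_setT mule1.
Qed.

Lemma E1_opp : symmetric_law P (S 1%N) ->
  forall f, bnd setT f -> E1 (fun y => f (- y)) = E1 f.
Proof.
move=> sym.
have mS : fibre_measurable (fun w => - S 1%N w : T).
  exact: (fibre_measurable_comp (fun x : T => - x) (fibre_walk S 1)).
have pos f : bnd setT f -> (forall x, 0 <= f x) -> E1 (fun y => f (- y)) = E1 f.
  move=> hf f0; apply: EFin_inj; rewrite /= !step_EFin//; last exact: bnd_comp hf.
  apply: (integral_same_fibres mS (fibre_walk S 1) f0) => u.
  by rewrite -sym.
move=> f [M hM]; apply: (addIr M).
have hf : bnd setT f by exists M.
rewrite -[X in _ + X = _](ev_cst E1) -[X in _ = _ + X](ev_cst E1) -!evD; try exact: bnd_cst; try exact: bnd_comp hf.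
apply: (pos (fun x => f x + M)); first by apply: bndD => //; exact: bnd_cst.
by move=> x; have := hM x I; rewrite ler_norml => /andP[]; rewrite -subr_ge0 opprK.
Qed.

Lemma fin_walk x : P (S 1%N @^-1` [set x]) \is a fin_num.
Proof. by apply: fin_num_measure; exact: fibre_walk. Qed.

Definition atom_mass (x : T) : R := fine (P (S 1%N @^-1` [set x])).

Lemma atom_le (x : T) f : bnd setT f -> (forall y, 0 <= f y) -> f x * atom_mass x <= E1 f.
Proof.
move=> hf f0.
have -> : atom_mass x = E1 (fun y => (y == x)%:R).
  apply: EFin_inj; rewrite /atom_mass fineK ?fin_walk//= step_EFin; last exact: bnd_bool.
  transitivity (\int[P]_w (\1_(S 1%N @^-1` [set x]) w)%:E)%E.
    by rewrite integral_indic ?setIT//; exact: fibre_walk.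
  apply: eq_integral => w _; rewrite indicE /=; congr ((nat_of_bool _)%:R%:E).
  by apply/idP/idP; rewrite inE => /eqP.
rewrite -evZ; last exact: bnd_bool.
apply: ev_le => [|//|y _]; first by apply: bndZ; exact: bnd_bool.
by case: eqP => [->|_]; rewrite ?mulr1// mulr0.
Qed.

(** By symmetry - v has the same mass as v. Each of the three averages is bounded alone with the
    smallest mass m, so a third of m serves for their sum. *)
Lemma symmetric_atoms_walk v1 v2 v3 : symmetric_law P (S 1%N) ->
  0 < atom_mass v1 -> 0 < atom_mass v2 -> 0 < atom_mass v3 ->
  exists2 beta, 0 < beta <= 1 & symmetric_atoms E1 beta v1 v2 v3.
Proof.
move=> sym p1 p2 p3.
have opp v : atom_mass (- v) = atom_mass v.
  rewrite /atom_mass (sym [set - v])//; congr (fine (P _)).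
  by apply/seteqP; split=> w /=; [move/oppr_inj|move=> ->].
pose m := Num.min (atom_mass v1) (Num.min (atom_mass v2) (atom_mass v3)).
have m0 : 0 < m by rewrite !lt_min p1 p2.
have [m1 m2 m3] : [/\ m <= atom_mass v1, m <= atom_mass v2 & m <= atom_mass v3].
  by rewrite /m; split; rewrite !ge_min lexx ?orbT.
have a1 : atom_mass v1 <= 1.
  by rewrite -lee_fin fineK ?fin_walk//; apply: probability_le1; exact: fibre_walk.
exists (m / 3); first by apply/andP; split; [exact: divr_gt0|lra].
move=> f hf f0.
have key v : m <= atom_mass v -> m * avg v f 0 <= E1 f.
  move=> mv; have h1 := atom_le v hf f0; have h2 := atom_le (- v) hf f0; rewrite opp in h2.
  have h3 := ler_wpM2l (f0 v) mv; have h4 := ler_wpM2l (f0 (- v)) mv.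
  by rewrite /avg !add0r; lra.
have := key _ m1; have := key _ m2; have := key _ m3; lra.
Qed.

Definition toQ (x : T) : 'rV[rat]_d := map_mx intr (x : 'rV[int]_d).

Lemma toQB x y : toQ (x - y) = toQ x - toQ y.
Proof. exact: map_mxB. Qed.

Lemma toQMz x (a : int) : toQ (x *~ a) = a%:~R *: toQ x.
Proof.
rewrite scaler_int.
exact: (raddfMz (map_mx (intr : int -> rat) : {additive 'rV[int]_d -> 'rV[rat]_d}) a x).
Qed.

(** The lattice points in the rational span of fewer than d vectors form a subgroup; if it contained
    all atoms, aperiodicity would make it Z^d, whose rank is d. *)
Lemma atom_outside k (A : 'M[rat]_(k, d)) : spitzer_aperiodic P (S 1%N) -> (k < d)%N ->
  exists2 x, 0 < atom_mass x & ~~ (toQ x <= A)%MS.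
Proof.
move=> ap kd; apply: contrapT => none.
pose H : {pred T} := fun x => (toQ x <= A)%MS.
have Hcl : zmod_closed H.
  split=> [|x y]; first by rewrite /H unfold_in /toQ map_mx0 sub0mx.
  by rewrite !unfold_in /H toQB => hx hy; rewrite addmx_sub// eqmx_opp.
have all_in := ap H Hcl _.
have {}all_in x : x \in H.
  apply: all_in => y py; apply/negPn/negP => nH; apply: none; exists y => //.
  by rewrite -lte_fin fineK ?fin_walk.
have : (1%:M <= A)%MS.
  apply/row_subP => i; rewrite row1.
  have := all_in (delta_mx 0 i : 'rV[int]_d); rewrite unfold_in /H /toQ map_delta_mx.
  by [].
move/mxrankS; rewrite mxrank1 => h.
by have := leq_trans h (rank_leq_row A); rewrite leqNgt kd.
Qed.

Lemma exists_independent_atoms : spitzer_aperiodic P (S 1%N) -> (3 <= d)%N ->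
  exists v1 v2 v3, [/\ independent3 v1 v2 v3, 0 < atom_mass v1, 0 < atom_mass v2 & 0 < atom_mass v3].
Proof.
move=> ap d3.
have [v1 p1 n1] := @atom_outside 0 0 ap (ltn_trans (isT : (0 < 2)%N) d3).
have [v2 p2 n2] := @atom_outside 1 (toQ v1) ap (ltn_trans (isT : (1 < 2)%N) d3).
have [v3 p3 n3] := @atom_outside _ (col_mx (toQ v1) (toQ v2)) ap d3.
exists v1, v2, v3; split=> // a b c rel.
have relQ : a%:~R *: toQ v1 + b%:~R *: toQ v2 + c%:~R *: toQ v3 = 0.
  rewrite -!toQMz /toQ -!map_mxD.
  by have -> : (v1 *~ a + v2 *~ b + v3 *~ c : 'rV[int]_d) = 0; [exact: rel|rewrite map_mx0].
have solve (A : rat) (u w : 'rV[rat]_d) : A != 0 -> w + A *: u = 0 -> u = (- A^-1) *: w.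
  move=> A0 /eqP; rewrite addr_eq0 => /eqP ->.
  by rewrite scalerN scaleNr opprK scalerA mulVf// scale1r.
have c0 : c = 0.
  apply/eqP; apply: contraNT n3 => cn.
  have i1 : (toQ v1 <= col_mx (toQ v1) (toQ v2))%MS by rewrite -addsmxE addsmxSl.
  have i2 : (toQ v2 <= col_mx (toQ v1) (toQ v2))%MS by rewrite -addsmxE addsmxSr.
  by rewrite (solve _ _ _ _ relQ) ?intr_eq0// scalemx_sub// addmx_sub// scalemx_sub.
have b0 : b = 0.
  apply/eqP; apply: contraNT n2 => bn.
  move: relQ; rewrite c0 scale0r addr0 => /solve ->; rewrite ?intr_eq0//.
  by rewrite !scalemx_sub.
split=> //; apply/eqP; apply: contraNT n1 => an.
move: relQ; rewrite c0 b0 !scale0r !addr0 -[a%:~R *: _]add0r => /solve ->; rewrite ?intr_eq0//.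
by rewrite scaler0 sub0mx.
Qed.

Lemma prob_return k : P (S k @^-1` [set 0]) = (ret E1 k 0)%:E.
Proof.
rewrite /ret -prob_event_path; congr (P _).
by apply/seteqP; split=> w /=; rewrite (last_path RW) => /eqP.
Qed.

(** Time 0 is counted once and every later time twice, hence 2 G(0) - 1. The bound C makes the
    series of the Green's function finite, so that [fine] returns its value. *)
Lemma green_limit (C : R) : (forall n, gfull E1 n 0 <= C) ->
  let v := 2 * fine (green P (fun k => S k : Omega -> T) 0) - 1 in
  (forall n, 1 + 2 * gsum E1 n 0 <= v) /\
  (forall e, 0 < e -> exists K, forall k, (K <= k)%N -> v - e <= 1 + 2 * gsum E1 k 0).
Proof.
move=> hC v.
pose s n : R := \sum_(0 <= k < n) ret E1 k 0.
have snd : nondecreasing_seq s.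
  apply/nondecreasing_seqP => n; rewrite /s big_nat_recr//= lerDl; exact: ret_ge0.
have sub : has_ubound (range s).
  exists C => _ [n _ <-]; apply: le_trans (snd _ _ (leqnSn n)) _.
  by apply: le_trans (hC n); rewrite /s big_mkord.
have scv := nondecreasing_is_cvgn snd sub.
have gE : green P (fun k => S k : Omega -> T) 0 = (limn s)%:E.
  rewrite /green -EFin_lim//; apply: congr_lim; apply: funext => n /=.
  by rewrite /s -sumEFin; apply: eq_bigr => k _; rewrite prob_return.
have vE : v = 2 * limn s - 1 by rewrite /v gE.
have sg n : 1 + 2 * gsum E1 n 0 = 2 * s n.+1 - 1.
  have -> : s n.+1 = gfull E1 n 0 by rewrite /s big_mkord.
  by rewrite gfullE eqxx /=; ring.
split=> [n|e e0].
  by rewrite sg vE lerB// ler_pM2l//; exact: nondecreasing_cvgn_le.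
have e20 : 0 < e / 2 by exact: divr_gt0.
have /cvgrPdist_lt/(_ _ e20)[K _ hK] := scv.
exists K => k Kk; rewrite sg vE.
by have := hK k.+1 (leqW Kk); rewrite ltr_norml => /andP[_]; lra.
Qed.

End walk_and_scenery.

(** * Exponential moments of the scenery *)

Section exponential_taylor.
Context {R : realType}.

Lemma ge_at0_of_derive_ge0 (f df : R -> R) : (forall x : R, is_derive x 1 f (df x)) ->
  (forall x, 0 <= x -> 0 <= df x) -> forall x, 0 <= x -> f 0 <= f x.
Proof.
move=> hf hdf x x0; have cf : {within `[0, x], continuous f}.
  apply: continuous_subspaceT => y.
  by apply/differentiable_continuous/derivable1_diffP; case: (hf y).
have [c] := MVT_segment x0 (fun y _ => hf y) cf.
rewrite in_itv /= => /andP[c0 _] e.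
by rewrite -subr_ge0 e subr0 mulr_ge0// hdf.
Qed.

Lemma expR_ge_taylor2 (x : R) : 0 <= x -> 1 + x + x ^+ 2 / 2 <= expR x.
Proof.
move=> x0.
pose f (y : R) := expR y - (1 + y + y ^+ 2 / 2); pose df (y : R) := expR y - (1 + y).
have h1 (y : R) : is_derive y 1 f (df y).
  by rewrite /f /df; apply: is_derive_eq; rewrite /GRing.scale /=; field.
have h2 y : 0 <= y -> 0 <= df y.
  by move=> y0; rewrite /df; rewrite subr_ge0 expR_ge1Dx.
have := ge_at0_of_derive_ge0 h1 h2 x0.
by rewrite /f ?oppr0 expR0 ?expr0n /= ?mul0r ?subr0 ?addr0 subrr subr_ge0.
Qed.

Lemma expR_le_taylor2 (x : R) : 0 <= x -> expR x <= 1 + x + x ^+ 2 / 2 + x ^+ 3 * expR x.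
Proof.
move=> x0.
pose f (y : R) := 1 + y + y ^+ 2 / 2 + y ^+ 3 * expR y - expR y; pose df (y : R) := 1 + y + (3 * y ^+ 2 * expR y + y ^+ 3 * expR y) - expR y.
have h1 (y : R) : is_derive y 1 f (df y).
  by rewrite /f /df; apply: is_derive_eq; rewrite /GRing.scale /=; field.
have h2 y : 0 <= y -> 0 <= df y.
  move=> y0; rewrite /df; have := expR_le_quad y0; have := expR_ge0 y.
  have : 0 <= y ^+ 2 * expR y by rewrite mulr_ge0 ?exprn_ge0 ?expR_ge0.
  have : 0 <= y ^+ 3 * expR y by rewrite mulr_ge0 ?exprn_ge0 ?expR_ge0.
  by lra.
have := ge_at0_of_derive_ge0 h1 h2 x0.
by rewrite /f ?oppr0 expR0 ?expr0n /= ?mul0r ?subr0 ?addr0 subrr subr_ge0.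
Qed.

Lemma expRN_le_taylor2 (x : R) : 0 <= x -> expR (- x) <= 1 - x + x ^+ 2 / 2.
Proof.
move=> x0.
pose f (y : R) := 1 - y + y ^+ 2 / 2 - expR (- y); pose df (y : R) := y + expR (- y) - 1.
have h1 (y : R) : is_derive y 1 f (df y).
  by rewrite /f /df; apply: is_derive_eq; rewrite /GRing.scale /=; field.
have h2 y : 0 <= y -> 0 <= df y.
  by move=> y0; rewrite /df; have := expR_ge1Dx (- y); lra.
have := ge_at0_of_derive_ge0 h1 h2 x0.
by rewrite /f ?oppr0 expR0 ?expr0n /= ?mul0r ?subr0 ?addr0 subrr subr_ge0.
Qed.

Lemma expRN_ge_taylor2 (x : R) : 0 <= x -> 1 - x + x ^+ 2 / 2 - x ^+ 3 <= expR (- x).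
Proof.
move=> x0.
pose f (y : R) := expR (- y) - (1 - y + y ^+ 2 / 2 - y ^+ 3); pose df (y : R) := 1 - y + 3 * y ^+ 2 - expR (- y).
have h1 (y : R) : is_derive y 1 f (df y).
  by rewrite /f /df; apply: is_derive_eq; rewrite /GRing.scale /=; field.
have h2 y : 0 <= y -> 0 <= df y.
  by move=> y0; rewrite /df; have := expRN_le_taylor2 y0; have := sqr_ge0 y; lra.
have := ge_at0_of_derive_ge0 h1 h2 x0.
by rewrite /f ?oppr0 expR0 ?expr0n /= ?mul0r ?subr0 ?addr0 subrr subr_ge0.
Qed.

(** The weight has a term for each sign: |x|^3 controls negative x, where the third moment is at
    hand, and |x|^3 exp(x) positive x, where the one-sided Cramer condition is. *)
Lemma expR_taylor2 (x : R) :
  `|expR x - (1 + x + x ^+ 2 / 2)| <= `|x| ^+ 3 * (1 + expR x).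
Proof.
have e0 := expR_ge0 x.
have [x0|/ltW x0] := leP 0 x.
  have h1 := expR_ge_taylor2 x0; have h2 := expR_le_taylor2 x0.
  rewrite ger0_norm ?subr_ge0// ger0_norm//.
  have : 0 <= x ^+ 3 by exact: exprn_ge0.
  by lra.
have y0 : 0 <= - x by rewrite oppr_ge0.
have := expRN_le_taylor2 y0; have := expRN_ge_taylor2 y0.
rewrite !opprK sqrrN => h1 h2.
rewrite ler0_norm ?subr_le0; last lra.
rewrite ler0_norm//.
have : 0 <= (- x) ^+ 3 * expR x by rewrite mulr_ge0// exprn_ge0.
by lra.
Qed.

End exponential_taylor.

(** * Moment generating function of the scenery near 0 *)

Section moment_generating_function.
Context {dO : measure_display} {Omega : measurableType dO} {R : realType}.
Variables (P : probability Omega R) (X : {RV P >-> R}) (theta v2 : R).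
Hypothesis theta0 : 0 < theta.
Hypothesis v20 : 0 < v2.
Hypothesis X_mean : ('E_P[X] = 0)%E.
Hypothesis X_var : ('V_P[X] = v2%:E)%E.
Hypothesis X_third : ('E_P[(fun w => `|X w| ^+ 3)%R] < +oo)%E.
Hypothesis X_exp : ('E_P[(fun w => expR (theta * X w))%R] < +oo)%E.

Definition mgf (s : R) : R := \int[P]_w expR (s * X w).

Let mX : measurable_fun setT X. Proof. exact: measurable_funPT. Qed.

Let mexp s : measurable_fun setT (fun w => expR (s * X w)).
Proof. by apply: measurableT_comp => //; exact: measurable_funM. Qed.

Let int_third : P.-integrable setT (EFin \o (fun w => `|X w| ^+ 3)).
Proof.
apply/integrableP; split; first by apply/measurable_EFinP; apply: measurable_funX; exact: measurableT_comp.
move: X_third; rewrite unlock; apply: le_lt_trans.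
by rewrite le_eqVlt; apply/orP; left; apply/eqP; apply: eq_integral => w _ /=; rewrite ger0_norm ?exprn_ge0.
Qed.

Let int_exp : P.-integrable setT (EFin \o (fun w => expR (theta * X w))).
Proof.
apply/integrableP; split; first exact/measurable_EFinP.
move: X_exp; rewrite unlock; apply: le_lt_trans.
by rewrite le_eqVlt; apply/orP; left; apply/eqP; apply: eq_integral => w _ /=; rewrite ger0_norm ?expR_ge0.
Qed.

Let int_cst (c : R) : P.-integrable setT (EFin \o cst c).
Proof. exact: finite_measure_integrable_cst. Qed.

Let int_dom (f g : Omega -> R) : measurable_fun setT f -> P.-integrable setT (EFin \o g) ->
  (forall w, `|f w| <= g w) -> P.-integrable setT (EFin \o f).
Proof.
move=> mf ig fg; apply: (@le_integrable _ _ _ P _ measurableT _ (EFin \o g)) => //.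
  exact/measurable_EFinP.
by move=> w _ /=; rewrite lee_fin (le_trans (fg w))// ler_norm.
Qed.

Let int_D (f g : Omega -> R) : P.-integrable setT (EFin \o f) -> P.-integrable setT (EFin \o g) ->
  P.-integrable setT (EFin \o (fun w => f w + g w)).
Proof. by move=> hf hg; have := integrableD measurableT hf hg. Qed.

Let int_Z c (f : Omega -> R) : P.-integrable setT (EFin \o f) ->
  P.-integrable setT (EFin \o (fun w => c * f w)).
Proof. by move=> hf; have := integrableZl measurableT c hf. Qed.

Let int_1 : P.-integrable setT (EFin \o X).
Proof.
apply: (int_dom mX (int_D (int_cst 1) int_third)) => w /=.
have := normr_ge0 (X w); set a := `|X w| => a0.
have : 0 <= (a - 1) ^+ 2 * (a + 1) by rewrite mulr_ge0 ?sqr_ge0 ?addr_ge0.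
nra.
Qed.

Let int_2 : P.-integrable setT (EFin \o (fun w => X w ^+ 2)).
Proof.
apply: (int_dom _ (int_D (int_cst 1) int_third)) => [|w /=].
  exact: measurable_funX.
rewrite normrX; have := normr_ge0 (X w); set a := `|X w| => a0.
have : 0 <= (a - 1) ^+ 2 * (a + 1) by rewrite mulr_ge0 ?sqr_ge0 ?addr_ge0.
nra.
Qed.

Let mean0 : \int[P]_w X w = 0.
Proof. by move: X_mean; rewrite unlock /Rintegral => ->. Qed.

Let var2 : \int[P]_w (X w ^+ 2) = v2.
Proof.
rewrite /Rintegral (_ : (\int[P]_w (X w ^+ 2)%:E)%E = v2%:E)//.
rewrite -X_var /variance unlock X_mean /= unlock.
by apply: eq_integral => w _ /=; rewrite /GRing.mul /= !subr0 expr2.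
Qed.

Lemma integrable_exp s : 0 <= s <= theta ->
  P.-integrable setT (EFin \o (fun w => expR (s * X w))).
Proof.
move=> /andP[s0 st]; apply: (int_dom (mexp s) (int_D (int_cst 1) int_exp)) => w /=.
rewrite ger0_norm ?expR_ge0//.
have [x0|/ltW x0] := leP 0 (X w).
  by rewrite -[leLHS]add0r lerD// ler_expR ler_wpM2r.
rewrite -[leLHS]addr0 lerD ?expR_ge0//.
by rewrite -[leRHS]expR0 ler_expR mulr_ge0_le0.
Qed.

(** Dominates |X|^3 (1 + exp(s X)) for s <= theta / 2. The factor 2 suffices when X <= 0. For X > 0,
    x^3 <= 6 exp(x) at x = theta X / 2 gives 48 = 8 * 6 and leaves exp(theta X / 2) for exp(s X). *)
Definition domin (w : Omega) : R := 2 * `|X w| ^+ 3 + 48 / theta ^+ 3 * expR (theta * X w).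

Lemma taylor_domin s w : 0 <= s <= theta / 2 ->
  `|expR (s * X w) - (1 + s * X w + (s * X w) ^+ 2 / 2)| <= s ^+ 3 * domin w.
Proof.
move=> /andP[s0 st]; apply: le_trans (expR_taylor2 _) _.
rewrite normrM (ger0_norm s0) exprMn -mulrA ler_wpM2l ?exprn_ge0// /domin.
set a := `|X w| ^+ 3; have a0 : 0 <= a by rewrite exprn_ge0.
have t3 : 0 < theta ^+ 3 by rewrite exprn_gt0.
have e0 := expR_ge0 (theta * X w).
have [x0|/ltW x0] := leP 0 (X w); last first.
  have e1 : expR (s * X w) <= 1 by rewrite -[leRHS]expR0 ler_expR mulr_ge0_le0.
  have := ler_wpM2l a0 e1.
  have : 0 <= 48 / theta ^+ 3 * expR (theta * X w) by rewrite mulr_ge0// divr_ge0// ltW.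
  by lra.
have ha : a <= 48 / theta ^+ 3 * expR (theta / 2 * X w).
  have y0 : 0 <= theta / 2 * X w by rewrite !mulr_ge0// ltW.
  have := @expR_ge1Dxn R _ 2 y0; rewrite /a ger0_norm// => h.
  have : (theta / 2 * X w) ^+ 3 <= 6 * expR (theta / 2 * X w).
    by move: h; rewrite (_ : 3`! = 6%N)//; lra.
  have -> : X w ^+ 3 = 8 / theta ^+ 3 * (theta / 2 * X w) ^+ 3 by field; rewrite gt_eqF.
  have k0 : 0 <= 8 / theta ^+ 3 by rewrite divr_ge0// ltW.
  by move=> /(ler_wpM2l k0); lra.
have e1 : expR (s * X w) <= expR (theta / 2 * X w) by rewrite ler_expR ler_wpM2r.
have : a * expR (s * X w) <= 48 / theta ^+ 3 * expR (theta / 2 * X w) * expR (theta / 2 * X w).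
  by apply: ler_pM => //; exact: expR_ge0.
rewrite -mulrA -expRD (_ : theta / 2 * X w + theta / 2 * X w = theta * X w); last by field.
lra.
Qed.

Let int_domin : P.-integrable setT (EFin \o domin).
Proof. exact: (int_D (int_Z 2 int_third) (int_Z (48 / theta ^+ 3) int_exp)). Qed.

Lemma mgf_taylor : exists2 M, 0 <= M & forall s, 0 <= s <= theta / 2 ->
  `|mgf s - (1 + s ^+ 2 * v2 / 2)| <= s ^+ 3 * M.
Proof.
exists (\int[P]_w domin w).
  apply: Rintegral_ge0 => w _; rewrite addr_ge0 ?mulr_ge0 ?exprn_ge0 ?expR_ge0// ?invr_ge0 ?exprn_ge0//; exact: ltW.
move=> s hs; have /andP[s0 st] := hs.
pose q w := 1 + (s * X w + s ^+ 2 / 2 * X w ^+ 2).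
have iq : P.-integrable setT (EFin \o q).
  exact: (int_D (int_cst 1) (int_D (int_Z s int_1) (int_Z (s ^+ 2 / 2) int_2))).
have qE : \int[P]_w q w = 1 + s ^+ 2 * v2 / 2.
  rewrite /q RintegralD//; [|exact: (int_cst 1)|exact: (int_D (int_Z s int_1) (int_Z (s ^+ 2 / 2) int_2))].
  rewrite RintegralD//; [|exact: (int_Z s int_1)|exact: (int_Z (s ^+ 2 / 2) int_2)].
  rewrite RintegralZl// RintegralZl// mean0 var2 Rintegral_cst//.
  have -> : fine (P setT) = 1 by have -> : P setT = 1%E by exact: probability_setT.
  by ring.
have ie : P.-integrable setT (EFin \o (fun w => expR (s * X w))).
  by apply: integrable_exp; apply/andP; split => //; lra.
have idm : P.-integrable setT (EFin \o (fun w => s ^+ 3 * domin w)).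
  exact: (int_Z (s ^+ 3) int_domin).
rewrite -qE /mgf -RintegralB// -RintegralZl//.
apply: le_trans (le_normr_Rintegral _ _) _ => //.
  by have := integrableB measurableT ie iq.
apply: le_Rintegral => //.
  have := integrableB measurableT ie iq => h; have := integrable_abse h.
  by apply: eq_integrable => // w _.
move=> w _; apply: le_trans (taylor_domin w hs); rewrite /q exprMn.
by rewrite le_eqVlt; apply/orP; left; apply/eqP; congr (`|_ - _|); ring.
Qed.

Lemma mgf_bounds (delta : R) : 0 < delta <= 1 / 2 -> exists2 s0, 0 < s0 <= theta / 2 &
  forall s, 0 <= s <= s0 ->
  expR ((1 - delta) * (s ^+ 2 * v2 / 2)) <= mgf s <= expR ((1 + delta) * (s ^+ 2 * v2 / 2)).
Proof.
move=> /andP[d0 d1]; have [M M0 hM] := mgf_taylor.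
(* The third entry makes the cubic remainder at most delta / 2 times the quadratic term, with M + 1
   because M may vanish. The last one, with s <= 1, makes the quadratic term at most delta / 12, for
   the comparison of the polynomial with the exponential from below. *)
pose s0 := Num.min (Num.min (theta / 2) 1) (Num.min (delta * v2 / (4 * (M + 1))) (delta / (6 * v2))).
have M1 : 0 < M + 1 by lra.
have s00 : 0 < s0.
  by rewrite !lt_min ltr01 !divr_gt0 ?mulr_gt0.
exists s0; first by rewrite s00 /s0 !ge_min lexx.
move=> s /andP[sge]; rewrite !le_min => /andP[/andP[st s1] /andP[s2 s3]].
have := hM s; rewrite sge st => /(_ isT); rewrite ler_norml => /andP[hl hu].
have s2' : 4 * (s * (M + 1)) <= delta * v2.
  by move: s2; rewrite ler_pdivlMr ?mulr_gt0//; lra.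
have s3' : 6 * (s * v2) <= delta.
  by move: s3; rewrite ler_pdivlMr ?mulr_gt0//; lra.
set y := s ^+ 2 * v2 / 2.
have ss : 0 <= s ^+ 2 by exact: sqr_ge0.
have y0 : 0 <= y by rewrite /y !mulr_ge0// ltW.
have s3M : s ^+ 3 * M <= delta / 2 * y.
  have h : s * M <= delta * v2 / 4 by lra.
  have := ler_wpM2l ss h; rewrite /y; lra.
have ydelta : y <= delta / 12.
  have sv : 0 <= s * v2 by rewrite mulr_ge0// ltW.
  have := ler_wpM2r sv s1; rewrite /y; lra.
apply/andP; split; last first.
  apply: le_trans (expR_ge1Dx _).
  have : 0 <= delta * y by rewrite mulr_ge0// ltW.
  by rewrite -/y in hu; lra.
have z0 : 0 <= (1 - delta) * y by rewrite mulr_ge0//; lra.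
have zy : (1 - delta) * y <= y by rewrite ler_piMl//; lra.
apply: le_trans (expR_le_quad z0) _.
have e2 : expR ((1 - delta) * y) <= 2.
  have e1 := expR_ge1Dx (- ((1 - delta) * y)); rewrite expRN in e1.
  have u0 := expR_gt0 ((1 - delta) * y).
  move: e1; rewrite -(ler_pM2r u0) mulVf ?gt_eqF//; set u := expR _ in u0 *.
  have : (1 - delta) * y * u <= 1 / 2 * u by rewrite ler_wpM2r ?(ltW u0)//; lra.
  lra.
have h1 : ((1 - delta) * y) ^+ 2 * expR ((1 - delta) * y) <= ((1 - delta) * y) ^+ 2 * 2.
  by rewrite ler_wpM2l// sqr_ge0.
have h2 : ((1 - delta) * y) ^+ 2 <= (1 - delta) * y * (delta / 12).
  by rewrite expr2 ler_wpM2l//; lra.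
have : 0 <= delta * y by rewrite mulr_ge0// ltW.
have : 0 <= delta * (delta * y) by rewrite !mulr_ge0// ltW.
by rewrite -/y in hl; lra.
Qed.

End moment_generating_function.

(** * Product formula for independent scenery variables *)

Section product_formula.
Context {dO : measure_display} {Omega : measurableType dO} {R : realType}.
Variable P : probability Omega R.

Lemma le_integral_EFin (f g : Omega -> R) : measurable_fun setT f -> measurable_fun setT g ->
  (forall w, 0 <= f w) -> (forall w, f w <= g w) ->
  (\int[P]_w (f w)%:E <= \int[P]_w (g w)%:E)%E.
Proof.
move=> mf mg f0 fg; apply: ge0_le_integral => //.
- by move=> w _; rewrite lee_fin.
- exact/measurable_EFinP.
- exact/measurable_EFinP.
- by move=> w _; rewrite lee_fin.
Qed.

Lemma integralZ_EFin (c : R) (f : Omega -> R) : 0 <= c -> measurable_fun setT f ->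
  (forall w, 0 <= f w) ->
  (c%:E * \int[P]_w (f w)%:E)%E = (\int[P]_w (c * f w)%:E)%E.
Proof.
move=> c0 mf f0; rewrite -ge0_integralZl_EFin//.
- by move=> w _; rewrite lee_fin.
- exact/measurable_EFinP.
Qed.

Lemma integralD_EFin (f g : Omega -> R) : measurable_fun setT f -> measurable_fun setT g ->
  (forall w, 0 <= f w) -> (forall w, 0 <= g w) ->
  (\int[P]_w (f w)%:E + \int[P]_w (g w)%:E)%E = (\int[P]_w (f w + g w)%:E)%E.
Proof.
move=> mf mg f0 g0; rewrite -ge0_integralD//.
- by move=> w _; rewrite lee_fin.
- exact/measurable_EFinP.
- by move=> w _; rewrite lee_fin.
- exact/measurable_EFinP.
Qed.

Variables (I : choiceType) (X : I -> {RV P >-> R}).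
Hypothesis X_ind : mutually_independent P (fun i => X i : Omega -> R).

Definition cylinder (J : {fset I}) (B : I -> set R) : set Omega :=
  \bigcap_(i in [set` J]) (X i @^-1` B i).

Lemma measurable_RV i (B : set R) : measurable B -> measurable (X i @^-1` B).
Proof. by move=> mB; rewrite -[X in measurable X]setTI; exact: (measurable_funPT (X i)). Qed.

Lemma measurable_cylinder J B : (forall i, measurable (B i)) -> measurable (cylinder J B).
Proof.
move=> mB; rewrite /cylinder; apply: fin_bigcap_measurable => // i _.
exact: measurable_RV.
Qed.

Lemma cylinder_add (J : {fset I}) B j (C : set R) : j \notin J ->
  cylinder (j |` J)%fset (fun i => if i == j then C else B i) = cylinder J B `&` X j @^-1` C.
Proof.
move=> jJ; apply/seteqP; split=> w.
  move=> h; split=> [i /= iJ|].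
    have := h i; rewrite /= in_fset1U iJ orbT => /(_ isT); case: eqP => // ij.
    by move: jJ; rewrite -ij iJ.
  by have := h j; rewrite /= in_fset1U !eqxx => /(_ isT).
move=> [h hj] i /=; rewrite in_fset1U => /orP[/eqP ->|iJ]; first by rewrite eqxx.
by case: eqP => [->//|_]; exact: h.
Qed.

Lemma prob_cylinder_add (J : {fset I}) B j (C : set R) : j \notin J ->
  (forall i, measurable (B i)) -> measurable C ->
  P (cylinder J B `&` X j @^-1` C) = (P (cylinder J B) * P (X j @^-1` C))%E.
Proof.
move=> jJ mB mC; rewrite -cylinder_add// /cylinder.
rewrite (X_ind (J := (j |` J)%fset)); last by move=> i _; case: eqP.
rewrite (X_ind (J := J)) => [|i _]; last exact: mB.
rewrite big_fsetU1//= eqxx muleC; congr (_ * _)%E.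
by apply: eq_big_seq => i iJ; case: eqP => // ij; move: jJ; rewrite -ij iJ.
Qed.

Section discretization.
Variables (m : nat) (s : I -> R).
Hypothesis m0 : (0 < m)%N.
Let m0R : 0 < m%:R :> R. Proof. by rewrite ltr0n. Qed.

(* Rounding down to multiples of 1/m reduces the product formula for independent
   variables to countably many cylinders. *)
Definition disc i w : int := Num.floor (m%:R * X i w).

Let cell (u : int) : set R := [set r | Num.floor (m%:R * r) = u].

Let measurable_cell u : measurable (cell u).
Proof.
have -> : cell u = `[u%:~R / m%:R, (u + 1)%:~R / m%:R[%classic.
  apply/seteqP; split=> r /=; rewrite in_itv /= ler_pdivrMr// ltr_pdivlMr// mulrC.
    by move=> <-; have := floor_itv (m%:R * r).
  by move=> h; exact: floor_def.
exact: measurable_itv.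
Qed.

Lemma fibre_disc i : fibre_measurable (disc i).
Proof. by move=> u; exact: (measurable_RV i (measurable_cell u)). Qed.

Definition edisc i w : R := expR (s i * ((disc i w)%:~R / m%:R)).

Lemma measurable_edisc i : measurable_fun setT (edisc i).
Proof.
apply/measurable_EFinP.
exact: (@fibre_measurable_fun _ _ _ _ (disc i) (fun u => (expR (s i * (u%:~R / m%:R)))%:E) setT measurableT (fibre_disc i)).
Qed.

Lemma measurable_prod_edisc (u : seq I) : measurable_fun setT (fun w => \prod_(i <- u) edisc i w).
Proof.
elim: u => [|i u IH].
  by under eq_fun do rewrite big_nil; exact: measurable_cst.
under eq_fun do rewrite big_cons; apply: measurable_funM => //; exact: measurable_edisc.
Qed.

Lemma prod_edisc_ge0 (u : seq I) w : 0 <= \prod_(i <- u) edisc i w.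
Proof. by apply: prodr_ge0 => i _; exact: expR_ge0. Qed.

(** The cylinder is there for the induction: fixing the cell of one variable adds a coordinate to
    it. *)
Lemma integral_prod_edisc (E : I -> R) (u : seq I) :
  (forall i, i \in u -> (\int[P]_w (edisc i w)%:E)%E = (E i)%:E) ->
  (forall i, 0 <= E i) -> uniq u ->
  forall (J : {fset I}) B, (forall i, measurable (B i)) -> (forall i, i \in u -> i \notin J) ->
  (\int[P]_(w in cylinder J B) (\prod_(i <- u) edisc i w)%:E)%E =
  (P (cylinder J B) * (\prod_(i <- u) E i)%:E)%E.
Proof.
move=> hE E0; elim: u hE => [|j u IH] hE /=.
  move=> _ J B mB _; rewrite big_nil mule1.
  rewrite (eq_integral (fun=> 1%:E)); last by move=> w _; rewrite big_nil.
  by rewrite integral_cst ?mul1e//; exact: measurable_cylinder.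
move=> /andP[ju uu] J B mB uJ.
have mc := measurable_cylinder J mB.
have jJ : j \notin J by apply: uJ; rewrite mem_head.
have PK : P (cylinder J B) = (fine (P (cylinder J B)))%:E by rewrite fineK// fin_num_measure.
rewrite (eq_integral (fun w => (expR (s j * ((disc j w)%:~R / m%:R)) * \prod_(i <- u) edisc i w)%:E));
  last by move=> w _; rewrite big_cons.
rewrite (integral_weighted_fibres (h := fun k : int => expR (s j * (k%:~R / m%:R)))
  (K := fine (P (cylinder J B)) * \prod_(i <- u) E i) (fibre_disc j) (fibre_disc j) mc
  (measurable_prod_edisc u) (prod_edisc_ge0 u)).
- have := hE j (mem_head _ _); rewrite /edisc => ->.
  by rewrite EFinM -PK big_cons [X in _ = (_ * X)%E]EFinM -muleA [X in (_ * X)%E]muleC.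
- by move=> k; exact: expR_ge0.
- by rewrite mulr_ge0 ?fine_ge0// prodr_ge0.
move=> k.
have -> : disc j @^-1` [set k] = X j @^-1` cell k by [].
rewrite -cylinder_add// IH//.
- rewrite cylinder_add// prob_cylinder_add//= EFinM -PK -!muleA; congr (_ * _)%E.
  by rewrite muleC.
- by move=> i iu; apply: hE; rewrite inE iu orbT.
- by move=> i; case: eqP.
- move=> i iu; rewrite in_fset1U negb_or uJ ?inE ?iu ?orbT// andbT.
  by apply: contraNneq ju => <-.
Qed.

Lemma disc_le i w : (disc i w)%:~R / m%:R <= X i w.
Proof. by rewrite ler_pdivrMr// mulrC; have /andP[] := floor_itv (m%:R * X i w). Qed.

Lemma disc_gt i w : X i w <= (disc i w)%:~R / m%:R + m%:R^-1.
Proof.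
have /andP[_ h] := floor_itv (m%:R * X i w).
rewrite -[X in _ + X]mul1r -mulrDl ler_pdivlMr// mulrC.
by move: h; rewrite intrD => /ltW.
Qed.

End discretization.

Lemma le_of_archimedean (a b c : R) : 0 <= a -> 0 <= c ->
  (forall m : nat, (0 < m)%N -> a * (1 - c / m%:R) <= b) -> a <= b.
Proof.
move=> a0 c0 h; rewrite leNgt; apply/negP => ba.
have ab : 0 < a - b by rewrite subr_gt0.
pose m := (Num.bound (a * c / (a - b))).+1.
have mb : a * c / (a - b) < m%:R.
  apply: (@lt_trans _ _ (Num.bound (a * c / (a - b)))%:R); last by rewrite ltr_nat.
  by rewrite archi_boundP// divr_ge0 ?mulr_ge0// ltW.
have m0 : 0 < m%:R :> R by rewrite ltr0n.
have := h m isT; rewrite mulrBr mulr1 mulrA => hm.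
have : a - b <= a * c / m%:R by lra.
by rewrite ler_pdivlMr// => h1; move: mb; rewrite ltr_pdivrMr//; lra.
Qed.

(** Rounding changes the exponent by at most c / m, where c is the sum of the s_i, so the two sides
    agree up to a factor exp(c / m) for every m. *)
Lemma integral_exp_sum (s M : I -> R) (u : seq I) : uniq u -> (forall i, 0 <= s i) ->
  (forall i, i \in u -> (\int[P]_w (expR (s i * X i w))%:E)%E = (M i)%:E) ->
  (\int[P]_w (expR (\sum_(i <- u) s i * X i w))%:E)%E = (\prod_(i <- u) M i)%:E.
Proof.
move=> uu s0 hM.
pose c := \sum_(i <- u) s i.
have c0 : 0 <= c by rewrite sumr_ge0.
have me i : measurable_fun setT (fun w => expR (s i * X i w)).
  by apply: measurableT_comp => //; exact: measurable_funM.
have mG : measurable_fun setT (fun w => expR (\sum_(i <- u) s i * X i w)).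
  apply: measurableT_comp => //.
  by apply: measurable_sum => i; exact: measurable_funM.
pose E m i := fine (\int[P]_w (edisc m s i w)%:E)%E.
have med m (m0 : (0 < m)%N) i : measurable_fun setT (edisc m s i) by exact: measurable_edisc.
have ed0 m i w : 0 <= edisc m s i w by exact: expR_ge0.
have E0 m i : 0 <= E m i by apply: fine_ge0; apply: integral_ge0 => w _; rewrite lee_fin.
have bounds m (m0 : (0 < m)%N) i : i \in u ->
    [/\ (\int[P]_w (edisc m s i w)%:E)%E = (E m i)%:E, E m i <= M i & M i <= expR (s i / m%:R) * E m i].
  move=> iu.
  have le1 : (\int[P]_w (edisc m s i w)%:E <= (M i)%:E)%E.
    rewrite -hM//; apply: (le_integral_EFin (med m m0 i) (me i)) => // w.
    by rewrite ler_expR ler_wpM2l// disc_le.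
  have fin : (\int[P]_w (edisc m s i w)%:E)%E \is a fin_num.
    rewrite ge0_fin_numE ?(le_lt_trans le1) ?ltry//.
    by apply: integral_ge0 => w _; rewrite lee_fin.
  have eE : (\int[P]_w (edisc m s i w)%:E)%E = (E m i)%:E by rewrite /E fineK.
  split=> //; first by rewrite -lee_fin -eE.
  rewrite -lee_fin -hM// EFinM -eE integralZ_EFin ?expR_ge0//; last exact: med.
  apply: le_integral_EFin => //.
  - by apply: measurable_funM => //; exact: med.
  - move=> w; rewrite -expRD ler_expR addrC -mulrDr ler_wpM2l//.
    exact: disc_gt.
have prodE m (m0 : (0 < m)%N) :
    (\int[P]_w (\prod_(i <- u) edisc m s i w)%:E)%E = (\prod_(i <- u) E m i)%:E.
  have := @integral_prod_edisc m s m0 (E m) u _ (E0 m) uu fset0 (fun=> setT) (fun=> measurableT) (fun i _ => isT).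
  have -> : cylinder fset0 (fun=> setT) = setT by apply/seteqP; split=> w // _ i.
  rewrite [P setT]probability_setT mul1e; apply=> i iu.
  by have [] := bounds m m0 i iu.
set Q := \prod_(i <- u) M i.
have M0 i : i \in u -> 0 <= M i.
  by move=> iu; rewrite -lee_fin -hM//; apply: integral_ge0 => w _; rewrite lee_fin expR_ge0.
have Q0 : 0 <= Q by rewrite /Q big_seq_cond prodr_ge0// => i /andP[iu _]; exact: M0.
have lower m (m0 : (0 < m)%N) : Q <= expR (c / m%:R) * \prod_(i <- u) E m i.
  rewrite /c mulr_suml expR_sum -big_split /= /Q.
  rewrite [leLHS]big_seq [leRHS]big_seq; apply: ler_prod => i iu; rewrite M0//=.
  by have [] := bounds m m0 i iu.
have upper m (m0 : (0 < m)%N) : \prod_(i <- u) E m i <= Q.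
  rewrite /Q [leLHS]big_seq [leRHS]big_seq; apply: ler_prod => i iu; rewrite E0/=.
  by have [] := bounds m m0 i iu.
have prodexp m w : \prod_(i <- u) edisc m s i w = expR (\sum_(i <- u) s i * ((disc m i w)%:~R / m%:R)).
  by rewrite expR_sum.
have mpr m (m0 : (0 < m)%N) : measurable_fun setT (fun w => \prod_(i <- u) edisc m s i w).
  exact: measurable_prod_edisc.
have pr0 m w : 0 <= \prod_(i <- u) edisc m s i w by exact: prod_edisc_ge0.
have Glow m (m0 : (0 < m)%N) : ((\prod_(i <- u) E m i)%:E <= \int[P]_w (expR (\sum_(i <- u) s i * X i w))%:E)%E.
  rewrite -prodE//; apply: (le_integral_EFin (mpr m m0) mG) => // w.
  rewrite prodexp ler_expR; apply: ler_sum => i _.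
  by rewrite ler_wpM2l// disc_le.
have Gup m (m0 : (0 < m)%N) : (\int[P]_w (expR (\sum_(i <- u) s i * X i w))%:E <= (expR (c / m%:R) * \prod_(i <- u) E m i)%:E)%E.
  rewrite EFinM -prodE// integralZ_EFin ?expR_ge0//; last exact: mpr.
  apply: le_integral_EFin => //.
  - by apply: measurable_funM => //; exact: mpr.
  - move=> w; rewrite prodexp -expRD ler_expR /c mulr_suml -big_split /=.
    by apply: ler_sum => i _; rewrite addrC -mulrDr ler_wpM2l// disc_gt.
have pos w : setT w -> (0 <= (expR (\sum_(i <- u) s i * X i w))%:E)%E.
  by move=> _; rewrite lee_fin expR_ge0.
have fin : (\int[P]_w (expR (\sum_(i <- u) s i * X i w))%:E)%E \is a fin_num.
  rewrite ge0_fin_numE ?(le_lt_trans (Gup 1%N isT)) ?ltry//.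
  exact: integral_ge0.
rewrite -(fineK fin); congr EFin; set g := fine _.
have g0 : 0 <= g by apply: fine_ge0; exact: integral_ge0.
have gE : g%:E = (\int[P]_w (expR (\sum_(i <- u) s i * X i w))%:E)%E by rewrite fineK.
have ineq (a b : R) (m : nat) : 0 <= a -> a <= expR (c / m%:R) * b -> a * (1 - c / m%:R) <= b.
  move=> a0 ab; have e0 := expR_gt0 (c / m%:R); rewrite -(ler_pM2l e0).
  apply: le_trans ab; rewrite mulrCA -[leRHS]mulr1 ler_wpM2l//.
  have h1 := ler_wpM2l (ltW e0) (expR_ge1Dx (- (c / m%:R))).
  by rewrite expRN mulfV ?gt_eqF// in h1.
apply/eqP; rewrite eq_le; apply/andP; split.
  apply: (le_of_archimedean g0 c0) => m m0; apply: ineq => //.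
  rewrite -lee_fin gE; apply: le_trans (Gup m m0) _.
  by rewrite lee_fin ler_wpM2l ?expR_ge0// upper.
apply: (le_of_archimedean Q0 c0) => m m0; apply: ineq => //.
apply: le_trans (lower m m0) _; rewrite ler_wpM2l ?expR_ge0//.
by rewrite -lee_fin gE Glow.
Qed.

End product_formula.

(** * The scenery along a fixed trajectory *)

Section quenched.
Context {dO : measure_display} {Omega : measurableType dO} {R : realType}.
Variables (P : probability Omega R) (I : choiceType) (X : I -> {RV P >-> R}) (i0 : I).
Hypothesis X_ind : mutually_independent P (fun i => X i : Omega -> R).
Hypothesis X_law : forall i j, same_law P (X i : Omega -> R) (X j).
Variables (theta v2 : R).
Hypothesis int_exp : forall s, 0 <= s <= theta ->
  P.-integrable setT (EFin \o (fun w => expR (s * X i0 w))).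

Local Notation M := (mgf (X i0)).

Lemma integral_exp_RV s i : 0 <= s <= theta -> (\int[P]_w (expR (s * X i w))%:E)%E = (M s)%:E.
Proof.
move=> hs; rewrite /mgf /Rintegral fineK; last by apply: integrable_fin_num => //; exact: int_exp.
pose f (r : R) := (expR (s * r))%:E.
have mf : measurable_fun setT f.
  by apply/measurable_EFinP; apply: measurableT_comp => //; exact: measurable_funM.
have f0 r : (0 <= f r)%E by rewrite lee_fin expR_ge0.
have e j : (\int[P]_w (expR (s * X j w))%:E)%E = (\int[distribution P (X j)]_r f r)%E.
  by rewrite ge0_integral_distribution.
rewrite !e; apply: eq_measure_integral => A mA _; exact: X_law.
Qed.

Definition sumX (t : seq I) (w : Omega) : R := \sum_(z <- t) X z w.

(** The transform at h given the trajectory: sites are listed without repetition, each with its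
    local time. *)
Definition qmgf (h : R) (t : seq I) : R := \prod_(z <- undup t) M (h * (count_mem z t)%:R).

Lemma sum_undup_count (V : nmodType) (F : I -> V) (t : seq I) :
  \sum_(z <- t) F z = \sum_(z <- undup t) F z *+ count_mem z t.
Proof. by rewrite -(big_undup_iterop_count _ t xpredT). Qed.

Lemma sum_undup_sq (t : seq I) : \sum_(z <- undup t) (count_mem z t)%:R ^+ 2 = (selfint t)%:R :> R.
Proof.
rewrite /selfint /cross natr_sum [RHS]sum_undup_count; apply: eq_bigr => z _.
by rewrite expr2 mulr_natr.
Qed.

Lemma measurable_sumX t : measurable_fun setT (sumX t).
Proof. by apply: measurable_sum => i; exact: measurable_funPT. Qed.

Lemma measurable_exp_sumX h t : measurable_fun setT (fun w => expR (h * sumX t w)).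
Proof. by apply: measurableT_comp => //; apply: measurable_funM => //; exact: measurable_sumX. Qed.

Lemma integral_exp_sumX h t : 0 <= h -> (forall y, h * (count_mem y t)%:R <= theta) ->
  (\int[P]_w (expR (h * sumX t w))%:E)%E = (qmgf h t)%:E.
Proof.
move=> h0 ht.
have e w : h * sumX t w = \sum_(z <- undup t) h * (count_mem z t)%:R * X z w.
  rewrite /sumX sum_undup_count mulr_sumr; apply: eq_bigr => z _.
  by rewrite -mulrA mulr_natl.
under eq_integral do rewrite e.
apply: (@integral_exp_sum _ _ _ P I X X_ind (fun z => h * (count_mem z t)%:R)) => [|z|z _].
- exact: undup_uniq.
- by rewrite mulr_ge0.
by apply: integral_exp_RV; rewrite mulr_ge0//= ht.
Qed.

Lemma qmgf_bounds (delta s0 h : R) t :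
  (forall s, 0 <= s <= s0 ->
    expR ((1 - delta) * (s ^+ 2 * v2 / 2)) <= M s <= expR ((1 + delta) * (s ^+ 2 * v2 / 2))) ->
  0 <= h -> (forall y, h * (count_mem y t)%:R <= s0) ->
  expR ((1 - delta) * (h ^+ 2 * v2 / 2) * (selfint t)%:R) <= qmgf h t <=
  expR ((1 + delta) * (h ^+ 2 * v2 / 2) * (selfint t)%:R).
Proof.
move=> hM h0 ht; rewrite -sum_undup_sq !mulr_sumr !expR_sum /qmgf.
have b z : expR ((1 - delta) * (h ^+ 2 * v2 / 2) * (count_mem z t)%:R ^+ 2) <=
    M (h * (count_mem z t)%:R) <= expR ((1 + delta) * (h ^+ 2 * v2 / 2) * (count_mem z t)%:R ^+ 2).
  have := hM (h * (count_mem z t)%:R); rewrite mulr_ge0//= ht => /(_ isT).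
  have e (c : R) : c * ((h * (count_mem z t)%:R) ^+ 2 * v2 / 2) = c * (h ^+ 2 * v2 / 2) * (count_mem z t)%:R ^+ 2 by ring.
  by rewrite !e.
apply/andP; split; apply: ler_prod => z _; have /andP[b1 b2] := b z.
  by rewrite expR_ge0.
by rewrite b2 (le_trans (expR_ge0 _) b1).
Qed.

Definition tail (b : R) t : R := fine (P [set w | b <= sumX t w]).

Lemma measurable_tail b t : measurable [set w | b <= sumX t w].
Proof.
rewrite (_ : [set _ | _] = sumX t @^-1` `[b, +oo[); last first.
  by apply/seteqP; split=> w /=; rewrite in_itv /= andbT.
by rewrite -[X in measurable X]setTI; apply: measurable_sumX.
Qed.

Lemma tail_ge0 b t : 0 <= tail b t.
Proof. exact: fine_ge0. Qed.

Lemma tail_le1 b t : tail b t <= 1.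
Proof.
have m := measurable_tail b t.
by rewrite -lee_fin fineK ?fin_num_measure//; exact: probability_le1.
Qed.

Lemma tail_le b h t : 0 <= h -> (forall y, h * (count_mem y t)%:R <= theta) ->
  tail b t <= expR (- (h * b)) * qmgf h t.
Proof.
move=> h0 ht; have m := measurable_tail b t.
rewrite -lee_fin fineK ?fin_num_measure// EFinM -integral_exp_sumX// integralZ_EFin ?expR_ge0//; last exact: measurable_exp_sumX.
have -> : P [set w | b <= sumX t w] = (\int[P]_w (\1_[set w | b <= sumX t w] w)%:E)%E.
  by rewrite integral_indic// setIT.
apply: le_integral_EFin => // [|w].
  by apply: measurable_funM => //; exact: measurable_exp_sumX.
rewrite indicE; case: (boolP (_ \in _)) => [|_]; last by rewrite mulr_ge0 ?expR_ge0.
rewrite inE /= => bw; rewrite -expRD -[leLHS]expR0 ler_expR.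
by rewrite addrC subr_ge0 ler_wpM2l.
Qed.

(* Split according to x < b, b <= x <= L and L < x, where x is the value of the sum. *)
Lemma tail_ge b L eta h t : b <= L -> 0 <= eta <= h ->
  (forall y, (h + eta) * (count_mem y t)%:R <= theta) ->
  qmgf h t <= expR (h * L) * tail b t + expR (eta * b) * qmgf (h - eta) t +
    expR (- (eta * L)) * qmgf (h + eta) t.
Proof.
move=> bL /andP[e0 eh] ht.
have h0 : 0 <= h by apply: le_trans eh.
have h0' : 0 <= h - eta by rewrite subr_ge0.
have h0'' : 0 <= h + eta by exact: addr_ge0.
have ht1 y : h * (count_mem y t)%:R <= theta.
  by apply: le_trans (ht y); rewrite ler_wpM2r// lerDl.
have ht2 y : (h - eta) * (count_mem y t)%:R <= theta.
  by apply: le_trans (ht1 y); rewrite ler_wpM2r// gerBl.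
have m := measurable_tail b t.
have mt : measurable_fun setT (\1_[set w | b <= sumX t w] : Omega -> R) by exact: measurable_indic.
have me k := measurable_exp_sumX k t.
have mZ (c : R) (f : Omega -> R) : measurable_fun setT f -> measurable_fun setT (fun w => c * f w).
  by move=> mf; exact: measurable_funM.
rewrite -lee_fin !EFinD !EFinM -!integral_exp_sumX//.
have -> : (tail b t)%:E = (\int[P]_w (\1_[set w | b <= sumX t w] w)%:E)%E.
  by rewrite fineK ?fin_num_measure// integral_indic// setIT.
rewrite !integralZ_EFin ?expR_ge0//; try exact: me.
have mf1 := mZ (expR (h * L)) _ mt.
have mf2 := mZ (expR (eta * b)) _ (me (h - eta)).
have mf3 := mZ (expR (- (eta * L))) _ (me (h + eta)).
have ind0 w : 0 <= \1_[set w | b <= sumX t w] w :> R by rewrite indicE.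
have q1 w : 0 <= expR (h * L) * \1_[set w | b <= sumX t w] w by rewrite mulr_ge0 ?expR_ge0.
have q2 w : 0 <= expR (eta * b) * expR ((h - eta) * sumX t w) by rewrite mulr_ge0 ?expR_ge0.
have q3 w : 0 <= expR (- (eta * L)) * expR ((h + eta) * sumX t w) by rewrite mulr_ge0 ?expR_ge0.
rewrite (integralD_EFin P mf1 mf2 q1 q2) (integralD_EFin P (measurable_funD mf1 mf2) mf3 _ q3); last first.
  by move=> w; rewrite addr_ge0.
apply: le_integral_EFin => [||w|w].
- exact: me.
- by apply: measurable_funD => //; exact: measurable_funD.
- exact: expR_ge0.
set x := sumX t w.
have p1 : 0 <= expR (h * L) * \1_[set w | b <= sumX t w] w by rewrite mulr_ge0 ?expR_ge0.
have p2 : 0 <= expR (eta * b) * expR ((h - eta) * x) by rewrite mulr_ge0 ?expR_ge0.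
have p3 : 0 <= expR (- (eta * L)) * expR ((h + eta) * x) by rewrite mulr_ge0 ?expR_ge0.
have [xb|bx] := ltP x b.
  apply: (@le_trans _ _ (expR (eta * b) * expR ((h - eta) * x))); last first.
    by rewrite -addrA addrCA lerDl addr_ge0.
  rewrite -expRD ler_expR; have : eta * x <= eta * b by rewrite ler_wpM2l// ltW.
  lra.
have [Lx|xL] := ltP L x.
  apply: (@le_trans _ _ (expR (- (eta * L)) * expR ((h + eta) * x))); last first.
    by rewrite lerDr addr_ge0.
  rewrite -expRD ler_expR; have : eta * L <= eta * x by rewrite ler_wpM2l// ltW.
  lra.
apply: (@le_trans _ _ (expR (h * L) * \1_[set w | b <= sumX t w] w)); last first.
  by rewrite -addrA lerDl addr_ge0.
by rewrite indicE mem_set// mulr1 ler_expR ler_wpM2l.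
Qed.

End quenched.

(** * The annealed large deviation estimates *)

Section exponents.
Context {R : realFieldType}.
Variables (e r : R).
Hypotheses (e0 : 0 < e) (e1 : e <= 1) (r0 : 0 < r).
Local Notation rho := (e ^+ 2 / 26).

Let re3 : r * (e ^+ 2 * e) <= r * e ^+ 2.
Proof. by rewrite ler_wpM2l ?(ltW r0)// ler_piMr// sqr_ge0. Qed.

Let re4 : r * (e ^+ 2 * e ^+ 2) <= r * e ^+ 2.
Proof. by rewrite ler_wpM2l ?(ltW r0)// ler_piMr ?sqr_ge0// exprn_ile1// ltW. Qed.

(** The tilts 1, 1 + e and 1 + 2 e are multiples of the optimal one, and r is the rate. With rho = 0
    the middle exponent exceeds either outer one by exactly e^2 r / 2. The errors cost at most 13
    rho r / 2 = e^2 r / 4, since (1 + e)^2 + (1 + 2 e)^2 <= 13, whence the 26; what remains is at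
    least 2. *)
Lemma tilt_gap_left : 8 <= r * e ^+ 2 ->
  e * r + (1 + rho) * (1 ^+ 2 * (r / 2)) <= (1 - rho) * ((1 + e) ^+ 2 * (r / 2)) - 2.
Proof. by move: re3 re4; lra. Qed.

Lemma tilt_gap_right : 8 <= r * e ^+ 2 ->
  - (e * (1 + 2 * e) * r) + (1 + rho) * ((1 + 2 * e) ^+ 2 * (r / 2)) <=
  (1 - rho) * ((1 + e) ^+ 2 * (r / 2)) - 2.
Proof. by move: re3 re4; lra. Qed.

(** Twice the cost divided by r is at most 1 + 4 e + 3 e^2 + rho (1 + e)^2 <= 1 + 8 e. One more e is
    set aside to pay for a factor 2. *)
Lemma tilt_cost :
  (1 + e) * (1 + 2 * e) * r + - (r / 2 * (1 + 9 * e)) + r / 2 * e <=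
  (1 - rho) * ((1 + e) ^+ 2 * (r / 2)).
Proof.
have re2 : r * (e * e) <= r * e by rewrite ler_wpM2l ?(ltW r0)// ler_piMr// ltW.
have re1 : 0 <= r * e by rewrite mulr_ge0// ltW.
by move: re1 re2 re3 re4; lra.
Qed.

End exponents.

(** * Annealed transform and tails *)

Section annealed.
Context {dO : measure_display} {Omega : measurableType dO} {R : realType}.
Variables (P : probability Omega R) (T : zmodType) (xi : T -> {RV P >-> R}).
Variable (E1 : @mean R T setT).
Implicit Types t : seq T.
Local Notation W := (W E1).
Local Notation gsum := (gsum E1).
Local Notation ret := (ret E1).
Local Notation qmgf := (qmgf xi 0).
Local Notation tail := (tail xi).
Variables (C v v2 theta : R).
Hypothesis C0 : 0 < C.
Hypothesis retC : forall n x, ret n x <= heat C n.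
Hypothesis E1_opp : forall f, bnd setT f -> E1 (fun y => f (- y)) = E1 f.
Hypothesis E1_com : commuting E1.
Hypothesis vub : forall n, 1 + 2 * gsum n 0 <= v.
Hypothesis vlim : forall e, 0 < e -> exists K, forall k, (K <= k)%N -> v - e <= 1 + 2 * gsum k 0.
Hypothesis X_ind : mutually_independent P (fun i => xi i : Omega -> R).
Hypothesis X_law : forall i j, same_law P (xi i : Omega -> R) (xi j).
Hypothesis int_exp : forall s, 0 <= s <= theta ->
  P.-integrable setT (EFin \o (fun w => expR (s * xi 0 w))).
Hypothesis v20 : 0 < v2.
Hypothesis xi_mgf : forall delta : R, 0 < delta <= 1 / 2 -> exists2 s0, 0 < s0 <= theta &
  forall s, 0 <= s <= s0 -> expR ((1 - delta) * (s ^+ 2 * v2 / 2)) <= mgf (xi 0) s <=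
    expR ((1 + delta) * (s ^+ 2 * v2 / 2)).

Let v1 : 1 <= v. Proof. exact: v_ge1 vub. Qed.
Let vp : 0 < v. Proof. exact: lt_le_trans ltr01 v1. Qed.

Ltac only_goal := clear - E1 C0 retC E1_opp E1_com vub vlim X_ind X_law int_exp v20 xi_mgf v1 vp.
Ltac arith := only_goal; lra.
Ltac arith2 := only_goal; nra.


Lemma annealed_mgf (rho : R) : 0 < rho <= 1 ->
  exists2 s1, 0 < s1 & exists2 c0, 0 < c0 & exists K, forall n c, c ^+ 3 = n%:R -> K <= c ->
  exists A : seq T -> bool, [/\ W n 0 (fun t => (~~ A t)%:R) <= expR (- (c0 * c)),
    forall t h, A t -> 0 <= h -> h * c <= s1 -> forall y, h * (count_mem y t)%:R <= theta,
    forall h, bnd (sized n) (fun t => qmgf h t * (A t)%:R) \/ ~ (0 <= h /\ h * c <= s1),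
    forall h, 0 <= h -> h * c <= s1 ->
      W n 0 (fun t => qmgf h t * (A t)%:R) <= expR ((1 + rho) * (h ^+ 2 * v2 * (n%:R * v) / 2)) &
    forall h, 0 <= h -> h * c <= s1 -> 4 <= h ^+ 2 * v2 * n%:R ->
      expR ((1 - rho) * (h ^+ 2 * v2 * (n%:R * v) / 2)) <= W n 0 (fun t => qmgf h t * (A t)%:R)].
Proof.
move=> /andP[r0 r1].
have hw e := @exp_selfint_bounds _ _ E1 C v C0 retC E1_opp E1_com vub vlim e.
have := @excess_ge0 _ _ E1 C v C0 vub; move: (excess C v) hw => ex hw ex0.
(* The error [delta] comes from the scenery and [eps] from V_n, where [ex] multiplies it in the
   upper exponent. As v >= 1, the combined errors are (1 + rho / 3) (1 + rho / 6) <= 1 + rho and (1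
   - rho / 3)^2 >= 1 - rho. *)
pose delta := rho / 3; pose eps := rho / (6 * (ex + 1)).
have ex10 : 0 < 6 * (ex + 1) by move: ex0; arith.
have eps0 : 0 < eps by rewrite divr_gt0.
have eps_le : eps * (6 * (ex + 1)) = rho by rewrite /eps mulrVK// unitfE gt_eqF.
have exeps0 : 0 <= ex * eps by rewrite mulr_ge0// ltW.
have eps6 : 6 * eps <= rho by move: exeps0 eps_le; arith.
have exeps : 6 * (ex * eps) <= rho by move: eps0 eps_le; arith.
clearbody eps; clear ex10 eps_le exeps0.
have delta12 : 0 < delta <= 1 / 2 by rewrite /delta; move: r0 r1; arith.
have eps12 : 0 < eps <= 1 / 2 by rewrite eps0 /=; move: r1 eps6; arith.
have [s0 /andP[s00 s0t] hs0] := xi_mgf delta12.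
have [dw dw0 [c0 c00 [c1 hc1]]] := hw eps eps12.
(* The condition h c <= s1 keeps h times every local time on A below [s0], and gives lam c^2 <= [dw]
   for lam = (1 + delta) h^2 v2 / 2. *)
pose s1 := Num.min s0 (Num.min 1 (dw / v2)).
have s10 : 0 < s1 by rewrite !lt_min s00 ltr01 divr_gt0.
exists s1 => //; exists c0 => //; exists (Num.max c1 1) => n c cn.
rewrite ge_max => /andP[cc1 c_1].
have [A [hcount hbad hup hlow]] := hc1 n c cn cc1.
have cnt t h : A t -> 0 <= h -> h * c <= s1 -> forall y, h * (count_mem y t)%:R <= s0.
  move=> At h0 hs y; apply: (@le_trans _ _ (h * c)); first by rewrite ler_wpM2l// hcount.
  by apply: le_trans hs _; rewrite ge_min lexx.
have qb t h : A t -> 0 <= h -> h * c <= s1 ->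
    expR ((1 - delta) * (h ^+ 2 * v2 / 2) * (selfint t)%:R) <= qmgf h t <=
    expR ((1 + delta) * (h ^+ 2 * v2 / 2) * (selfint t)%:R).
  by move=> At h0 hs; apply: (qmgf_bounds hs0 h0); exact: cnt.
have bE (lam : R) : bnd (sized n) (fun t => expR (lam * (selfint t)%:R) * (A t)%:R).
  by apply: bndM; [exact: bnd_exp_selfint|exact: bnd_bool].
have bq h : 0 <= h -> h * c <= s1 -> bnd (sized n) (fun t => qmgf h t * (A t)%:R).
  move=> h0 hs; apply: bnd_ge0_le (bE ((1 + delta) * (h ^+ 2 * v2 / 2))) => t _.
  case At : (A t); last by rewrite !mulr0 lexx.
  rewrite !mulr1; have /andP[q1 q2] := qb t h At h0 hs.
  by rewrite q2 (le_trans (expR_ge0 _) q1).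
have v20' := ltW v20; have n0 : 0 <= n%:R :> R by exact: ler0n.
exists A; split => //.
- by move=> t h At h0 hs y; apply: le_trans (cnt t h At h0 hs y) s0t.
- move=> h; have [[h0 hs]|nh] := pselect (0 <= h /\ h * c <= s1); [by left; exact: bq|by right].
- move=> h h0 hs.
  have hv0 : 0 <= h ^+ 2 * v2 / 2 by rewrite !mulr_ge0 ?exprn_ge0.
  pose lam := (1 + delta) * (h ^+ 2 * v2 / 2).
  have l0 : 0 <= lam by rewrite mulr_ge0// /delta; lra.
  have lc : lam * c ^+ 2 <= dw.
    have hc0 : 0 <= h * c by rewrite mulr_ge0//; move: c_1; arith.
    have hc1' : h * c <= 1 by apply: le_trans hs _; rewrite !ge_min lexx orbT.
    have hcd : h * c * v2 <= dw.
      by rewrite -ler_pdivlMr//; apply: le_trans hs _; rewrite !ge_min lexx !orbT.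
    have e1 : lam * c ^+ 2 = (1 + delta) / 2 * ((h * c) * (h * c * v2)) by rewrite /lam; ring.
    rewrite e1; have a1 : (h * c) * (h * c * v2) <= dw.
      apply: le_trans hcd; rewrite ler_piMl// mulr_ge0//.
    have a0 : 0 <= (h * c) * (h * c * v2) by rewrite !mulr_ge0//; lra.
    have d2 : (1 + delta) / 2 <= 1 by rewrite /delta; lra.
    by apply: le_trans a1; rewrite ler_piMl.
  apply: (@le_trans _ _ (W n 0 (fun t => expR (lam * (selfint t)%:R) * (A t)%:R))).
    apply: W_le => [||t _]; [exact: bq|exact: bE|].
    case At : (A t); last by rewrite !mulr0.
    by rewrite !mulr1; have /andP[] := qb t h At h0 hs.
  apply: le_trans (hup lam l0 lc) _; rewrite ler_expR.
  set Y := h ^+ 2 * v2 / 2 in hv0 lam l0 lc *.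
  have -> : h ^+ 2 * v2 * (n%:R * v) / 2 = Y * n%:R * v by rewrite /Y; ring.
  have Yn : 0 <= Y * n%:R by rewrite mulr_ge0.
  have vex : v + ex * eps <= v * (1 + rho / 6).
    have : rho / 6 <= v * (rho / 6) by rewrite ler_peMl// divr_ge0// ltW.
    lra.
  rewrite /lam.
  have d1 : 0 <= 1 + delta by rewrite /delta; move: r0; arith.
  have Yn1 : 0 <= (1 + delta) * Y * n%:R by rewrite -[_ * n%:R]mulrA mulr_ge0.
  apply: le_trans (ler_wpM2l Yn1 vex) _.
  have Ynv : 0 <= Y * n%:R * v by rewrite mulr_ge0//; move: v1; arith.
  have dd : (1 + delta) * (1 + rho / 6) <= 1 + rho.
    have : rho * rho <= rho by rewrite ler_piMl// ltW.
    by rewrite /delta; lra.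
  by have := ler_wpM2r Ynv dd; lra.
- move=> h h0 hs h4.
  have hv0 : 0 <= h ^+ 2 * v2 / 2 by rewrite !mulr_ge0 ?exprn_ge0.
  pose lam := (1 - delta) * (h ^+ 2 * v2 / 2).
  have d1 : 0 <= 1 - delta by rewrite /delta; lra.
  have l0 : 0 <= lam by rewrite mulr_ge0.
  have ln : 1 <= lam * n%:R.
    have e1 : lam * n%:R = (1 - delta) / 2 * (h ^+ 2 * v2 * n%:R) by rewrite /lam; ring.
    rewrite e1; have d3 : 0 <= (1 - delta) / 2 by rewrite /delta; lra.
    by have := ler_wpM2l d3 h4; rewrite /delta; lra.
  apply: (@le_trans _ _ (W n 0 (fun t => expR (lam * (selfint t)%:R) * (A t)%:R))); last first.
    apply: W_le => [||t _]; [exact: bE|exact: bq|].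
    case At : (A t); last by rewrite !mulr0.
    by rewrite !mulr1; have /andP[] := qb t h At h0 hs.
  apply: le_trans _ (hlow lam l0 ln); rewrite ler_expR.
  set Y := h ^+ 2 * v2 / 2 in hv0 lam l0 ln *.
  have -> : h ^+ 2 * v2 * (n%:R * v) / 2 = Y * n%:R * v by rewrite /Y; ring.
  have vex : v * (1 - rho / 3) <= v - 2 * eps.
    have : rho / 3 <= v * (rho / 3) by rewrite ler_peMl// divr_ge0// ltW.
    lra.
  rewrite /lam.
  have Yn1 : 0 <= (1 - delta) * Y * n%:R by rewrite !mulr_ge0.
  apply: le_trans _ (ler_wpM2l Yn1 vex).
  have Ynv : 0 <= Y * n%:R * v by rewrite !mulr_ge0//; move: v1; arith.
  have dd : 1 - rho <= (1 - delta) * (1 - rho / 3).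
    have : 0 <= rho * rho by rewrite mulr_ge0// ltW.
    by rewrite /delta; lra.
  by have := ler_wpM2r Ynv dd; lra.
Qed.

Lemma bnd_tail b n : bnd (sized n) (tail b).
Proof. by exists 1 => t _; rewrite ger0_norm ?tail_ge0 ?tail_le1. Qed.

(* Twice the large deviation cost; the optimal tilt is b / (n v v2). *)
Definition rate (n : nat) (b : R) : R := b ^+ 2 / (n%:R * v * v2).

(** Since n = c^3, the square of h c at h = k b / (n v v2) is k^2 [rate n b] / (c v v2), so it is
    enough that the rate is small against c. The range of k covers the tilts of both estimates. *)
Lemma tilt_bound (s1 : R) : 0 < s1 -> exists K, forall n c b k, c ^+ 3 = n%:R -> 1 <= c -> 0 < b ->
  0 <= k <= 3 -> K * rate n b <= c -> k * b / (n%:R * v * v2) * c <= s1.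
Proof.
move=> s10; exists (9 / (v * v2 * s1 ^+ 2)) => n c b k cn c1 b0 /andP[k0 k3] hK.
have c0 : 0 < c by lra.
rewrite -cn in hK *; rewrite /rate -cn in hK.
have V0 : 0 < c ^+ 3 * v * v2 by rewrite !mulr_gt0 ?exprn_gt0.
rewrite -(@ler_pXn2r _ 2) ?nnegrE ?(ltW s10)//; last first.
  by rewrite mulr_ge0 ?divr_ge0 ?mulr_ge0// ?ltW.
have e1 : (k * b / (c ^+ 3 * v * v2) * c) ^+ 2 = k ^+ 2 * (b ^+ 2 / (c ^+ 3 * v * v2) / (c * v * v2)).
  by field; rewrite !gt_eqF.
rewrite e1.
have e2 : 9 * (b ^+ 2 / (c ^+ 3 * v * v2) / (c * v * v2)) <= s1 ^+ 2.
  set r := b ^+ 2 / (c ^+ 3 * v * v2) in hK *.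
  rewrite mulrA ler_pdivrMr ?mulr_gt0//.
  have den : 0 < v * v2 * s1 ^+ 2 by rewrite !mulr_gt0 ?exprn_gt0.
  move: hK; rewrite mulrAC ler_pdivrMr//; lra.
apply: le_trans e2; apply: ler_wpM2r.
  by rewrite !divr_ge0 ?exprn_ge0 ?mulr_ge0 ?exprn_ge0// ltW.
by have : k ^+ 2 <= 3 ^+ 2; [apply: lerXn2r; rewrite ?nnegrE//|lra].
Qed.

Lemma tilt_sq n b k : 0 < n%:R :> R -> (k * b / (n%:R * v * v2)) ^+ 2 * v2 * (n%:R * v) / 2 = k ^+ 2 * (rate n b / 2).
Proof. by move=> n0; rewrite /rate; field; rewrite !gt_eqF. Qed.

Lemma expR_ge2 (x : R) : 1 <= x -> 2 <= expR x.
Proof. by move=> x1; apply: le_trans (expR_ge1Dx x); lra. Qed.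

Lemma annealed_upper (kappa : R) : 0 < kappa <= 1 -> exists K, forall n c b,
  c ^+ 3 = n%:R -> 0 < b -> K <= c -> K <= rate n b -> K * rate n b <= c ->
  W n 0 (tail b) <= expR (- (rate n b / 2 * (1 - kappa))).
Proof.
move=> /andP[k0 k1]; have k2 : 0 < kappa / 2 <= 1 by lra.
have [s1 s10 [c0 c00 [K1 hK1]]] := annealed_mgf k2.
have [K2 hK2] := tilt_bound s10.
(* Here c0^-1 makes the probability of the complement of A at most exp(- r), and 4 / kappa gives 2
   <= exp(r kappa / 4), which pays for adding two terms. *)
pose K := Num.max (Num.max K1 1) (Num.max (Num.max K2 c0^-1) (4 / kappa)).
exists K => n c b cn b0; rewrite !ge_max => /andP[/andP[a1 a2] _] /andP[/andP[_ _] /andP[/andP[_ _] r1]] hc.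
have rp : 0 < rate n b by apply: lt_le_trans r1; rewrite divr_gt0.
have Kr x : x <= K -> x * rate n b <= c by move=> xK; apply: le_trans hc; rewrite ler_wpM2r// ltW.
have [A [hbad hth bq hup _]] := hK1 n c cn a1.
have np : 0 < n%:R :> R by rewrite -cn exprn_gt0//; lra.
pose h := 1 * b / (n%:R * v * v2).
have h0 : 0 <= h by rewrite divr_ge0 ?mulr_ge0 ?(ltW np) ?(ltW v20) ?(ltW b0) ?(ltW vp).
have hs : h * c <= s1.
  apply: hK2 => //; first by rewrite ler01 ler1n.
  by apply: Kr; rewrite !le_max lexx !orbT.
have {}bq : bnd (sized n) (fun t => qmgf h t * (A t)%:R) by case: (bq h) => // [[]].
have bA : bnd (sized n) (fun t => (~~ A t)%:R : R) by exact: bnd_bool.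
apply: (@le_trans _ _ (W n 0 (fun t => (~~ A t)%:R + expR (- (h * b)) * (qmgf h t * (A t)%:R)))).
  apply: W_le => [||t _]; first exact: bnd_tail.
    by apply: bndD => //; exact: bndZ.
  case At : (A t); last by rewrite !mulr0 addr0; exact: tail_le1.
  by rewrite add0r mulr1; apply: (tail_le X_ind X_law int_exp) => //; exact: hth.
rewrite WD//; last by exact: bndZ.
rewrite WZ//.
have hup' := hup h h0 hs; rewrite tilt_sq// expr1n mul1r in hup'.
set r := rate n b in rp r1 Kr hup' *.
have hbE : h * b = r by rewrite /h /r /rate; ring.
have bad : W n 0 (fun t => (~~ A t)%:R) <= expR (- r).
  apply: le_trans hbad _; rewrite ler_expR lerN2.
  have := Kr c0^-1; rewrite !le_max lexx !orbT => /(_ isT).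
  by rewrite mulrC ler_pdivrMr// mulrC.
have main : expR (- (h * b)) * W n 0 (fun t => qmgf h t * (A t)%:R) <= expR (- (r / 2 * (1 - kappa / 2))).
  apply: le_trans (ler_wpM2l (expR_ge0 _) hup') _.
  by rewrite -expRD ler_expR hbE; lra.
have rk : 1 <= r / 2 * (kappa / 2).
  by move: r1; rewrite ler_pdivrMr//; lra.
have two : 2 <= expR (r / 2 * (kappa / 2)) by exact: expR_ge2.
have bad2 : expR (- r) <= expR (- (r / 2 * (1 - kappa / 2))).
  have : 0 <= r * kappa by rewrite mulr_ge0// ltW.
  by rewrite ler_expR lerN2; lra.
have -> : - (r / 2 * (1 - kappa)) = r / 2 * (kappa / 2) + - (r / 2 * (1 - kappa / 2)) by field.
rewrite expRD; have e0 := expR_ge0 (- (r / 2 * (1 - kappa / 2))).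
by have := ler_wpM2r e0 two; lra.
Qed.

(** The middle tilt is 1 + e times the optimal one, so that under it the sum should settle near (1 +
    e) b, strictly between b and L. The pieces outside are compared with the tilts 1 and 1 + 2 e,
    where upper bounds for the transform suffice. *)
Lemma annealed_lower (e : R) : 0 < e <= 1 -> exists K, forall n c b,
  c ^+ 3 = n%:R -> 0 < b -> K <= c -> K <= rate n b -> K * rate n b <= c ->
  expR (- (rate n b / 2 * (1 + 9 * e))) <= W n 0 (tail b).
Proof.
move=> /andP[e0 e1].
pose rho := e ^+ 2 / 26.
have e2 : e ^+ 2 <= 1 by rewrite exprn_ile1// ltW.
have e20 : 0 < e ^+ 2 by rewrite exprn_gt0.
have r01 : 0 < rho <= 1 by rewrite /rho; lra.
have [rho0 rho1] := andP r01.
have [s1 s10 [c0 c00 [K1 hK1]]] := annealed_mgf r01.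
have [K2 hK2] := tilt_bound s10.
(* The entry 4 v admits the lower bound for the transform at the middle tilt, 8 / e^2 the two gaps
   between exponents, and 2 / e turns a lost factor 2 into exp(r e / 2). *)
pose K := Num.max (Num.max K1 1) (Num.max K2 (Num.max (4 * v) (Num.max (8 / e ^+ 2) (2 / e)))).
exists K => n c b cn b0; rewrite !ge_max => /andP[/andP[a1 a2] _] /andP[_ /andP[_ /and3P[r1 r2 r3]]] hc.
have rp : 0 < rate n b by apply: lt_le_trans r1; exact: mulr_gt0.
have Kr x : x <= K -> x * rate n b <= c by move=> xK; apply: le_trans hc; rewrite ler_wpM2r// ltW.
have [A [_ hth bq hup hlow]] := hK1 n c cn a1.
have np : 0 < n%:R :> R by rewrite -cn exprn_gt0//; lra.
have Vp : 0 < n%:R * v * v2 by rewrite !mulr_gt0.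
pose hh k := k * b / (n%:R * v * v2).
have hh0 k : 0 <= k -> 0 <= hh k by move=> k0; rewrite divr_ge0 ?(ltW Vp)// mulr_ge0// ltW.
have hs k : 0 <= k <= 3 -> hh k * c <= s1.
  move=> hk; apply: hK2 => //.
  by apply: Kr; rewrite !le_max lexx !orbT.
have bq' k : 0 <= k <= 3 -> bnd (sized n) (fun t => qmgf (hh k) t * (A t)%:R).
  move=> hk; have := bq (hh k) => -[//|[]]; split; last exact: hs.
  by apply: hh0; case/andP: hk.
have i0 : 0 <= (1 : R) <= 3 by rewrite ler01 ler1n.
have i1 : 0 <= 1 + e <= 3 by move: e0 e1; arith.
have i2 : 0 <= 1 + 2 * e <= 3 by move: e0 e1; arith.
set r := rate n b in rp r1 r2 r3 Kr *.
pose h := hh (1 + e); pose eta := hh e; pose L := b * (1 + 2 * e).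
have hm : h - eta = hh 1 by rewrite /h /eta /hh; ring.
have hp : h + eta = hh (1 + 2 * e) by rewrite /h /eta /hh; ring.
have hL : h * L = (1 + e) * (1 + 2 * e) * r by rewrite /h /hh /L /r /rate; ring.
have etab : eta * b = e * r by rewrite /eta /hh /r /rate; ring.
have etaL : eta * L = e * (1 + 2 * e) * r by rewrite /eta /hh /L /r /rate; ring.
have h4 : h ^+ 2 * v2 * n%:R = (1 + e) ^+ 2 * (r / v).
  by rewrite /h /hh /r /rate; field; rewrite !gt_eqF.
have bL : b <= L by rewrite /L ler_peMr ?(ltW b0)// lerDl mulr_ge0// ltW.
have g0 : 0 <= h by apply: hh0; rewrite addr_ge0// ltW.
have g1 : 0 <= hh 1 by exact: hh0.
have g2 : 0 <= hh (1 + 2 * e) by apply: hh0; case/andP: i2.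
have eta0 : 0 <= eta by apply: hh0; exact: ltW.
have eh : eta <= h by rewrite -subr_ge0 hm.
have hs0 := hs _ i1; have hs1 := hs _ i0; have hs2 := hs _ i2.
have q0 := bq' _ i1; have q1 := bq' _ i0; have q2 := bq' _ i2.
have th t : A t -> forall y, (h + eta) * (count_mem y t)%:R <= theta.
  by move=> At; apply: hth; rewrite ?hp.
rewrite -/h in hs0 q0.
have low : expR ((1 - rho) * ((1 + e) ^+ 2 * (r / 2))) <= W n 0 (fun t => qmgf h t * (A t)%:R).
  have := hlow h; rewrite tilt_sq//; apply => //.
  rewrite h4; have rv : 4 <= r / v by rewrite ler_pdivlMr.
  have e11 : 1 <= (1 + e) ^+ 2 by rewrite exprn_ege1// lerDl ltW.
  by apply: le_trans rv _; rewrite ler_peMl// divr_ge0// ltW.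
have up1 := hup _ g1 hs1.
have up2 := hup _ g2 hs2.
rewrite tilt_sq// -/r in up1; rewrite tilt_sq// -/r in up2.
have re : 8 <= r * e ^+ 2 by rewrite -ler_pdivrMr.
have two : 2 <= expR (r / 2 * e).
  by apply: expR_ge2; move: r3; rewrite ler_pdivrMr//; arith.
have gl := tilt_gap_left e0 e1 rp re; have gr := tilt_gap_right e0 e1 rp re.
have gc := tilt_cost e0 e1 rp.
rewrite -/rho in gl gr gc.
move: (hh 1) (hh (1 + 2 * e)) hm hp g1 g2 q1 q2 up1 up2 => k1 k2 hm hp g1 g2 q1 q2 up1 up2.
clearbody r rho h eta L; clear hlow hup bq bq' hth hs hs0 hs1 hs2 i0 i1 i2 hh hh0.
have tot : W n 0 (fun t => qmgf h t * (A t)%:R) <=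
    expR (h * L) * W n 0 (tail b) + expR (eta * b) * W n 0 (fun t => qmgf k1 t * (A t)%:R)
    + expR (- (eta * L)) * W n 0 (fun t => qmgf k2 t * (A t)%:R).
  have bt := bnd_tail b n.
  have bc (x : R) (f : seq T -> R) : bnd (sized n) f -> bnd (sized n) (fun t => x * f t).
    by move=> hf; exact: bndZ.
  rewrite -!WZ// -!WD; [|by apply: bndD; exact: bc|exact: bc|exact: bc|exact: bc].
  apply: W_le => [||t _]; first exact: q0.
    by apply: bndD; [apply: bndD|]; exact: bc.
  case At : (A t); last by rewrite !mulr0 !addr0; apply: mulr_ge0; [exact: expR_ge0|exact: tail_ge0].
  rewrite !mulr1 -hm -hp; apply: (tail_ge X_ind X_law int_exp bL).
    by rewrite eta0 eh.
  exact: th.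
set B := (1 - rho) * ((1 + e) ^+ 2 * (r / 2)) in low gl gr gc.
have B1 : expR (eta * b) * W n 0 (fun t => qmgf k1 t * (A t)%:R) <= expR (B - 2).
  apply: le_trans (ler_wpM2l (expR_ge0 _) up1) _.
  by rewrite -expRD ler_expR etab.
have B2 : expR (- (eta * L)) * W n 0 (fun t => qmgf k2 t * (A t)%:R) <= expR (B - 2).
  apply: le_trans (ler_wpM2l (expR_ge0 _) up2) _.
  by rewrite -expRD ler_expR etaL.
clearbody B.
(* Each outer piece takes at most a quarter of exp(B), because exp(2) >= 4; half of it is left for
   the tail. *)
have q4 : expR (B - 2) <= expR B / 4.
  rewrite expRD ler_wpM2l ?expR_ge0// expRN lef_pV2 ?posrE ?expR_gt0//.
  have := expR_ge2 (lexx 1).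
  have -> : expR 2 = expR 1 * expR 1 :> R by rewrite -expRD -natr1.
  by arith2.
have half : expR B / 2 <= expR (h * L) * W n 0 (tail b).
  by move: low tot B1 B2 q4; arith.
rewrite -(ler_pM2l (expR_gt0 (h * L))); apply: le_trans half.
rewrite ler_pdivlMr//; apply: le_trans (ler_wpM2l (mulr_ge0 (expR_ge0 _) (expR_ge0 _)) two) _.
by rewrite -!expRD ler_expR hL.
Qed.

End annealed.

(** * Random walk in random scenery *)

Section walk_in_scenery.
Context {dO : measure_display} {Omega : measurableType dO} {R : realType}.
Variables (P : probability Omega R) (d : nat).
Variables (S : nat -> {RV P >-> lattice d}) (xi : lattice d -> {RV P >-> R}).

Lemma rwrs_path n w : rwrs S xi n w = sumX xi (path S n w) w.
Proof.
elim: n => [|n IH]; first by rewrite /rwrs big_geq// /sumX big_nil.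
rewrite /rwrs big_nat_recr//= -/(rwrs S xi n w) IH /sumX.
by rewrite -[in RHS]cats1 big_cat big_seq1.
Qed.

Lemma generated_sumX b t :
  generated_events (fun z => xi z : Omega -> R) [set w | b <= sumX xi t w].
Proof.
set G := \bigcup_i preimage_set_system setT (xi i) measurable.
have mxi i : measurable_fun (setT : set (g_sigma_algebraType G)) (xi i : Omega -> R).
  move=> _ B mB; apply: sub_gen_smallest; exists i => //.
  by exists B.
have ms : measurable_fun (setT : set (g_sigma_algebraType G)) (sumX xi t : Omega -> R).
  by apply: measurable_sum.
rewrite /generated_events -/G (_ : [set _ | _] = setT `&` sumX xi t @^-1` `[b, +oo[); last first.
  by rewrite setTI; apply/seteqP; split=> w /=; rewrite in_itv /= andbT.
exact: ms.
Qed.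

Lemma prob_rwrs n b : random_walk S -> independent_families P S xi ->
  fine (P [set w | b <= rwrs S xi n w]) = W (E1 S) n 0 (tail xi b).
Proof.
move=> RW ind; rewrite -[RHS]/(fine (W (E1 S) n 0 (tail xi b))%:E); congr fine.
rewrite -(prob_along_path RW (B := fun t => [set w | b <= sumX xi t w])).
- by congr (P _); apply/seteqP; split=> w /=; rewrite rwrs_path.
- by move=> t; exact: measurable_tail.
- by move=> t; apply: ind; [exact: generated_path|exact: generated_sumX].
Qed.

End walk_in_scenery.

(** * The range of b_n *)

Section growth.
Context {R : realType}.
Variables (b : nat -> R) (v v2 : R).
Hypothesis v0 : 0 < v.
Hypothesis v20 : 0 < v2.
Hypothesis b_gt0 : forall n, (0 < n)%N -> 0 < b n.
Hypothesis b_lower : negligible_to (fun n => n%:R `^ (1 / 2)) b.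
Hypothesis b_upper : negligible_to b (fun n => n%:R `^ (2 / 3)).

Lemma powR_divn_exp (x : R) k m : (0 < m)%N -> 0 <= x -> (x `^ (k%:R / m%:R)) ^+ m = x ^+ k.
Proof.
move=> m0 x0; rewrite -powR_mulrn ?powR_ge0// -powRrM mulfVK ?powR_mulrn//.
by rewrite pnatr_eq0 -lt0n.
Qed.

Lemma eventually_le (u w : nat -> R) e : negligible_to u w -> (forall n, (0 < n)%N -> 0 < w n) ->
  0 < e -> \forall n \near \oo, u n <= e * w n.
Proof.
move=> /cvgrPdist_le h w0 e0; have := h _ e0 => hn.
near=> n; have n0 : (0 < n)%N by near: n; exists 1%N.
rewrite -ler_pdivrMr ?w0//.
have : `|0 - u n / w n| <= e by near: n.
by rewrite sub0r normrN ler_norml => /andP[].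
Unshelve. all: by end_near. Qed.

(** The lower condition makes b_n^2 / n large; the upper one makes it small against n^(4/3) / n =
    n^(1/3) = c. *)
Lemma eventually_rate K : 0 < K -> \forall n \near \oo,
  let c := n%:R `^ (1 / 3) in let r := rate v v2 n (b n) in
  [/\ (0 < n)%N, c ^+ 3 = n%:R, K <= c, K <= r & K * r <= c].
Proof.
move=> K0; have V0 : 0 < v * v2 by rewrite mulr_gt0.
have KV0 : 0 < K * (v * v2) + 1 by rewrite addr_gt0// mulr_gt0.
pose e1 := (K * (v * v2) + 1)^-1; pose e2 := v * v2 / (K + v * v2).
have e10 : 0 < e1 by rewrite invr_gt0.
have e20 : 0 < e2 by rewrite divr_gt0// addr_gt0.
have hl := eventually_le b_lower b_gt0 e10.
have hu : \forall n \near \oo, b n <= e2 * n%:R `^ (2 / 3).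
  by apply: eventually_le => // n n0; rewrite powR_gt0 ?ltr0n.
have hK : \forall n \near \oo, K ^+ 3 <= n%:R :> R by exact: nbhs_infty_ger.
near=> n.
have bl : n%:R `^ (1 / 2) <= e1 * b n by near: n.
have bu : b n <= e2 * n%:R `^ (2 / 3) by near: n.
have Kn : K ^+ 3 <= n%:R by near: n.
set c : R := _ `^ (1 / 3); set r := rate _ _ _ _; cbv zeta.
have n0 : (0 < n)%N by near: n; exists 1%N.
have np : 0 < n%:R :> R by rewrite ltr0n.
have cn : c ^+ 3 = n%:R by rewrite (powR_divn_exp 1).
have c0 : 0 < c by rewrite powR_gt0.
have bn := b_gt0 n0.
have c2 : n%:R `^ (2 / 3) = c ^+ 2.
  by rewrite -powR_mulrn ?powR_ge0// -powRrM; congr powR; field.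
split; [exact: n0|exact: cn| | |].
- by rewrite -(@ler_pXn2r _ 3) ?nnegrE ?(ltW c0) ?(ltW K0)// cn.
- pose s : R := n%:R `^ (1 / 2).
  have s0 : 0 < s by rewrite powR_gt0.
  have s2 : s ^+ 2 = n%:R by rewrite (powR_divn_exp 1).
  have : s <= e1 * b n by exact: bl.
  rewrite /e1 mulrC ler_pdivlMr// => sb.
  have sb1 : s <= b n by apply: le_trans sb; rewrite ler_peMr ?(ltW s0)// lerDr mulr_ge0// ltW.
  have sb2 : n%:R * (K * (v * v2)) <= b n ^+ 2.
    have h1 : s * (s * (K * (v * v2) + 1)) <= b n * b n by apply: ler_pM => //; rewrite ?mulr_ge0// ltW.
    rewrite -s2 expr2 expr2; apply: le_trans h1.
    by rewrite -mulrA ler_pM2l// ler_pM2l// lerDl.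
  by rewrite /r /rate ler_pdivlMr ?mulr_gt0//; apply: le_trans sb2; rewrite le_eqVlt; apply/orP; left; apply/eqP; ring.
- rewrite c2 in bu.
  have e21 : e2 <= 1 by rewrite ler_pdivrMr ?addr_gt0// mul1r lerDr ltW.
  have Ke : K * e2 <= v * v2.
    rewrite /e2 mulrA ler_pdivrMr ?addr_gt0// mulrC ler_wpM2l ?(ltW V0)// lerDl; exact: ltW.
  have b2 : b n ^+ 2 <= e2 * c ^+ 4.
    apply: (@le_trans _ _ ((e2 * c ^+ 2) ^+ 2)); first by apply: lerXn2r => //; rewrite nnegrE; [exact: ltW|apply: mulr_ge0; [exact: ltW|apply: exprn_ge0; exact: ltW]].
    rewrite exprMn -exprM ler_wpM2r ?exprn_ge0 ?(ltW c0)// expr2.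
    by apply: ler_piMr => //; exact: ltW.
  rewrite /r /rate mulrA ler_pdivrMr ?mulr_gt0// -cn.
  apply: le_trans (ler_wpM2l (ltW K0) b2) _.
  have -> : c * (c ^+ 3 * v * v2) = v * v2 * c ^+ 4 by ring.
  by rewrite mulrA ler_wpM2r// exprn_ge0// ltW.
Unshelve. all: by end_near. Qed.

Lemma ln_ratio (p q kappa : R) : 0 < q -> expR (- (q * (1 + kappa))) <= p ->
  p <= expR (- (q * (1 - kappa))) -> `|1 - ln p / (- q)| <= kappa.
Proof.
move=> q0 lo up; have p0 : 0 < p by apply: lt_le_trans lo; exact: expR_gt0.
have {}lo : - (q * (1 + kappa)) <= ln p by rewrite -ler_expR lnK.
have {}up : ln p <= - (q * (1 - kappa)) by rewrite -ler_expR lnK.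
have -> : 1 - ln p / (- q) = (q + ln p) / q by field; rewrite gt_eqF.
rewrite normrM normfV (gtr0_norm q0) ler_pdivrMr// ler_norml.
by apply/andP; split; lra.
Qed.

End growth.

Theorem theorem3 (dO : measure_display) (Omega : measurableType dO)
    (R : realType) (P : probability Omega R) (d : nat)
    (S : nat -> {RV P >-> lattice d}) (xi : lattice d -> {RV P >-> R})
    (sigma : R) (b : nat -> R)
    (d_ge3 : (3 <= d)%N)
    (walkS : walk_assumptions S)
    (sceneryxi : scenery_assumptions xi sigma)
    (walk_indep_scenery : independent_families P S xi)
    (b_gt0 : forall n, (0 < n)%N -> 0 < b n)
    (b_lower : negligible_to (fun n => n%:R `^ (1 / 2)) b)
    (b_upper : negligible_to b (fun n => n%:R `^ (2 / 3))) :
  asymp_equiv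
    (fun n => ln (fine (P [set w | b n <= rwrs S xi n w])))
    (fun n => - (b n ^+ 2 / n%:R)
              * (1 / (2 * sigma ^+ 2 * (2 * fine (green P S 0) - 1)))).
Proof.
case: walkS => RW sym ap _ _.
case: sceneryxi => -[X_ind X_law] X_mean X_var v20 X_third [theta theta0 X_exp].
(* The dimension enters here: three independent atoms give the decay n^(-3/2) of the return
   probabilities. *)
have [y1 [y2 [y3 [ind3 p1 p2 p3]]]] := exists_independent_atoms ap d_ge3.
have [beta b01 atoms] := symmetric_atoms_walk sym p1 p2 p3.
have [C C0 retC] := W_return_le ind3 b01 atoms.
have Eo := E1_opp sym.
have Ec := E1_commuting RW.
have [] := green_limit RW (C := 4 * C) (fun n => gfull_le C0 retC n 0).
set v := 2 * _ - 1 => vub vlim.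
have v1 : 1 <= v by exact: v_ge1 vub.
have v0 : 0 < v by exact: lt_le_trans v1.
have int_exp := integrable_exp (X := xi 0) X_exp.
have xi_mgf delta : 0 < delta <= 1 / 2 -> exists2 s0, 0 < s0 <= theta &
    forall s, 0 <= s <= s0 -> expR ((1 - delta) * (s ^+ 2 * sigma ^+ 2 / 2)) <= mgf (xi 0) s <=
      expR ((1 + delta) * (s ^+ 2 * sigma ^+ 2 / 2)).
  move=> hd; have [s0 /andP[s00 s0t] h] := mgf_bounds theta0 v20 X_mean X_var X_third X_exp hd.
  by exists s0 => //; rewrite s00 (le_trans s0t)// ler_pdivrMr// ler_peMr ?(ltW theta0)// ler1n.
rewrite /asymp_equiv; apply/cvgrPdist_lt => e e0.
pose kappa := Num.min (e / 2) 1.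
have k0 : 0 < kappa by rewrite lt_min divr_gt0 ?ltr01.
have k1 : kappa <= 1 by rewrite ge_min lexx orbT.
have ke : kappa < e.
  by apply: (@le_lt_trans _ _ (e / 2)); [rewrite ge_min lexx|rewrite ltr_pdivrMr// ltr_pMr// ltr1n].
(* The lower estimate loses 9 e in the exponent, so e = kappa / 9 matches the loss kappa of the
   upper one. *)
have k9 : 0 < kappa / 9 <= 1 by rewrite divr_gt0//= ler_pdivrMr// mul1r (le_trans k1)// ler1n.
have [K1 hK1] := annealed_upper C0 retC Eo Ec vub vlim X_ind X_law int_exp v20 xi_mgf
  (introT andP (conj k0 k1)).
have [K2 hK2] := annealed_lower C0 retC Eo Ec vub vlim X_ind X_law int_exp v20 xi_mgf k9.
pose K := Num.max (Num.max K1 K2) 1.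
have K0 : 0 < K by rewrite lt_max ltr01 orbT.
have KK1 : K1 <= K by rewrite !le_max lexx.
have KK2 : K2 <= K by rewrite !le_max lexx !orbT.
have := eventually_rate v0 v20 b_gt0 b_lower b_upper K0.
apply: filterS => n [n0 cn Kc Kr rc].
apply: le_lt_trans ke; rewrite (prob_rwrs n (b n) RW walk_indep_scenery).
set c := _ `^ _ in cn Kc rc; set r := rate _ _ _ _ in Kr rc.
have r0 : 0 < r by exact: lt_le_trans Kr.
have small x : x <= K -> x * r <= c.
  by move=> xK; apply: le_trans rc; rewrite ler_wpM2r// ltW.
have -> : - (b n ^+ 2 / n%:R) * (1 / (2 * sigma ^+ 2 * v)) = - (r / 2).
  have sn0 : sigma != 0 by move: v20; rewrite exprn_even_gt0.
  have nn0 : n%:R != 0 :> R by rewrite pnatr_eq0 -lt0n.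
  have vn0 : v != 0 by rewrite gt_eqF.
  rewrite /r /rate; clearbody v; by field; rewrite sn0 nn0 vn0.
apply: ln_ratio; first exact: divr_gt0.
  have -> : kappa = 9 * (kappa / 9) by field.
  apply: (hK2 n c (b n)) => //; [exact: b_gt0|exact: le_trans Kc|exact: le_trans Kr|exact: small].
by apply: (hK1 n c (b n)) => //; [exact: b_gt0|exact: le_trans Kc|exact: le_trans Kr|exact: small].
Qed.
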